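(* Suppose that $n_2\le n_1$, and let $(\widehat\pi_{\mathsf{tds}},\widehat\sigma_{\mathsf{tds}})$ be the output of Algorithm 3 (two-dimensional sorting) described in the context. There exists an absolute constant $c_1>0$ such that for any $M^*\in\mathbb{C}_{\mathsf{Perm}}^{\mathsf{r},\mathsf{c}}$, \[ \mathcal R(M^*,\widehat\pi_{\mathsf{tds}})\le 1\wedge c_1\bar\zeta^2\Big(\frac{n_1\log n_1}{N}\Big)^{1/2} \] with probability exceeding $1-9(n_1n_2)^{-3}$. Moreover there exists an absolute constant $c_2>0$ such that, with $\widehat M(\widehat\pi_{\mathsf{tds}},\widehat\sigma_{\mathsf{tds}})=\arg\min_{M\in\mathbb{C}_{\mathsf{BISO}}(\widehat\pi_{\mathsf{tds}},\widehat\sigma_{\mathsf{tds}})}\|Y-M\|_F^2$, \[ \mathcal F\big(M^*,\widehat M(\widehat\pi_{\mathsf{tds}},\widehat\sigma_{\mathsf{tds}})\big)\le1\wedge c_2\Big\{\bar\zeta^2\Big(\frac{n_1\log n_1}{N}\Big)^{3/4}+\vartheta(N,n_1,n_2,\zeta)\Big\} \] with probability exceeding $1-10(n_1n_2)^{-3}$.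
   Context: Let $n_1,n_2$ be positive integers; $a\wedge b=\min$, $a\vee b=\max$; logarithms natural. $\mathbb{C}_{\mathsf{BISO}}$: matrices in $[0,1]^{n_1\times n_2}$ with all rows and columns non-decreasing; $\mathfrak S_n$ permutations of $[n]$, $\mathsf{id}$ identity; $[M(\pi,\sigma)]_{i,j}=M_{\pi(i),\sigma(j)}$; $\mathbb{C}_{\mathsf{BISO}}(\pi,\sigma)=\{M(\pi,\sigma):M\in\mathbb{C}_{\mathsf{BISO}}\}$; $\mathbb{C}_{\mathsf{Perm}}^{\mathsf{r},\mathsf{c}}=\bigcup_{\pi,\sigma}\mathbb{C}_{\mathsf{BISO}}(\pi,\sigma)$. Observation model: fix $N>0$. Draw $N'\sim\mathrm{Poi}(N)$ independently, then $N'$ independent pairs $(X_\ell,y_\ell)$, $X_\ell$ uniform on $\{E^{(i,j)}\}$ ($1$ in entry $(i,j)$, $0$ elsewhere), $y_\ell=\mathrm{trace}(X_\ell^\top M^* )+z_\ell$, $z_\ell$ independent zero-mean with $\mathbb{E}\exp(sz_\ell)\le\exp(\zeta^2s^2)$ for $|s|\le1/\zeta$ ($\zeta>0$). $\bar\zeta=\zeta\vee1$. From a sample, the observation matrix is $Y_{i,j}=\frac{n_1n_2}{N}\sum_{\ell}y_\ell\mathbf 1\{X_\ell=E^{(i,j)}\}$. $\mathcal F(M^*,\widehat M)=\frac1{n_1n_2}\|\widehat M-M^*\|_F^2$. For $M^*\in\mathbb{C}_{\mathsf{BISO}}(\pi^*,\sigma^* )$, $\mathcal R(M^*,\widehat\pi)=\max_i\frac1{n_2}\|[M^*(\pi^*,\sigma^*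 )]_i-[M^*(\widehat\pi,\sigma^* )]_i\|_2^2$ ($[A]_i$ = row $i$). $\vartheta(N,a,b,\zeta)=\bar\zeta\frac{b}{N}(\log a)^2+\Big(\bar\zeta\frac{1}{\sqrt N}(\log a)^2\Big)\wedge\Big(\bar\zeta^2\frac{b}{N}\log a\Big)^{2/3}\wedge\Big(\bar\zeta^2\frac{ab}{N}\log N\Big)$. A topological sort of a directed graph $G$ on $[n_1]$ is a permutation $\pi$ with $\pi(u)<\pi(v)$ for each edge $u\to v$. Subroutine 1 (blocking), input $Y\in\mathbb R^{n_1\times n_2}$: Step 1: compute column sums $C(j)=\sum_{i=1}^{n_1}Y_{i,j}$, and let $\widehat\sigma_{\mathsf{pre}}$ be a permutation along which $C(\widehat\sigma_{\mathsf{pre}}(j))$ is non-decreasing. Step 2: let $\tau=16(\zeta+1)\big(\sqrt{\frac{n_1^2n_2}{N}\log(n_1n_2)}+\frac{n_1n_2}{N}\log(n_1n_2)\big)$, $K=\lceil n_1/\tau\rceil$, and define blocks $\mathsf{bl}_1=\{j:C(j)<\tau\}$, $\mathsf{bl}_k=\{j:C(j)\in[(k-1)\tau,k\tau)\}$ for $1<k<K$, $\mathsf{bl}_K=\{j:C(j)\ge(K-1)\tau\}$. Step 3: let $\beta=n_2\sqrt{\frac{n_1}{N}\log(n_1n_2)}$; a block is large if its size is $\ge\beta$ and small otherwise; keep large blocks unchanged and, in the ordering of columns given by $\widehat\sigma_{\mathsf{pre}}$, take unions of adjacent small blocks (small blocks with no other small block between them) so that each resulting block has size in $[\frac12\beta,2\beta]$;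 if the union of all small blocks has size less than $\frac12\beta$, aggregate them all into one block. Return the resulting partition $\mathsf{BL}(Y)$ of $[n_2]$. Algorithm 3: Step 0: split the observations into two independent sub-samples of equal size and form the corresponding observation matrices $Y^{(1)}$ and $Y^{(2)}$ by the averaging formula above. Step 1: apply Subroutine 1 to $Y^{(1)}$ to get $\mathsf{BL}=\{\mathsf{BL}_1,\dots,\mathsf{BL}_K\}$. Step 2: compute $S(i)=\sum_{j\in[n_2]}Y^{(2)}_{i,j}$ and $S_{\mathsf{BL}_k}(i)=\sum_{j\in\mathsf{BL}_k}Y^{(2)}_{i,j}$; build a directed graph $G$ on $[n_1]$ with an edge $u\to v$ iff $S(v)-S(u)>16(\zeta+1)\big(\sqrt{\frac{n_1n_2^2}{N}\log(n_1n_2)}+\frac{n_1n_2}{N}\log(n_1n_2)\big)$ or, for some $k\in[K]$, $S_{\mathsf{BL}_k}(v)-S_{\mathsf{BL}_k}(u)>16(\zeta+1)\big(\sqrt{\frac{n_1n_2}{N}|\mathsf{BL}_k|\log(n_1n_2)}+\frac{n_1n_2}{N}\log(n_1n_2)\big)$. Step 3: let $\widehat\pi_{\mathsf{tds}}$ be a topological sort of $G$, or $\mathsf{id}$ if none exists. Step 4: repeat Steps 1–3 with $(Y^{(i)})^\top$ in place of $Y^{(i)}$ ($i=1,2$) and the roles of $n_1,n_2$ (and of row and column permutations) switched, to get $\widehat\sigma_{\mathsf{tds}}$. Step 5: return $(\widehat\pi_{\mathsf{tds}},\widehat\sigma_{\mathsf{tds}})$.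
   Formalization: N ≥ 1 is assumed (for N < 1 the log N term makes the second bound negative); R compares M* sorted by the inverses of π* and π̂ (the literal formula fails with tied rows); the split is by independent fair coins with mean size N/2 each; ''exceeding'' is read as ''at least''. *)

(* Defs.v *)
From HB Require Import structures.
From mathcomp Require Import all_boot all_order all_algebra.
From mathcomp Require Import perm fingroup.
From mathcomp Require Import all_classical all_reals all_analysis.

Set Implicit Arguments.
Unset Strict Implicit.
Unset Printing Implicit Defensive.

Import Order.TTheory GRing.Theory Num.Theory.
Local Open Scope classical_set_scope.
Local Open Scope ring_scope.

Section Defs.
Variable R : realType.

Definition zbar (zeta : R) : R := Num.max zeta 1.

Definition is_BISO (n1 n2 : nat) (M : 'M[R]_(n1, n2)) : Prop :=
  (forall i j, 0 <= M i j <= 1) /\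
  (forall (i : 'I_n1) (j j' : 'I_n2), (j <= j')%N -> M i j <= M i j') /\
  (forall (i i' : 'I_n1) (j : 'I_n2), (i <= i')%N -> M i j <= M i' j).

Definition permM (n1 n2 : nat) (M : 'M[R]_(n1, n2)) (pi : 'S_n1) (sg : 'S_n2)
  : 'M[R]_(n1, n2) := \matrix_(i, j) M (pi i) (sg j).

Definition in_CBISO (n1 n2 : nat) (pi : 'S_n1) (sg : 'S_n2) (M : 'M[R]_(n1, n2))
  : Prop := exists B : 'M[R]_(n1, n2), is_BISO B /\ M = permM B pi sg.

Definition frob2 (n1 n2 : nat) (A : 'M[R]_(n1, n2)) : R :=
  \sum_(i < n1) \sum_(j < n2) (A i j) ^+ 2.

Definition lossF (n1 n2 : nat) (Ms Mh : 'M[R]_(n1, n2)) : R :=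
  frob2 (Mh - Ms) / (n1 * n2)%:R.

(** R(M*, pihat), where M* in C_BISO(pis, sgs). *)
Definition lossR (n1 n2 : nat) (Ms : 'M[R]_(n1, n2)) (pis : 'S_n1) (sgs : 'S_n2)
  (pih : 'S_n1) : R :=
  \big[Num.max/0]_(i < n1)
    ((\sum_(j < n2) (permM Ms pis^-1 sgs^-1 i j - permM Ms pih^-1 sgs^-1 i j) ^+ 2)
       / n2%:R).

Definition vartheta (N a b zeta : R) : R :=
  zbar zeta * b / N * (ln a) ^+ 2 +
  Num.min (Num.min (zbar zeta / Num.sqrt N * (ln a) ^+ 2)
                   ((zbar zeta ^+ 2 * b / N * ln a) `^ (2 / 3)))
          (zbar zeta ^+ 2 * a * b / N * ln N).

Section Blocking.
Variables (m1 m2 : nat) (N zeta : R).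

Definition lg : R := ln ((m1 * m2)%:R).

Definition colsum (Y : 'M[R]_(m1, m2)) (j : 'I_m2) : R := \sum_(i < m1) Y i j.

Definition tau_bl : R :=
  16 * (zeta + 1) * (Num.sqrt ((m1 ^ 2 * m2)%:R / N * lg) + (m1 * m2)%:R / N * lg).

Definition K_bl : nat := `|Num.ceil (m1%:R / tau_bl)|%N.

Definition beta_bl : R := m2%:R * Num.sqrt (m1%:R / N * lg).

Definition blidx (Y : 'M[R]_(m1, m2)) (j : 'I_m2) : nat :=
  if colsum Y j < tau_bl then 1%N
  else minn K_bl (`|Num.floor (colsum Y j / tau_bl)|%N).+1.

Definition blk (Y : 'M[R]_(m1, m2)) (k : nat) : {set 'I_m2} :=
  [set j | blidx Y j == k].

(** BL is a possible output of Subroutine 1 on Y *)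
Definition is_blocking (Y : 'M[R]_(m1, m2)) (BL : seq {set 'I_m2}) : Prop :=
  let ks := iota 1 K_bl in
  let large k := beta_bl <= #|blk Y k|%:R in
  let smalls := [seq k <- ks | ~~ large k] in
  let U (g : seq nat) := \bigcup_(k <- g) blk Y k in
  exists groups : seq (seq nat),
    flatten groups = smalls /\
    BL = [seq blk Y k | k <- ks & large k] ++ [seq U g | g <- groups] /\
    ((#|U smalls|%:R < beta_bl / 2 /\ groups = [:: smalls]) \/
     (beta_bl / 2 <= #|U smalls|%:R /\
      forall g, g \in groups -> beta_bl / 2 <= #|U g|%:R <= 2 * beta_bl)).

Definition rowsumB (Y : 'M[R]_(m1, m2)) (B : {set 'I_m2}) (i : 'I_m1) : R :=
  \sum_(j in B) Y i j.

Definition thr_full : R :=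
  16 * (zeta + 1) * (Num.sqrt ((m1 * m2 ^ 2)%:R / N * lg) + (m1 * m2)%:R / N * lg).

Definition thr_blk (b : nat) : R :=
  16 * (zeta + 1) * (Num.sqrt ((m1 * m2)%:R / N * b%:R * lg) + (m1 * m2)%:R / N * lg).

Definition edge (Y : 'M[R]_(m1, m2)) (BL : seq {set 'I_m2}) (u v : 'I_m1) : Prop :=
  rowsumB Y [set: 'I_m2] v - rowsumB Y [set: 'I_m2] u > thr_full \/
  exists2 B, B \in BL & rowsumB Y B v - rowsumB Y B u > thr_blk #|B|.

Definition is_topsort (e : 'I_m1 -> 'I_m1 -> Prop) (pi : 'S_m1) : Prop :=
  forall u v, e u v -> (pi u < pi v)%N.

(** pi is a possible output of Steps 1-3 of Algorithm 3 on (Y1, Y2) *)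
Definition tds_rows (Y1 Y2 : 'M[R]_(m1, m2)) (pi : 'S_m1) : Prop :=
  exists BL, is_blocking Y1 BL /\
    (is_topsort (edge Y2 BL) pi \/
     ((forall p, ~ is_topsort (edge Y2 BL) p) /\ pi = 1%g)).
End Blocking.

Section Model.
Variables (d : measure_display) (Omega : measurableType d) (P : probability Omega R).
Variables (n1 n2 : nat).

Definition Ymat (Ms : 'M[R]_(n1, n2)) (Nn : Omega -> nat)
  (X : nat -> Omega -> 'I_n1 * 'I_n2) (z : nat -> Omega -> R)
  (keep : nat -> Omega -> bool) (Nnorm : R) (w : Omega) : 'M[R]_(n1, n2) :=
  \matrix_(i, j) ((n1 * n2)%:R / Nnorm *
     \sum_(0 <= l < Nn w | keep l w)
        ((Ms (X l w).1 (X l w).2 + z l w) * (X l w == (i, j))%:R)).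

Definition indep_family (I : eqType) (F : I -> set (set Omega)) : Prop :=
  forall (s : seq I) (A : I -> set Omega), uniq s ->
    (forall i, i \in s -> F i (A i)) ->
    P (\big[setI/setT]_(i <- s) A i) = (\prod_(i <- s) P (A i))%E.

Definition model_events (Nn : Omega -> nat) (X : nat -> Omega -> 'I_n1 * 'I_n2)
  (z : nat -> Omega -> R) (S : nat -> Omega -> bool)
  (v : option (nat * 'I_3)) : set (set Omega) :=
  match v with
  | None => [set E | exists A : set nat, E = Nn @^-1` A]
  | Some (l, k) =>
      if val k == 0%N then [set E | exists A : set ('I_n1 * 'I_n2), E = X l @^-1` A]
      else if val k == 1%N then [set E | exists A : set R, measurable A /\ E = z l @^-1` A]
      else [set E | exists A : set bool, E = S l @^-1` A]
  end.

(** The sampling model: N' ~ Poi(N); X_l uniform on index pairs;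
    z_l zero mean with E exp(s z_l) <= exp(zeta^2 s^2) for |s| <= 1/zeta;
    S_l ~ Bernoulli(1/2) (sample-splitting labels); all mutually independent. *)
Definition obs_model (N zeta : R) (Nn : Omega -> nat)
  (X : nat -> Omega -> 'I_n1 * 'I_n2) (z : nat -> Omega -> R)
  (S : nat -> Omega -> bool) : Prop :=
  (forall A : set nat, measurable (Nn @^-1` A)) /\
  (forall l (A : set ('I_n1 * 'I_n2)), measurable (X l @^-1` A)) /\
  (forall l (A : set bool), measurable (S l @^-1` A)) /\
  (forall l, measurable_fun setT (z l)) /\
  (forall k : nat, P (Nn @^-1` [set k]) = (expR (- N) * N ^+ k / (k`!)%:R)%:E) /\
  (forall l ij, P (X l @^-1` [set ij]) = ((n1 * n2)%:R^-1)%:E) /\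
  (forall l, P (S l @^-1` [set true]) = (2^-1)%:E) /\
  (forall l, P.-integrable setT (EFin \o z l) /\
             (\int[P]_w (z l w)%:E = 0)%E /\
             (forall s : R, `|s| <= zeta^-1 ->
                (\int[P]_w (expR (s * z l w))%:E <= (expR (zeta ^+ 2 * s ^+ 2))%:E)%E)) /\
  indep_family (model_events Nn X z S).
End Model.

End Defs.

(* Main.v *)
(* Sorting. A Chernoff bound for Poissonized sums, taken over all candidate blocks (a block is
   determined by at most two columns), shows that no edge of the graph is reversed and that
   every gap exceeding three thresholds is detected. A topological sort then misplaces a row
   only among rows with close block sums. Monotonicity of the columns bounds the l2 error
   by the l1 error of full row sums, which gives the first claim; summing over the blocks, on
   each of which a row varies little on average, improves the total error to the exponent 3/4.
   The column permutation is handled by transposing the model.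

   Least squares. The basic inequality reduces the risk to the squared sorting error plus a
   linear form of the noise at a difference of two bimonotone matrices. This form is
   bounded by chaining along nested partitions into rectangles. At each level, the large increments
   are few and are put in a finite net of step functions, while the small ones form a polytope
   whose vertices are step functions, so that one union bound over step functions (and over all
   permutations) controls everything. Dyadic squares give the rate 1/sqrt N, slices of
   columns the rate N^(-2/3), and the entrywise bound the parametric rate. *)

Require Import Defs.
From HB Require Import structures.
From mathcomp Require Import all_boot all_order all_algebra.
From mathcomp Require Import perm fingroup.
From mathcomp Require Import all_classical all_reals all_analysis.
From mathcomp Require Import measurable_realfun.
From mathcomp Require Import ring lra zify.

Set Implicit Arguments.
Unset Strict Implicit.
Unset Printing Implicit Defensive.

Import Order.TTheory GRing.Theory Num.Theory.
Local Open Scope classical_set_scope.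
Local Open Scope ring_scope.

(** * Independence *)

(** Two dependences shape the proof. The blocks depend on the data. Given the sample size and the
    labels, however, the two halves are independent, so the block pattern of the first half can be
    frozen, and each pattern costs only a union over at most 3 (n1 n2)^2 triples of two rows and a
    candidate block. Deviations of probability (n1 n2)^-6 then leave (n1 n2)^-4. The sorted
    permutations depend on the very sample that enters the least squares, so the noise has to be
    controlled under all permutations at once. This costs an entropy of order n1 log n1 however few
    rectangles are used. The dyadic chain is tuned to it: up to its last level it uses of order n1
    rectangles, and this dictates the truncation levels 2^k log n1 / n1. Two regimes are settled
    separately: for n1 n2 <= 2 the claimed probabilities are not positive, and for N below a
    multiple of n1 log n1 the constants make the claimed bounds equal to 1. *)

Section Independence.
Context {R : realType} {d : measure_display} {Omega : measurableType d}
  (P : probability Omega R) {I : choiceType} (F : I -> set (set Omega)).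
Hypothesis Fm : forall i A, F i A -> measurable A.
Hypothesis FT : forall i, F i setT.
Hypothesis FI : forall i A B, F i A -> F i B -> F i (A `&` B).
Hypothesis Find : indep_family P F.

(** A pi-system generating the sigma-algebra of the coordinates in [J]; on it the product formula of
    [indep_family] applies directly. *)
Definition cylinder (J : pred I) : set (set Omega) :=
  [set D | exists (s : seq I) (A : I -> set Omega),
    [/\ uniq s, {subset s <= J}, (forall i, i \in s -> F i (A i)) &
        D = \big[setI/setT]_(i <- s) A i]].

Lemma in_big_setI (s : seq I) (A : I -> set Omega) w :
  (\big[setI/setT]_(i <- s) A i) w <-> (forall i, i \in s -> A i w).
Proof. by rewrite -bigcap_seq; split => h i /h. Qed.

Lemma cylinder_measurable (J : pred I) : cylinder J `<=` measurable.
Proof.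
move=> _ [s [A [_ _ FA ->]]]; rewrite big_seq.
by apply: big_ind => //; [exact: measurableI | move=> i /FA /Fm].
Qed.

Lemma cylinderT (J : pred I) : cylinder J setT.
Proof. by exists [::], (fun=> setT); split => //; rewrite big_nil. Qed.

Lemma cylinder1 (J : pred I) i A : J i -> F i A -> cylinder J A.
Proof.
move=> Ji FA; exists [:: i], (fun=> A); split => //.
- by move=> k; rewrite inE => /eqP ->.
- by move=> k; rewrite inE => /eqP ->.
- by rewrite big_seq1.
Qed.

Lemma sub_cylinder (J J' : pred I) : {subset J <= J'} -> cylinder J `<=` cylinder J'.
Proof.
move=> JJ' _ [s [A [us sJ FA ->]]]; exists s, A; split => //.
by move=> i /sJ /JJ'.
Qed.

Lemma cylinder_setI_closed (J : pred I) : setI_closed (cylinder J).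
Proof.
move=> _ _ [s [A [us sJ FA ->]]] [t [B [ut tJ FB ->]]].
exists (undup (s ++ t)),
  (fun i => (if i \in s then A i else setT) `&` (if i \in t then B i else setT)).
split; first exact: undup_uniq.
- by move=> i; rewrite mem_undup mem_cat => /orP[/sJ|/tJ].
- move=> i _; apply: FI; case: ifP => // hi; [exact: FA|exact: FB].
- apply/seteqP; split => w; rewrite /= !in_big_setI.
  + move=> [hA hB] i _; split; case: ifP => // hi; [exact: hA|exact: hB].
  + move=> h; split=> i hi; have := h i; rewrite mem_undup mem_cat hi ?orbT => /(_ erefl) [].
      by [].
    by [].
Qed.

Lemma sigma_cylinder_measurable (J : pred I) : <<s cylinder J >> `<=` measurable.
Proof.
by apply: smallest_sub; [exact: sigma_algebra_measurable | exact: cylinder_measurable].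
Qed.

Lemma cylinder_indep (J1 J2 : pred I) (D1 D2 : set Omega) :
  (forall i, J1 i -> ~~ J2 i) -> cylinder J1 D1 -> cylinder J2 D2 ->
  P (D1 `&` D2) = (P D1 * P D2)%E.
Proof.
move=> J12 [s [A [us sJ FA ->]]] [t [B [ut tJ FB ->]]].
have st i : i \in s -> i \notin t.
  by move=> /sJ /J12; apply: contra => /tJ.
(* The index lists are disjoint, so both events are read off from one family, to which the product
   formula on [s ++ t] applies. *)
pose C i := if i \in s then A i else B i.
have eA : \big[setI/setT]_(i <- s) A i = \big[setI/setT]_(i <- s) C i.
  by apply: eq_big_seq => i hi; rewrite /C hi.
have eB : \big[setI/setT]_(i <- t) B i = \big[setI/setT]_(i <- t) C i.
  by apply: eq_big_seq => i hi; rewrite /C; case: ifP => // /st; rewrite hi.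
have FC1 i : i \in s -> F i (C i) by rewrite /C => hi; rewrite hi; exact: FA.
have FC2 i : i \in t -> F i (C i).
  by rewrite /C => hi; case: ifP => // [/st|_]; [rewrite hi|exact: FB].
rewrite eA eB -big_cat /= (Find (s := s ++ t)).
- by rewrite big_cat /= (Find us FC1) (Find ut FC2).
- rewrite cat_uniq us ut andbT /=; apply/hasPn => i hi /=.
  by apply/negP => /st; rewrite hi.
- by move=> i; rewrite mem_cat => /orP[/FC1|/FC2].
Qed.

(** Uniqueness of finite measures on a pi-system, applied twice: with one event fixed, both sides
    are measures of the other event that agree on cylinders. *)
Lemma sigma_cylinder_indep (J1 J2 : pred I) (D1 D2 : set Omega) :
  (forall i, J1 i -> ~~ J2 i) -> <<s cylinder J1 >> D1 -> <<s cylinder J2 >> D2 ->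
  P (D1 `&` D2) = (P D1 * P D2)%E.
Proof.
move=> J12.
have step (J : pred I) (D : set Omega) : measurable D ->
    (forall A, cylinder J A -> P (A `&` D) = (P A * P D)%E) ->
    forall A, <<s cylinder J >> A -> P (A `&` D) = (P A * P D)%E.
  move=> mD h A sA.
  have fPD : (0 <= fine (P D))%R by rewrite fine_ge0.
  pose m1 : measure Omega R := mrestr P mD.
  pose m2 : measure Omega R := mscale (NngNum fPD) P.
  have ->: P (A `&` D) = m1 A by [].
  have ->: (P A * P D)%E = m2 A.
    change (m2 A) with ((fine (P D))%:E * P A)%E.
    by rewrite fineK ?fin_num_measure// muleC.
  apply: (@g_sigma_algebra_measure_unique _ _ _ (cylinder J)
    (@cylinder_measurable J) (fun=> setT)) => //.
  - by move=> _; exact: cylinderT.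
  - by rewrite bigcup_const.
  - exact: cylinder_setI_closed.
  - move=> B cB; change (m2 B) with ((fine (P D))%:E * P B)%E.
    by rewrite fineK ?fin_num_measure// muleC -h.
  - move=> _; change (m1 setT) with (P (setT `&` D)).
    by rewrite setTI ltey_eq fin_num_measure.
move=> s1 s2; move: D1 s1; apply: (step J1 D2); first exact: sigma_cylinder_measurable s2.
move=> A cA; rewrite setIC muleC; move: D2 s2; apply: (step J2 A).
  exact: cylinder_measurable cA.
move=> B cB; rewrite setIC muleC; exact: (cylinder_indep J12).
Qed.

End Independence.

(** * Expectation of a product of independent variables *)

Section ExpectationProduct.
Context {R : realType} {d : measure_display} {Omega : measurableType d}
  (P : probability Omega R).

(** The joint law of the pair is the product of the marginal laws, as the two agree on measurable
    rectangles; Tonelli then splits the integral. *)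
Lemma expectation_indepM (g h : Omega -> R) :
  measurable_fun setT g -> measurable_fun setT h ->
  (forall w, 0 <= g w) -> (forall w, 0 <= h w) ->
  (forall A B : set R, measurable A -> measurable B ->
     P ((g @^-1` A) `&` (h @^-1` B)) = (P (g @^-1` A) * P (h @^-1` B))%E) ->
  (\int[P]_w (g w * h w)%:E = (\int[P]_w (g w)%:E) * (\int[P]_w (h w)%:E))%E.
Proof.
move=> mg mh g0 h0 ind.
pose gm : {mfun Omega >-> R} := mfun_Sub (mem_set mg).
pose hm : {mfun Omega >-> R} := mfun_Sub (mem_set mh).
have mgh : measurable_fun setT (fun w => (g w, h w)) by exact/measurable_fun_pairP.
(* The absolute values make the integrand non-negative on the whole plane, as Tonelli asks; they
   disappear on the values of [g] and [h]. *)
pose f (xy : R * R) : \bar R := (`|xy.1| * `|xy.2|)%:E.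
have mf : measurable_fun setT f.
  apply/measurable_EFinP; apply: measurable_funM.
    by apply: measurableT_comp => //; exact: measurable_fst.
  by apply: measurableT_comp => //; exact: measurable_snd.
have f0 x : (0 <= f x)%E by rewrite lee_fin mulr_ge0.
pose mu : probability _ _ := distribution P gm.
pose nu : probability _ _ := distribution P hm.
transitivity (\int[pushforward P (fun w => (g w, h w))]_z f z)%E.
  rewrite ge0_integral_pushforward//.
  by apply: eq_integral => w _; rewrite /f /= !ger0_norm.
transitivity (\int[(mu \x nu)%E]_z f z)%E.
  apply: eq_measure_integral => A mA _; apply/esym.
  apply: (@product_measure_unique _ _ _ _ _ mu nu) => //.
have mn : measurable_fun setT (fun y : R => (`|y|)%:E).
  by apply/measurable_EFinP; exact: (@normr_measurable R setT).
have n0 (y : R) : (0 <= (`|y|)%:E)%E by rewrite lee_fin.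
rewrite fubini_tonelli1//.
transitivity (\int[mu]_x ((`|x|)%:E * \int[nu]_y (`|y|)%:E))%E.
  apply: eq_integral => x _; rewrite /fubini_F /f /=.
  by under eq_integral => y _ do rewrite EFinM; rewrite ge0_integralZl.
rewrite ge0_integralZr//; last by apply: integral_ge0 => y _.
by congr (_ * _)%E; rewrite ge0_integral_distribution//;
  apply: eq_integral => w _ /=; rewrite ger0_norm.
Qed.

End ExpectationProduct.

(** * Elementary inequalities for the exponential *)

Section RealFacts.
Context {R : realType}.

(** For a <= 0 this rests on (1 - a)(1 + a + a^2) = 1 - a^3. For a > 0 the tangent bound exp(-c) >=
    1 - c is raised to the eighth power at c = a / 8; a division by 4 would fail at a = 1, since
    (4/3)^4 > 3. *)
Lemma expR_le_quadratic (a : R) : `|a| <= 1 -> expR a <= 1 + a + a ^+ 2.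
Proof.
move=> a1.
have [a0|a0] := leP a 0.
  have h : 1 + - a <= expR (- a) by exact: expR_ge1Dx.
  have e0 := expR_gt0 a.
  have : expR a * (1 - a) <= 1.
    have eN : expR a * expR (- a) = 1 by rewrite -expRD subrr expR0.
    by rewrite -[X in _ <= X]eN ler_pM2l.
  have p1 : 0 < 1 - a by lra.
  move=> h1; rewrite -(ler_pM2r p1); apply: (le_trans h1).
  have -> : (1 + a + a ^+ 2) * (1 - a) = 1 + - a * a ^+ 2 by ring.
  by rewrite lerDl mulr_ge0 ?sqr_ge0 ?oppr_ge0.
have {}a1 : a <= 1 by apply: le_trans a1; exact: ler_norm.
pose c := a / 8.
have c0 : 0 < c by rewrite /c; lra.
have c1 : c <= 1 / 8 by rewrite /c; lra.
have ac : a = 8 * c by rewrite /c; field.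
have ec : expR c * (1 - c) <= 1.
  have eN : expR c * expR (- c) = 1 by rewrite -expRD subrr expR0.
  by rewrite -[X in _ <= X]eN ler_pM2l ?expR_gt0// expR_ge1Dx.
have e8 : expR a = expR c ^+ 8 by rewrite ac -expRM_natl.
have e8' : expR c ^+ 8 * (1 - c) ^+ 8 <= 1.
  rewrite -exprMn; apply: exprn_ile1; last exact: ec.
  by apply: mulr_ge0; [exact: expR_ge0|lra].
have v0 : 0 <= 1 - 4 * c + 6 * c ^+ 2 - 4 * c ^+ 3.
  have -> : 1 - 4 * c + 6 * c ^+ 2 - 4 * c ^+ 3
    = (1 - 4 * c) + c ^+ 2 * (6 - 4 * c) by ring.
  by apply: addr_ge0; [lra|rewrite mulr_ge0 ?sqr_ge0//; lra].
have v4 : 1 - 4 * c + 6 * c ^+ 2 - 4 * c ^+ 3 <= (1 - c) ^+ 4.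
  have -> : (1 - c) ^+ 4 = 1 - 4 * c + 6 * c ^+ 2 - 4 * c ^+ 3 + (c ^+ 2) ^+ 2 by ring.
  by rewrite lerDl sqr_ge0.
have v8 : (1 - 4 * c + 6 * c ^+ 2 - 4 * c ^+ 3) ^+ 2 <= (1 - c) ^+ 8.
  by rewrite (exprM _ 4 2) ler_sqr ?nnegrE// (le_trans v0).
have key : 1 <= (1 - 4 * c + 6 * c ^+ 2 - 4 * c ^+ 3) ^+ 2 * (1 + a + a ^+ 2).
  rewrite ac.
  have -> : (1 - 4 * c + 6 * c ^+ 2 - 4 * c ^+ 3) ^+ 2 * (1 + 8 * c + (8 * c) ^+ 2)
    = 1 + c ^+ 2 * ((28 - 344 * c + 1412 * c ^+ 2 - 3088 * c ^+ 3)
        + c ^+ 4 * (3984 - 2944 * c) + 1024 * c ^+ 6) by ring.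
  rewrite lerDl; apply: mulr_ge0; first exact: sqr_ge0.
  have h3 : c ^+ 3 <= 1 / 8 * c ^+ 2 by rewrite exprS ler_wpM2r ?sqr_ge0.
  have h6 : 0 <= c ^+ 6 by apply: exprn_ge0; exact: ltW.
  have h4 : 0 <= c ^+ 4 by apply: exprn_ge0; exact: ltW.
  have h5 : 0 <= c ^+ 4 * (1 - c) by apply: mulr_ge0 => //; lra.
  have : 0 <= (c - 1 / 8) ^+ 2 by exact: sqr_ge0.
  rewrite sqrrB; lra.
rewrite e8.
have q0 : 0 < 1 + a + a ^+ 2 by rewrite ltr_wpDr ?sqr_ge0//; lra.
have p8 : 0 < (1 - c) ^+ 8 by apply: exprn_gt0; lra.
have : (1 - 4 * c + 6 * c ^+ 2 - 4 * c ^+ 3) ^+ 2 * (1 + a + a ^+ 2)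
   <= (1 - c) ^+ 8 * (1 + a + a ^+ 2) by rewrite ler_pM2r.
move=> h; rewrite -(ler_pM2r p8).
apply: (le_trans e8'); apply: (le_trans key).
by rewrite [X in _ <= X]mulrC.
Qed.

(** The signal [m] is at most 1 and the noise has scale [zeta], so [1 + zeta] is the scale of one
    observation; in this normalisation the exponent has modulus at most |s| (1 + zeta) <= 1 and the
    quadratic bound applies. *)
Lemma mgf_step (zeta s m : R) : 0 < zeta -> 0 <= m <= 1 -> `|s| * (1 + zeta) <= 1 ->
  expR (s * m + zeta ^+ 2 * s ^+ 2) <= 1 + s * m + 2 * (1 + zeta) ^+ 2 * s ^+ 2.
Proof.
move=> z0 /andP[m0 m1] hs.
set r := `|s| in hs; have r0 : 0 <= r by exact: normr_ge0.
have s2 : s ^+ 2 = r ^+ 2 by rewrite /r real_normK ?num_real.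
have zr : zeta ^+ 2 * r <= zeta.
  have h : zeta * (r * (1 + zeta)) <= zeta * 1 by rewrite ler_pM2l.
  have h' : 0 <= zeta * r by rewrite mulr_ge0 // ltW.
  by move: h; rewrite mulr1 => h; rewrite expr2; lra.
have sm : `|s * m| <= r by rewrite normrM (ger0_norm m0) ler_piMr.
have h1 : `|s * m + zeta ^+ 2 * s ^+ 2| <= r * (1 + zeta).
  apply: (le_trans (ler_normD _ _)).
  rewrite [X in _ + X]ger0_norm; last by rewrite mulr_ge0 ?sqr_ge0.
  have h : zeta ^+ 2 * r * r <= zeta * r by rewrite ler_wpM2r.
  by move: h; rewrite s2 expr2; lra.
apply: (le_trans (expR_le_quadratic (le_trans h1 hs))).
have h2 : (s * m + zeta ^+ 2 * s ^+ 2) ^+ 2 <= (r * (1 + zeta)) ^+ 2.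
  rewrite -[X in X <= _]real_normK ?num_real// ler_sqr ?nnegrE//.
  by rewrite mulr_ge0//; lra.
have h3 : zeta ^+ 2 * s ^+ 2 <= (1 + zeta) ^+ 2 * s ^+ 2.
  by rewrite ler_wpM2r ?sqr_ge0// ler_sqr ?nnegrE; lra.
by move: h2; rewrite exprMn -s2; lra.
Qed.

Lemma exp_coeff_partial_le (x : R) n : 0 <= x ->
  \sum_(0 <= k < n) exp_coeff x k <= expR x.
Proof.
move=> x0; have := nondecreasing_cvgn_le (u_ := series (exp_coeff x)).
apply; last exact: is_cvg_series_exp_coeff.
by apply: nondecreasing_series => i _ _; exact: exp_coeff_ge0.
Qed.

End RealFacts.

(** * Chernoff bounds for the Poissonized model *)

Section UnionBound.
Context {R : realType} {d : measure_display} {Omega : measurableType d}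
  (P : probability Omega R).

Lemma measure_bigsetU_le (I : Type) (s : seq I) (A : I -> set Omega) :
  (forall i, measurable (A i)) ->
  (P (\big[setU/set0]_(i <- s) A i) <= \sum_(i <- s) P (A i))%E.
Proof.
move=> mA; elim: s => [|i s IH]; first by rewrite !big_nil measure0.
rewrite !big_cons; apply: (le_trans (measureU2 _ _ _)) => //.
  by apply: bigsetU_measurable => j _.
by apply: leeD.
Qed.

Lemma measure_bigsetU_le_const (I : finType) (A : I -> set Omega) (c : R) :
  (forall i, measurable (A i)) -> (forall i, (P (A i) <= c%:E)%E) ->
  (P (\big[setU/set0]_(i : I) A i) <= (#|I|%:R * c)%:E)%E.
Proof.
move=> mA pA; apply: (le_trans (measure_bigsetU_le _ mA)).
apply: (@le_trans _ _ (\sum_(i : I) c%:E)%E); first by apply: lee_sum => i _.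
by rewrite sumEFin sumr_const mulr_natl.
Qed.

End UnionBound.

Section Model.
Context {R : realType} {d : measure_display} {Omega : measurableType d}
  (P : probability Omega R) (n1 n2 : nat) (N zeta : R)
  (Ms : 'M[R]_(n1, n2)) (Nn : Omega -> nat)
  (X : nat -> Omega -> 'I_n1 * 'I_n2) (z : nat -> Omega -> R)
  (S : nat -> Omega -> bool).
Hypothesis n1_gt0 : (0 < n1)%N.
Hypothesis n2_gt0 : (0 < n2)%N.
Hypothesis zeta_gt0 : 0 < zeta.
Hypothesis N_ge0 : 0 <= N.
Hypothesis Ms01 : forall i j, 0 <= Ms i j <= 1.
Hypothesis Hobs : obs_model P N zeta Nn X z S.

Local Notation F := (model_events Nn X z S).

Definition matip (A B : 'M[R]_(n1, n2)) : R := \sum_i \sum_j A i j * B i j.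

(** The unnormalised inner product of [V] with the observation matrix built from the samples [ls].
    The explicit list makes it a function of finitely many coordinates. *)
Definition obs_sum (V : 'M[R]_(n1, n2)) (ls : seq nat) (w : Omega) : R :=
  \sum_(l <- ls) (Ms (X l w).1 (X l w).2 + z l w) * V (X l w).1 (X l w).2.

Definition k0 : 'I_3 := @Ordinal 3 0 isT.
Definition k1 : 'I_3 := @Ordinal 3 1 isT.
Definition k2 : 'I_3 := @Ordinal 3 2 isT.

(** Coordinates 0 and 1 are the position and the noise. The label and the sample size are left out,
    so that one can condition on them. *)
Definition sample_idx (ls : pred nat) : pred (option (nat * 'I_3)) :=
  fun v => if v is Some (l, k) then ls l && (k < 2)%N else false.

Lemma model_events_measurable i A : F i A -> measurable A.
Proof.
have [mN [mX [mS [mz _]]]] := Hobs.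
case: i => [[l k]|] /=; last by case=> B ->.
case: ifP => _; first by case=> B ->.
case: ifP => _; last by case=> B ->.
by case=> B [mB ->]; rewrite -[X in measurable X]setTI; apply: mz.
Qed.

Lemma model_eventsT i : F i setT.
Proof.
case: i => [[l k]|] /=; last by exists setT.
case: ifP => _; first by exists setT.
by case: ifP => _; exists setT.
Qed.

Lemma model_eventsI i A B : F i A -> F i B -> F i (A `&` B).
Proof.
case: i => [[l k]|] /=; last first.
  by move=> [A' ->] [B' ->]; exists (A' `&` B'); rewrite preimage_setI.
case: ifP => _.
  by move=> [A' ->] [B' ->]; exists (A' `&` B'); rewrite preimage_setI.
case: ifP => _.
  move=> [A' [mA ->]] [B' [mB ->]]; exists (A' `&` B'); rewrite preimage_setI.
  by split => //; exact: measurableI.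
by move=> [A' ->] [B' ->]; exists (A' `&` B'); rewrite preimage_setI.
Qed.

Lemma model_indep (J1 J2 : pred (option (nat * 'I_3))) (D1 D2 : set Omega) :
  (forall i, J1 i -> ~~ J2 i) -> <<s cylinder F J1 >> D1 -> <<s cylinder F J2 >> D2 ->
  P (D1 `&` D2) = (P D1 * P D2)%E.
Proof.
apply: sigma_cylinder_indep.
- exact: model_events_measurable.
- exact: model_eventsT.
- exact: model_eventsI.
- by case: Hobs => _ [_ [_ [_ [_ [_ [_ [_ ]]]]]]].
Qed.

(** [Omega] with the sigma-algebra of the coordinates in [J]: measurability in this space means
    dependence on these coordinates only. *)
Local Notation sub J := (g_sigma_algebraType (cylinder F J)).

Lemma sub_measurableX (J : pred (option (nat * 'I_3))) l (g : 'I_n1 * 'I_n2 -> R) :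
  J (Some (l, k0)) -> measurable_fun (setT : set (sub J)) (fun w : sub J => g (X l w)).
Proof.
move=> Jl _ B mB; rewrite setTI; apply: sub_sigma_algebra.
by apply: (cylinder1 Jl); exists (g @^-1` B).
Qed.

Lemma sub_measurablez (J : pred (option (nat * 'I_3))) l :
  J (Some (l, k1)) -> measurable_fun (setT : set (sub J)) (z l : sub J -> R).
Proof.
move=> Jl _ B mB; rewrite setTI; apply: sub_sigma_algebra.
by apply: (cylinder1 Jl); exists B.
Qed.

Lemma sub_measurable_obs (J : pred (option (nat * 'I_3))) l (V : 'M[R]_(n1, n2)) :
  J (Some (l, k0)) -> J (Some (l, k1)) ->
  measurable_fun (setT : set (sub J))
    (fun w : sub J => (Ms (X l w).1 (X l w).2 + z l w) * V (X l w).1 (X l w).2).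
Proof.
move=> J0 J1; apply: measurable_funM; last first.
  exact: (@sub_measurableX J l (fun x => V x.1 x.2)).
apply: measurable_funD; last exact: sub_measurablez.
exact: (@sub_measurableX J l (fun x => Ms x.1 x.2)).
Qed.

Lemma sub_measurable_obs_sum (J : pred (option (nat * 'I_3))) (V : 'M[R]_(n1, n2)) ls :
  (forall l, l \in ls -> J (Some (l, k0)) /\ J (Some (l, k1))) ->
  measurable_fun (setT : set (sub J)) (obs_sum V ls : sub J -> R).
Proof.
elim: ls => [_|l s IH hs].
  rewrite (_ : obs_sum V [::] = cst 0); first exact: measurable_cst.
  by apply/funext => w; rewrite /obs_sum big_nil.
rewrite (_ : obs_sum V (l :: s) = (fun w =>
  (Ms (X l w).1 (X l w).2 + z l w) * V (X l w).1 (X l w).2 + obs_sum V s w)); last first.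
  by apply/funext => w; rewrite /obs_sum big_cons.
apply: measurable_funD; last by apply: IH => i hi; apply: hs; rewrite inE hi orbT.
have [] := hs l (mem_head _ _); exact: sub_measurable_obs.
Qed.

Lemma sub_measurable_fun (J : pred (option (nat * 'I_3))) (f : Omega -> R) :
  measurable_fun (setT : set (sub J)) (f : sub J -> R) -> measurable_fun setT f.
Proof.
move=> mf _ B mB; have h := mf measurableT B mB.
exact: (sigma_cylinder_measurable model_events_measurable h).
Qed.

Definition expw (lam : R) (V : 'M[R]_(n1, n2)) (l : nat) (w : Omega) : R :=
  expR (lam * ((Ms (X l w).1 (X l w).2 + z l w) * V (X l w).1 (X l w).2)).

Lemma sub_measurable_expw (J : pred (option (nat * 'I_3))) lam V l :
  J (Some (l, k0)) -> J (Some (l, k1)) ->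
  measurable_fun (setT : set (sub J)) (expw lam V l : sub J -> R).
Proof.
move=> J0 J1; apply: measurableT_comp; first exact: measurable_expR.
apply: measurable_funM; first exact: measurable_cst.
exact: sub_measurable_obs.
Qed.

Lemma sub_measurable_prod_expw (J : pred (option (nat * 'I_3))) lam V ls :
  (forall l, l \in ls -> J (Some (l, k0)) /\ J (Some (l, k1))) ->
  measurable_fun (setT : set (sub J)) ((fun w => \prod_(l <- ls) expw lam V l w) : sub J -> R).
Proof.
elim: ls => [_|l s IH hs].
  by under eq_fun do rewrite big_nil; exact: measurable_cst.
under eq_fun do rewrite big_cons.
apply: measurable_funM; last by apply: IH => i hi; apply: hs; rewrite inE hi orbT.
have [] := hs l (mem_head _ _); exact: sub_measurable_expw.
Qed.

Lemma sub_preimage (J : pred (option (nat * 'I_3))) (f : Omega -> R) (A : set R) :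
  measurable_fun (setT : set (sub J)) (f : sub J -> R) -> measurable A ->
  <<s cylinder F J >> (f @^-1` A).
Proof. by move=> mf mA; have := mf measurableT A mA; rewrite setTI. Qed.

Lemma expectation_prod_expw (lam : R) (V : 'M[R]_(n1, n2)) (ls : seq nat) : uniq ls ->
  (\int[P]_w (\prod_(l <- ls) expw lam V l w)%:E
   = \prod_(l <- ls) \int[P]_w (expw lam V l w)%:E)%E.
Proof.
elim: ls => [_|l s IH /= /andP[ls us]].
  under eq_integral do rewrite big_nil.
  by rewrite integral_cst//= probability_setT mule1 big_nil.
under eq_integral do rewrite big_cons.
have hl k : k \in [:: l] -> sample_idx (pred1 l) (Some (k, k0)) /\
    sample_idx (pred1 l) (Some (k, k1)).
  by rewrite inE => /eqP ->; rewrite /= eqxx.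
have hs k : k \in s -> sample_idx [in s] (Some (k, k0)) /\ sample_idx [in s] (Some (k, k1)).
  by move=> ks; rewrite /= ks.
have [l0 l1] := hl l (mem_head _ _).
rewrite expectation_indepM.
- by rewrite big_cons IH.
- exact: (sub_measurable_fun (sub_measurable_expw lam V l0 l1)).
- exact: (sub_measurable_fun (sub_measurable_prod_expw lam V hs)).
- by move=> w; exact: expR_ge0.
- by move=> w; apply: prodr_ge0 => i _; exact: expR_ge0.
- move=> A B mA mB; apply: (@model_indep (sample_idx (pred1 l)) (sample_idx [in s])).
  + move=> [[k m]|] //= /andP[/eqP -> ->].
    by rewrite andbT.
  + by apply: sub_preimage mA; exact: sub_measurable_expw.
  + by apply: sub_preimage mB; exact: sub_measurable_prod_expw.
Qed.

(** A bound on the exponential moment of one observation weighted by [V]. It is kept in the form 1 +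
    a, which a Poisson number of samples turns into exp(N a). *)
Definition mgf_bound (th : R) (V : 'M[R]_(n1, n2)) : R :=
  1 + (th / (1 + zeta) * matip Ms V + 2 * th ^+ 2 * frob2 V) / (n1 * n2)%:R.

(** The position is uniform and independent of the noise, so each entry contributes [mgf_step] with
    weight 1 / (n1 n2). *)
Lemma expectation_expw_le (th : R) (V : 'M[R]_(n1, n2)) (l : nat) : 0 <= th ->
  (forall i j, th * `|V i j| <= 1) ->
  (\int[P]_w (expw (th / (1 + zeta)) V l w)%:E <= (mgf_bound th V)%:E)%E.
Proof.
move=> th0 thV; set lam := th / (1 + zeta).
have [mN [mX [mS [mz [_ [pX [_ [hz _]]]]]]]] := Hobs.
have z1 : 0 < 1 + zeta by rewrite addr_gt0.
have lamE : lam * (1 + zeta) = th by rewrite /lam divfK ?gt_eqF.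
have lam0 : 0 <= lam by rewrite /lam divr_ge0// ltW.
pose T := ('I_n1 * 'I_n2)%type.
pose a (x : T) := lam * V x.1 x.2.
pose e (x : T) (w : Omega) := expR (a x * (Ms x.1 x.2 + z l w)).
have a1 x : `|a x| * (1 + zeta) <= 1.
  by rewrite /a normrM (ger0_norm lam0) mulrAC lamE.
have me x : measurable_fun setT (e x).
  apply: measurableT_comp; first exact: measurable_expR.
  by apply: measurable_funM => //; apply: measurable_funD.
have mi (x : T) : measurable_fun setT (\1_(X l @^-1` [set x]) : Omega -> R).
  exact/measurable_indic/mX.
have expwE w : (expw lam V l w)%:E
    = (\sum_(x : T) ((\1_(X l @^-1` [set x]) w : R) * e x w)%:E)%E.
  rewrite sumEFin; congr (_%:E); rewrite (bigD1 (X l w))//= big1 ?addr0.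
    rewrite indicE mem_set// mul1r /e /a /expw; congr expR; ring.
  move=> x xX; rewrite indicE memNset ?mul0r// => /= h.
  by rewrite h eqxx in xX.
under eq_integral do rewrite expwE.
rewrite ge0_integral_sum//; last 2 first.
- by move=> x; apply/measurable_EFinP; apply: measurable_funM.
- by move=> x w _; rewrite lee_fin mulr_ge0 ?expR_ge0.
have bnd x : (\int[P]_w ((\1_(X l @^-1` [set x]) w : R) * e x w)%:E
   <= ((n1 * n2)%:R^-1 * (1 + a x * Ms x.1 x.2 + 2 * (1 + zeta) ^+ 2 * (a x) ^+ 2))%:E)%E.
  rewrite expectation_indepM//; first last.
  - move=> A B mA mB.
    apply: (@model_indep (pred1 (Some (l, k0))) (pred1 (Some (l, k1)))).
    + by move=> i /eqP ->; apply/negP => /eqP [].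
    + apply: sub_sigma_algebra.
      apply: (@cylinder1 _ _ _ _ _ (Some (l, k0))) => //=.
      by exists ((\1_[set x] : T -> R) @^-1` A).
    + apply: sub_sigma_algebra.
      apply: (@cylinder1 _ _ _ _ _ (Some (l, k1))) => //=.
      exists ((fun t => expR (a x * (Ms x.1 x.2 + t))) @^-1` B); split => //.
      rewrite -[X in measurable X]setTI.
      suff : measurable_fun setT (fun t : R => expR (a x * (Ms x.1 x.2 + t))) by exact.
      apply: measurableT_comp; first exact: measurable_expR.
      by apply: measurable_funM => //; apply: measurable_funD.
  - by move=> w; exact: expR_ge0.
  have -> : (\int[P]_w (\1_(X l @^-1` [set x]) w : R)%:E = ((n1 * n2)%:R^-1)%:E)%E.
    by rewrite integral_indic//; rewrite setIT; exact: pX.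
  rewrite EFinM lee_pmul2l ?lte_fin ?invr_gt0 ?ltr0n ?muln_gt0 ?n1_gt0//.
  have -> : (\int[P]_w (e x w)%:E
     = (expR (a x * Ms x.1 x.2))%:E * \int[P]_w (expR (a x * z l w))%:E)%E.
    transitivity (\int[P]_w ((expR (a x * Ms x.1 x.2))%:E * (expR (a x * z l w))%:E))%E.
      by apply: eq_integral => w _; rewrite /e mulrDr expRD EFinM.
    apply: ge0_integralZl => //.
    - apply/measurable_EFinP; apply: measurableT_comp; first exact: measurable_expR.
      by apply: measurable_funM.
  have [_ [_ hmgf]] := hz l.
  apply: (@le_trans _ _ (expR (a x * Ms x.1 x.2) * expR (zeta ^+ 2 * (a x) ^+ 2))%:E).
    rewrite EFinM lee_pmul2l ?lte_fin ?expR_gt0//; apply: hmgf.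
    rewrite -[zeta^-1]mul1r ler_pdivlMr//; apply: le_trans (a1 x).
    by rewrite ler_wpM2l//; lra.
  rewrite lee_fin -expRD; exact: mgf_step.
apply: (@le_trans _ _ (\sum_(x : T) ((n1 * n2)%:R^-1 *
   (1 + a x * Ms x.1 x.2 + 2 * (1 + zeta) ^+ 2 * (a x) ^+ 2))%:E)%E).
  by apply: lee_sum => x _; exact: bnd.
rewrite sumEFin lee_fin -mulr_sumr.
rewrite !big_split /= sumr_const card_prod !card_ord.
have n0 : 0 < (n1 * n2)%:R :> R by rewrite ltr0n muln_gt0 n1_gt0.
rewrite -addrA mulrDr mulVf ?gt_eqF//.
rewrite /mgf_bound lerD2l mulrC ler_pM2r ?invr_gt0//.
apply: lerD.
- rewrite /matip mulr_sumr -(pair_bigA _ (fun i j => a (i, j) * Ms i j)) /=.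
  rewrite le_eqVlt; apply/orP; left; apply/eqP; apply: eq_bigr => i _.
  by rewrite mulr_sumr; apply: eq_bigr => j _; rewrite /a /= mulrAC mulrA.
- rewrite /frob2 mulr_sumr
    -(pair_bigA _ (fun i j => 2 * (1 + zeta) ^+ 2 * a (i, j) ^+ 2)) /=.
  rewrite le_eqVlt; apply/orP; left; apply/eqP; apply: eq_bigr => i _.
  rewrite mulr_sumr; apply: eq_bigr => j _; rewrite /a /= -lamE; ring.
Qed.

Lemma mgf_bound_ge0 (th : R) (V : 'M[R]_(n1, n2)) : 0 <= th ->
  (forall i j, th * `|V i j| <= 1) -> 0 <= mgf_bound th V.
Proof.
move=> th0 thV; rewrite -lee_fin; apply: le_trans (expectation_expw_le 0%N th0 thV).
by apply: integral_ge0 => w _; rewrite lee_fin expR_ge0.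
Qed.

Lemma mgf_bound_le (th : R) (V : 'M[R]_(n1, n2)) : mgf_bound th V
  <= expR ((th / (1 + zeta) * matip Ms V + 2 * th ^+ 2 * frob2 V) / (n1 * n2)%:R).
Proof. exact: expR_ge1Dx. Qed.

Lemma obs_sum_tail (th t : R) (V : 'M[R]_(n1, n2)) (ls : seq nat) : uniq ls -> 0 <= th ->
  (forall i j, th * `|V i j| <= 1) ->
  (P [set w | (t <= obs_sum V ls w)%R]
   <= (expR (- (th / (1 + zeta) * t)) * mgf_bound th V ^+ size ls)%:E)%E.
Proof.
move=> uls th0 thV; set lam := th / (1 + zeta).
have lam0 : 0 <= lam by rewrite /lam divr_ge0// ltW// addr_gt0.
pose G w := \prod_(l <- ls) expw lam V l w.
have hJ l : l \in ls -> sample_idx [in ls] (Some (l, k0)) /\ sample_idx [in ls] (Some (l, k1)).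
  by move=> h; rewrite /= h.
have mG : measurable_fun setT G.
  exact: (sub_measurable_fun (sub_measurable_prod_expw lam V hJ)).
have GE w : G w = expR (lam * obs_sum V ls w).
  by rewrite /G /obs_sum mulr_sumr expR_sum.
have G0 w : 0 <= G w by rewrite GE expR_ge0.
have mO : measurable_fun setT (obs_sum V ls).
  exact: (sub_measurable_fun (sub_measurable_obs_sum V hJ)).
have mA : measurable [set w | (t <= obs_sum V ls w)%R].
  have := mO measurableT _ (@measurable_itv R `[t, +oo[).
  rewrite setTI; congr (measurable _); apply/seteqP; split => w /=;
    by rewrite in_itv /= andbT.
have e0 : 0 < expR (lam * t) by exact: expR_gt0.
have step1 : ((expR (lam * t))%:E * P [set w | (t <= obs_sum V ls w)%R]
    <= \int[P]_w (G w)%:E)%E.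
  have -> : ((expR (lam * t))%:E * P [set w | (t <= obs_sum V ls w)%R]
    = \int[P]_(w in [set w | (t <= obs_sum V ls w)%R]) (expR (lam * t))%:E)%E.
    by rewrite integral_cst.
  apply: (@le_trans _ _ (\int[P]_(w in [set w | (t <= obs_sum V ls w)%R]) (G w)%:E)%E).
    apply: ge0_le_integral => //.
    - by apply/measurable_EFinP; apply: measurable_funS mG.
    - by move=> w /= tw; rewrite lee_fin GE ler_expR ler_wpM2l.
  apply: ge0_subset_integral => //; first exact/measurable_EFinP.
  by move=> w _; rewrite lee_fin.
have step2 : (\int[P]_w (G w)%:E <= (mgf_bound th V ^+ size ls)%:E)%E.
  rewrite expectation_prod_expw//; elim: (ls) => [|l s IH]; first by rewrite big_nil.
  rewrite big_cons /= exprS EFinM; apply: lee_pmul => //.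
  - by apply: integral_ge0 => w _; rewrite lee_fin expR_ge0.
  - apply: prode_ge0 => l' _; apply: integral_ge0 => w _; rewrite lee_fin expR_ge0//.
  - exact: expectation_expw_le.
have := le_trans step1 step2; rewrite muleC -lee_pdivlMr// => h.
by apply: (le_trans h); rewrite lee_fin expRN mulrC.
Qed.


Definition label_idx : pred (option (nat * 'I_3)) :=
  fun v => if v is Some (l, k) then val k == 2%N else true.

(** Over all [k] and [s] these events partition the space. They are independent of the samples, so
    conditioning on one of them keeps the law of the samples. *)
Lemma label_prob (k : nat) (s : {ffun 'I_k -> bool}) :
  exists D : set Omega,
    [/\ cylinder F label_idx D,
     (forall w, D w <-> Nn w = k /\ (forall i : 'I_k, S i w = s i)) &
     P D = (expR (- N) * N ^+ k / (k`!)%:R * (2^-1) ^+ k)%:E].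
Proof.
have [mN [mX [mS [mz [pN [pX [pS [hz ind]]]]]]]] := Hobs.
pose l2 (i : 'I_k) : option (nat * 'I_3) := Some (val i, k2).
pose A (v : option (nat * 'I_3)) : set Omega :=
  if v is Some (l, _) then
    [set w | forall i : 'I_k, val i = l -> S l w = s i]
  else Nn @^-1` [set k].
pose sq := None :: map l2 (enum 'I_k).
have usq : uniq sq.
  rewrite /= map_inj_uniq ?enum_uniq ?andbT; last by move=> i j [] /val_inj.
  by apply/mapP => -[].
have Al (i : 'I_k) : A (l2 i) = S i @^-1` [set s i].
  apply/seteqP; split => w /=; first by move/(_ i erefl).
  by move=> h j /val_inj ->.
have FA v : v \in sq -> F v (A v).
  rewrite inE => /orP[/eqP ->|/mapP[i _ ->]]; first by exists [set k].
  by rewrite Al /=; exists [set s i].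
have pSl l b : P (S l @^-1` [set b]) = (2^-1)%:E.
  case: b => //.
  have -> : S l @^-1` [set false] = ~` (S l @^-1` [set true]).
    by apply/seteqP; split => w /=; case: (S l w).
  rewrite probability_setC//; rewrite (_ : P _ = (2^-1)%:E)//.
  by rewrite -EFinB; congr (_%:E); lra.
exists (\big[setI/setT]_(v <- sq) A v); split.
- exists sq, A; split => // v; rewrite inE => /orP[/eqP ->|/mapP[i _ ->]] //.
- move=> w; rewrite in_big_setI; split.
    move=> h; split; first exact: (h None (mem_head _ _)).
    move=> i; have := h (l2 i); rewrite Al; apply.
    by rewrite inE; apply/orP; right; apply/map_f; rewrite mem_enum.
  move=> [h1 h2] v; rewrite inE => /orP[/eqP -> //|/mapP[i _ ->]].
  by rewrite Al /= h2.
- have hp (t : seq 'I_k) : (\prod_(i <- t) P (A (l2 i)))%E = ((2^-1) ^+ size t : R)%:E.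
    elim: t => [|i t IH]; first by rewrite big_nil.
    by rewrite big_cons IH Al pSl /= exprS EFinM.
  rewrite ind// /sq big_cons big_map hp size_enum_ord EFinM.
  by congr (_ * _)%E; exact: pN.
Qed.

Definition all_samples : pred (option (nat * 'I_3)) := sample_idx predT.

Lemma sub_all_samples (ls : pred nat) D :
  <<s cylinder F (sample_idx ls) >> D -> <<s cylinder F all_samples >> D.
Proof.
apply: sub_sigma_algebra2; apply: sub_cylinder => -[[l k]|] //=.
by rewrite /all_samples !unfold_in /= => /andP[_ ->].
Qed.

Definition labels (w : Omega) : {ffun 'I_(Nn w) -> bool} := [ffun i : 'I_(Nn w) => S i w].

(* Conditioning on the (independent) sample size and labels, and summing the Poisson series. *)
Lemma poisson_label_bound (Bad : forall k, {ffun 'I_k -> bool} -> set Omega)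
    (ts : seq (R * R * R)) :
  (forall k s, <<s cylinder F all_samples >> (Bad k s)) ->
  (forall p, p \in ts -> [/\ 0 <= p.1.1, 0 <= p.1.2 & 0 <= p.2]) ->
  (forall k s, (P (Bad k s)
     <= (\sum_(p <- ts) p.1.1 * \prod_(i < k) (if s i then p.1.2 else p.2))%:E)%E) ->
  let B := [set w | Bad (Nn w) (labels w) w] in
  measurable B /\
  (P B <= (\sum_(p <- ts) p.1.1 * expR (N * ((p.1.2 + p.2) / 2 - 1)))%:E)%E.
Proof.
move=> sB ts0 pB B.
have mBad k s : measurable (Bad k s).
  exact: (sigma_cylinder_measurable model_events_measurable (sB k s)).
pose D k s := projT1 (cid (@label_prob k s)).
have DP k s : [/\ cylinder F label_idx (D k s),
     (forall w, D k s w <-> Nn w = k /\ (forall i : 'I_k, S i w = s i)) &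
     P (D k s) = (expR (- N) * N ^+ k / (k`!)%:R * (2^-1) ^+ k)%:E].
  exact: (projT2 (cid (@label_prob k s))).
have mD k s : measurable (D k s).
  by have [cD _ _] := DP k s; apply: (cylinder_measurable model_events_measurable cD).
pose C k := \big[setU/set0]_(s : {ffun 'I_k -> bool}) (D k s `&` Bad k s).
have mC k : measurable (C k).
  by apply: bigsetU_measurable => s _; exact: measurableI.
have BE : B = \bigcup_k C k.
  apply/seteqP; split => w /=.
    move=> Bw; exists (Nn w) => //; rewrite /C -bigcup_seq.
    exists (labels w); first by rewrite /= mem_index_enum.
    split => //; have [_ -> _] := DP (Nn w) (labels w); split => // i.
    by rewrite ffunE.
  move=> [k _]; rewrite /C -bigcup_seq => -[s _ [Dw Bw]].
  have [_ h _] := DP k s; move: Dw => /h [Nk Ss]; subst k.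
  have e : labels w = s by apply/ffunP => i; rewrite ffunE Ss.
  by rewrite /B /= e.
have mB : measurable B by rewrite BE; exact: bigcup_measurable.
split => //.
(* The term of order [k] of exp(-N) exp(N (a + g) / 2), times the prefactor [p.1.1], where a =
   [p.1.2] and g = [p.2] are the factors of the two label values. *)
pose u (p : R * R * R) k : R :=
  p.1.1 * (expR (- N) * exp_coeff (N * ((p.1.2 + p.2) / 2)) k).
have pC k : (P (C k) <= (\sum_(p <- ts) u p k)%:E)%E.
  apply: (@le_trans _ _ (\sum_(s : {ffun 'I_k -> bool}) P (D k s `&` Bad k s))%E).
    by apply: measure_bigsetU_le => s; exact: measurableI.
  pose c := expR (- N) * N ^+ k / (k`!)%:R * (2^-1) ^+ k : R.
  have c0 : 0 <= c.
    by rewrite /c !mulr_ge0 ?expR_ge0 ?exprn_ge0 ?invr_ge0 ?ler0n.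
  apply: (@le_trans _ _ (\sum_(s : {ffun 'I_k -> bool})
    (c * \sum_(p <- ts) p.1.1 * \prod_(i < k) (if s i then p.1.2 else p.2))%:E)%E).
    apply: lee_sum => s _; have [cD _ pD] := DP k s.
    rewrite (@model_indep label_idx all_samples) => //.
    - by rewrite pD -/c [X in (_ <= X)%E]EFinM; apply: lee_pmul; rewrite ?lee_fin//; exact: pB.
    - move=> [[l j]|] //=; rewrite /all_samples /= => /eqP ->; by [].
    - exact: sub_sigma_algebra.
  rewrite sumEFin lee_fin -mulr_sumr exchange_big /= mulr_sumr.
  rewrite le_eqVlt; apply/orP; left; apply/eqP; apply: eq_bigr => p _.
  (* Summed over all label vectors, the products give (a + g)^k. *)
  rewrite -mulr_sumr -(bigA_distr_bigA (fun (i : 'I_k) (b : bool) => if b then p.1.2 else p.2)).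
  rewrite (eq_bigr (fun=> p.1.2 + p.2)); last first.
    by move=> i _; rewrite big_bool.
  rewrite prodr_const card_ord /u /exp_coeff /= /c !exprMn.
  have k0' : (k`!)%:R != 0 :> R by rewrite pnatr_eq0 -lt0n fact_gt0.
  rewrite !exprVn; field.
  by rewrite k0' expf_neq0 ?pnatr_eq0.
have u0 p k : p \in ts -> 0 <= u p k.
  move=> /ts0[c0 a0 g0]; apply: mulr_ge0 => //; apply: mulr_ge0; first exact: expR_ge0.
  apply: exp_coeff_ge0; apply: mulr_ge0 => //; apply: divr_ge0 => //; exact: addr_ge0.
rewrite BE; apply: (le_trans (generalized_Boole_inequality P mC _)); first by rewrite -BE.
apply: (@le_trans _ _ (\sum_(0 <= k <oo) (\sum_(p <- ts) u p k)%:E)%E).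
  by apply: lee_nneseries => // k _; exact: pC.
apply: lime_le.
  apply: is_cvg_nneseries => k _ _; rewrite lee_fin big_seq sumr_ge0// => p hp.
  exact: u0.
apply: nearW => n; rewrite sumEFin lee_fin exchange_big /=.
rewrite [X in X <= _]big_seq [X in _ <= X]big_seq; apply: ler_sum => p hp.
have [c0 a0 g0] := ts0 _ hp.
rewrite /u -mulr_sumr -mulr_sumr; apply: ler_wpM2l => //.
have -> : N * ((p.1.2 + p.2) / 2 - 1) = - N + N * ((p.1.2 + p.2) / 2) by ring.
rewrite expRD; apply: ler_wpM2l; first exact: expR_ge0.
by apply: exp_coeff_partial_le; rewrite mulr_ge0// divr_ge0// addr_ge0.
Qed.

End Model.

(** * Choice of the exponential parameter *)

Section BernsteinExponents.
Context {R : realType}.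

(** Bernstein's two regimes, with s = sqrt(nu H / p): the Gaussian choice s / nu while it respects
    [th * b <= 1], and otherwise the boundary value 1 / b, for which the term b H / p of the
    deviation alone yields H. *)
Lemma full_exponent (p nu b H : R) : 0 < p -> 0 < nu -> 0 < b -> 0 <= H ->
  exists th, [/\ 0 <= th, th * b <= 1 &
   - (th * (p * (3 * Num.sqrt (nu * H / p) + b * H / p))) + 2 * p * th ^+ 2 * nu <= - H].
Proof.
move=> p0 nu0 b0 H0; set s := Num.sqrt _.
have s0 : 0 <= s by exact: sqrtr_ge0.
have s2 : s ^+ 2 = nu * H / p.
  by rewrite sqr_sqrtr// divr_ge0 ?mulr_ge0// ltW.
have pp : p != 0 by rewrite gt_eqF.
have nn : nu != 0 by rewrite gt_eqF.
have bb : b != 0 by rewrite gt_eqF.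
have [h|h] := leP (s * b) nu.
  exists (s / nu); split; first by rewrite divr_ge0// ltW.
    by rewrite mulrAC ler_pdivrMr// mul1r.
  have e1 : p * s ^+ 2 / nu = H by rewrite s2; field; rewrite pp nn.
  have -> : - (s / nu * (p * (3 * s + b * H / p))) + 2 * p * (s / nu) ^+ 2 * nu
     = - (p * s ^+ 2 / nu) - s / nu * b * H by field; rewrite pp nn.
  rewrite e1 lerBlDr lerDl.
  by rewrite !mulr_ge0// ?invr_ge0 ltW.
exists (b^-1); split; first by rewrite invr_ge0 ltW.
  by rewrite mulVf.
have -> : - (b^-1 * (p * (3 * s + b * H / p))) + 2 * p * b^-1 ^+ 2 * nu
   = - H + (2 * (nu / b) - 3 * s) * (p / b) by field; rewrite pp bb.
rewrite gerDl; apply: mulr_le0_ge0; last by rewrite divr_ge0// ltW.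
have : nu / b <= s by rewrite ler_pdivrMr// ltW.
lra.
Qed.

(** The factor 12/5 is 2 * 2 * 3/5: the variance constant, the bound [2 * #|B|] on a squared norm,
    and at most 3/5 N samples in the second half. At q = 9/4 L the choice 3/2 L / s reaches 1;
    beyond, it yields 12 - 27/5 > 6. *)
Lemma edge_exponent (q L : R) : 0 <= q -> 0 < L ->
  exists th, [/\ 0 <= th, th <= 1 &
   - (8 * th * (Num.sqrt (q * L) + L)) + 12 / 5 * th ^+ 2 * q <= - (6 * L)].
Proof.
move=> q0 L0; set s := Num.sqrt _.
have s0 : 0 <= s by exact: sqrtr_ge0.
have s2 : s ^+ 2 = q * L by rewrite sqr_sqrtr// mulr_ge0// ltW.
have [h|h] := leP q (9 / 4 * L).
  exists 1; split => //.
  have : q <= 3 / 2 * s.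
    rewrite -ler_sqr ?nnegrE ?mulr_ge0// exprMn s2.
    have : q * q <= q * (9 / 4 * L) by rewrite ler_wpM2l.
    rewrite -expr2; lra.
  rewrite expr1n; lra.
have s1 : 3 / 2 * L < s.
  have l0 : 0 <= 3 / 2 * L by rewrite mulr_ge0// ltW.
  rewrite -(@ltr_pXn2r _ 2) ?nnegrE// exprMn s2.
  have : L * (9 / 4 * L) < L * q by rewrite ltr_pM2l.
  rewrite [L * q]mulrC expr2; lra.
have sp : 0 < s by apply: lt_trans s1; rewrite mulr_gt0.
exists (3 / 2 * L / s); split.
- by rewrite !mulr_ge0// ?invr_ge0// ltW.
- by rewrite ler_pdivrMr// mul1r ltW.
have ss : s != 0 by rewrite gt_eqF.
have -> : - (8 * (3 / 2 * L / s) * (s + L)) + 12 / 5 * (3 / 2 * L / s) ^+ 2 * q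
   = - (12 * L) - 12 * (L ^+ 2 / s) + 27 / 5 * (L * (q * L) / s ^+ 2).
  by field.
rewrite -s2 mulfK ?expf_neq0//.
have : 0 <= L ^+ 2 / s by rewrite divr_ge0// sqr_ge0.
lra.
Qed.

End BernsteinExponents.

(** * Blocks as functions of the column sums *)

Section Blocks.
Context {R : realType} (m1 m2 : nat) (N zeta : R).
Hypothesis m1_gt0 : (0 < m1)%N.
Hypothesis m2_gt0 : (0 < m2)%N.
Hypothesis N_gt0 : 0 < N.
Hypothesis zeta_gt0 : 0 < zeta.
Hypothesis lg_gt0 : 0 < lg R m1 m2.

Lemma mn_gt0 : 0 < (m1 * m2)%:R :> R.
Proof. by rewrite ltr0n muln_gt0 m1_gt0. Qed.

Lemma tau_bl_gt0 : 0 < tau_bl m1 m2 N zeta.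
Proof.
rewrite /tau_bl; apply: mulr_gt0; first by apply: mulr_gt0 => //; apply: addr_gt0.
apply: ltr_wpDl; first exact: sqrtr_ge0.
by apply: mulr_gt0 => //; apply: divr_gt0 => //; exact: mn_gt0.
Qed.

Lemma thr_blk_ge0 b : 0 <= thr_blk m1 m2 N zeta b.
Proof.
rewrite /thr_blk; apply: mulr_ge0; first by apply: mulr_ge0 => //; rewrite addr_ge0// ltW.
apply: addr_ge0; first exact: sqrtr_ge0.
by apply: mulr_ge0; [rewrite divr_ge0// ltW|exact: ltW].
Qed.

Lemma thr_fullE : thr_full m1 m2 N zeta = thr_blk m1 m2 N zeta m2.
Proof.
rewrite /thr_full /thr_blk; congr (_ * (Num.sqrt _ + _)).
by rewrite mulnA !natrM; field; rewrite gt_eqF.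
Qed.

Lemma K_bl_gt0 : (0 < K_bl m1 m2 N zeta)%N.
Proof.
rewrite /K_bl absz_gt0 gt_eqF// -(@ltr_int R).
apply: lt_le_trans (Num.Theory.ceil_ge _).
by apply: divr_gt0; [rewrite ltr0n|exact: tau_bl_gt0].
Qed.

(** The block index as a function of one real number, the column sum: it is monotone, hence
    measurable. *)
Definition blidx_of (c : R) : nat :=
  if c < tau_bl m1 m2 N zeta then 1%N
  else minn (K_bl m1 m2 N zeta) (`|Num.floor (c / tau_bl m1 m2 N zeta)|%N).+1.

Lemma blidxE (Y : 'M[R]_(m1, m2)) j : blidx N zeta Y j = blidx_of (colsum Y j).
Proof. by []. Qed.

Lemma blidx_of_bounds c : (1 <= blidx_of c <= K_bl m1 m2 N zeta)%N.
Proof.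
have K0 := K_bl_gt0.
rewrite /blidx_of; case: ifP => _; first by rewrite K0.
by rewrite leq_min K0 /= geq_minl.
Qed.

Lemma blidx_of_homo : {homo blidx_of : c c' / c <= c' >-> (c <= c')%N}.
Proof.
move=> c c' cc'; have K0 := K_bl_gt0; have t0 := tau_bl_gt0.
rewrite /blidx_of; case: ltP => [h|h].
  by case: ifP => _ //; rewrite leq_min K0.
rewrite ltNge (le_trans h cc') /=.
rewrite leq_min geq_minl /= (leq_trans (geq_minr _ _))// ltnS.
have f1 : Num.floor (c / tau_bl m1 m2 N zeta) <= Num.floor (c' / tau_bl m1 m2 N zeta).
  by apply: le_floor; rewrite ler_pM2r// invr_gt0.
have f0 : 0 <= Num.floor (c / tau_bl m1 m2 N zeta).
  by rewrite floor_ge0 divr_ge0// ?(le_trans (ltW t0))// ltW.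
by rewrite -lez_nat !gez0_abs// (le_trans f0).
Qed.

Lemma blidx_of_measurable k : measurable [set c | blidx_of c = k].
Proof.
have mf : measurable_fun setT (fun c : R => (blidx_of c)%:R : R).
  by apply: nondecreasing_measurable => // c c' cc'; rewrite ler_nat; exact: blidx_of_homo.
have := mf measurableT _ (measurable_set1 (k%:R : R)).
rewrite setTI; congr (measurable _); apply/seteqP; split => c /=.
  by move/eqP; rewrite eqr_nat => /eqP.
by move=> ->.
Qed.

(* A block of the partition is a set of consecutive values of the block index, so that
   it is determined by at most two of its columns. *)
Definition candidate (f : 'I_m2 -> nat) (o : option ('I_m2 * 'I_m2 * bool)) : {set 'I_m2} :=
  match o with
  | None => [set: 'I_m2]%SET
  | Some (j1, _, true) => [set j | f j == f j1]%SET
  | Some (j1, j2, false) =>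
      [set j | (#|[set j' | f j' == f j]%SET|%:R < beta_bl m1 m2 N)%R
                && (f j1 <= f j <= f j2)%N]%SET
  end.

Lemma in_bigcup_seq (T : eqType) (g : seq T) (A : T -> {set 'I_m2}) j :
  (j \in \bigcup_(k <- g) A k) = has (fun k => j \in A k) g.
Proof.
by elim: g => [|k g IH]; rewrite ?big_nil ?inE// big_cons inE IH.
Qed.

Lemma blk_union (Y : 'M[R]_(m1, m2)) (g : seq nat) j :
  (j \in \bigcup_(k <- g) blk N zeta Y k) = (blidx N zeta Y j \in g).
Proof.
rewrite in_bigcup_seq; apply/hasP/idP => [[k kg]|h]; first by rewrite inE => /eqP ->.
by exists (blidx N zeta Y j) => //; rewrite inE.
Qed.

(** A merged group is a contiguous piece of the increasing list of small block indices, so it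
    consists of all small blocks whose index lies between its two extremes. *)
Lemma blocking_candidate (Y : 'M[R]_(m1, m2)) BL B :
  is_blocking N zeta Y BL -> B \in BL ->
  B = finset.set0 \/ exists o, B = candidate (blidx N zeta Y) o.
Proof.
move=> [groups [fl [-> _]]]; rewrite mem_cat => /orP[/mapP[k]|/mapP[g gG ->]].
  move=> _ ->; have [->|[j1 hj1]] := set_0Vmem (blk N zeta Y k); first by left.
  right; exists (Some (j1, j1, true)); apply/setP => j; rewrite !inE.
  by move: hj1; rewrite inE => /eqP ->.
have [->|[j0 hj0]] := set_0Vmem (\bigcup_(k <- g) blk N zeta Y k); first by left.
right.
set U := (\bigcup_(k <- g) blk N zeta Y k) in hj0 *.
have [j1 j1U min1] := arg_minnP (blidx N zeta Y) hj0.
have [j2 j2U max2] := arg_maxnP (blidx N zeta Y) hj0.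
exists (Some (j1, j2, false)); apply/setP => j; rewrite [RHS]inE.
set smalls := [seq _ <- _ | _] in fl.
have [s1 [s2 es]] : exists s1 s2, smalls = s1 ++ g ++ s2.
  rewrite -fl; elim: (groups) gG => // h gs IH; rewrite inE => /orP[/eqP <-|/IH[s1 [s2 e]]].
    by exists [::], (flatten gs).
  by exists (h ++ s1), s2; rewrite /= e -!catA.
have srt : sorted ltn smalls by apply: sorted_filter; [exact: ltn_trans|exact: iota_ltn_sorted].
have sm j' : (blidx N zeta Y j' \in smalls) =
    (#|[set j'' | blidx N zeta Y j'' == blidx N zeta Y j']%SET|%:R < beta_bl m1 m2 N).
  rewrite mem_filter mem_iota -ltNge /blk; case/andP: (blidx_of_bounds (colsum Y j')) => a b.
  by rewrite blidxE a /= add1n ltnS b andbT.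
apply/idP/idP => [jU|/andP[]].
  have h2 : (blidx N zeta Y j <= blidx N zeta Y j2)%N by exact: max2.
  rewrite -sm min1//= h2 andbT es !mem_cat.
  by move: jU; rewrite /U blk_union => ->; rewrite orbT.
move: srt; rewrite (sorted_pairwise ltn_trans) es !pairwise_cat allrel_catr.
move=> /and3P[/andP[a1 _] _ /and3P[a2 _ _]].
have j1g : blidx N zeta Y j1 \in g by rewrite -blk_union.
have j2g : blidx N zeta Y j2 \in g by rewrite -blk_union.
rewrite -sm es !mem_cat => /orP[hj|/orP[hj|hj]] /andP[h1 h2].
- by have := allrelP a1 _ _ hj j1g; rewrite ltnNge h1.
- by rewrite /U blk_union.
- by have := allrelP a2 _ _ j2g hj; rewrite ltnNge h2.
Qed.

End Blocks.

(** * Deviations of linear forms of the observation matrix *)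

Section FullSample.
Context {R : realType} {d : measure_display} {Omega : measurableType d}
  (P : probability Omega R) (n1 n2 : nat) (N zeta : R)
  (Ms : 'M[R]_(n1, n2)) (Nn : Omega -> nat)
  (X : nat -> Omega -> 'I_n1 * 'I_n2) (z : nat -> Omega -> R)
  (S : nat -> Omega -> bool).
Hypothesis n1_gt0 : (0 < n1)%N.
Hypothesis n2_gt0 : (0 < n2)%N.
Hypothesis zeta_gt0 : 0 < zeta.
Hypothesis N_gt0 : 0 < N.
Hypothesis Ms01 : forall i j, 0 <= Ms i j <= 1.
Hypothesis Hobs : obs_model P N zeta Nn X z S.

Local Notation F := (model_events Nn X z S).

Lemma matip_Ymat (V : 'M[R]_(n1, n2)) keep Nm w :
  matip (Ymat Ms Nn X z keep Nm w) V
  = (n1 * n2)%:R / Nm * obs_sum Ms X z V [seq l <- iota 0 (Nn w) | keep l w] w.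
Proof.
rewrite /matip /obs_sum big_filter pair_bigA /=.
transitivity (\sum_(x : 'I_n1 * 'I_n2) \sum_(l <- iota 0 (Nn w) | keep l w)
   (n1 * n2)%:R / Nm * ((Ms (X l w).1 (X l w).2 + z l w) * (X l w == x)%:R * V x.1 x.2)).
  apply: eq_bigr => x _.
  rewrite /Ymat mxE /index_iota subn0 mulr_sumr mulr_suml; apply: eq_bigr => l _.
  by rewrite -surjective_pairing; ring.
rewrite exchange_big /= mulr_sumr; apply: eq_bigr => l _.
rewrite (bigD1 (X l w))//= eqxx mulr1 big1 ?addr0// => x xN.
by rewrite eq_sym (negPf xN) mulr0 mul0r mulr0.
Qed.

Lemma matipN (A V : 'M[R]_(n1, n2)) : matip A (- V) = - matip A V.
Proof.
rewrite /matip -sumrN; apply: eq_bigr => i _; rewrite -sumrN; apply: eq_bigr => j _.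
by rewrite mxE mulrN.
Qed.

Lemma frob2N (V : 'M[R]_(n1, n2)) : frob2 (- V) = frob2 V.
Proof. by apply: eq_bigr => i _; apply: eq_bigr => j _; rewrite mxE sqrrN. Qed.

Lemma obs_sumN (V : 'M[R]_(n1, n2)) ls w :
  obs_sum Ms X z (- V) ls w = - obs_sum Ms X z V ls w.
Proof. by rewrite /obs_sum -sumrN; apply: eq_bigr => l _; rewrite mxE mulrN. Qed.

Lemma matipB (A B V : 'M[R]_(n1, n2)) : matip (A - B) V = matip A V - matip B V.
Proof.
rewrite /matip -sumrB; apply: eq_bigr => i _; rewrite -sumrB; apply: eq_bigr => j _.
by rewrite !mxE mulrBl.
Qed.

(** Once the labels are given, the retained samples form a deterministic list, as the conditional
    bounds require. *)
Definition samples (kf : bool -> bool) k (s : {ffun 'I_k -> bool}) : seq nat :=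
  [seq val i | i <- enum 'I_k & kf (s i)].

Lemma samples_uniq kf k s : uniq (@samples kf k s).
Proof.
by rewrite map_inj_uniq; [rewrite filter_uniq// enum_uniq|exact: val_inj].
Qed.

Lemma samples_labels kf w :
  [seq l <- iota 0 (Nn w) | kf (S l w)] = samples kf (labels Nn S w).
Proof.
rewrite -val_enum_ord filter_map /samples; congr map; apply: eq_filter => i /=.
by rewrite ffunE.
Qed.

Lemma expr_samples (q : R) kf k (s : {ffun 'I_k -> bool}) :
  q ^+ size (samples kf s) = \prod_(i < k) (if kf (s i) then q else 1).
Proof.
rewrite size_map -sum1_size big_filter -[in RHS]big_enum /=.
elim: (enum _) => [|i t IH]; first by rewrite !big_nil.
by rewrite !big_cons; case: ifP => _; rewrite ?exprD ?expr1 IH// mul1r.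
Qed.

Lemma obs_sum_sigma (V : 'M[R]_(n1, n2)) ls (A : set R) : measurable A ->
  <<s cylinder F (sample_idx [in ls]) >> (obs_sum Ms X z V ls @^-1` A).
Proof.
move=> mA; apply: sub_preimage => //; apply: sub_measurable_obs_sum => l hl.
by rewrite /sample_idx /= hl.
Qed.

Lemma obs_sum_ge_sigma (V : 'M[R]_(n1, n2)) ls t :
  <<s cylinder F (sample_idx [in ls]) >> [set w | (t <= obs_sum Ms X z V ls w)%R].
Proof.
have := @obs_sum_sigma V ls `[t, +oo[%classic (measurable_itv _).
congr (<<s _ >> _); apply/seteqP; split => w /=; by rewrite in_itv /= andbT.
Qed.

Lemma scaled_le (n M u m o : R) : 0 < n -> 0 < M ->
  (u <= n / M * o - m) = (M / n * (u + m) <= o).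
Proof. by move=> n0 M0; rewrite lerBrDr -ler_pdivrMl ?divr_gt0// invf_div. Qed.

(* Chernoff bound when only the observations whose label satisfies [kf] are kept; the
   kept sample has Poisson size of mean [N * rho]. *)
Lemma chernoff (kf : bool -> bool) (rho th u : R) (V : 'M[R]_(n1, n2)) :
  rho = (kf true + kf false)%:R / 2 -> 0 < rho -> 0 <= th ->
  (forall i j, th * `|V i j| <= 1) ->
  let B := [set w | u <= matip (Ymat Ms Nn X z (fun l w => kf (S l w)) (N * rho) w - Ms) V] in
  measurable B /\
  (P B <= (expR (- (th / (1 + zeta) * (N * rho / (n1 * n2)%:R * u))
             + 2 * (N * rho / (n1 * n2)%:R) * th ^+ 2 * frob2 V))%:E)%E.
Proof.
move=> rhoE rho0 th0 thV B; set n := (n1 * n2)%:R.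
have n0 : 0 < n :> R by rewrite ltr0n muln_gt0 n1_gt0.
have Nr0 : 0 < N * rho by rewrite mulr_gt0.
pose t := N * rho / n * (u + matip Ms V).
pose Bad k (s : {ffun 'I_k -> bool}) :=
  [set w | (t <= obs_sum Ms X z V (samples kf s) w)%R].
have BE : B = [set w | Bad (Nn w) (labels Nn S w) w].
  apply/seteqP; split => w; rewrite /B /Bad /= matipB matip_Ymat samples_labels;
    by rewrite scaled_le.
have q0 := mgf_bound_ge0 n1_gt0 n2_gt0 zeta_gt0 Ms01 Hobs th0 thV.
set q := mgf_bound zeta Ms th V in q0.
have [] := @poisson_label_bound _ _ _ P n1 n2 N zeta Nn X z S (ltW N_gt0) Hobs Bad
  [:: (expR (- (th / (1 + zeta) * t)), if kf true then q else 1, if kf false then q else 1)].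
- move=> k s; apply: sub_all_samples; exact: obs_sum_ge_sigma.
- move=> pp; rewrite inE => /eqP -> /=; split; [exact: expR_ge0|by case: ifP|by case: ifP].
- move=> k s; rewrite big_seq1 /=.
  rewrite (eq_bigr (fun i => if kf (s i) then q else 1)); last by move=> i _; case: (s i).
  rewrite -expr_samples.
  exact: (obs_sum_tail n1_gt0 n2_gt0 zeta_gt0 Ms01 Hobs t (samples_uniq kf s) th0 thV).
rewrite -BE => mB pB; split => //; apply: (le_trans pB).
rewrite big_seq1 /= lee_fin -expRD ler_expR.
set a := (th / (1 + zeta) * matip Ms V + 2 * th ^+ 2 * frob2 V) / n.
(* Discarded samples have factor 1 and kept ones 1 + a, so the average over the label is 1 + rho a
   and the Poisson sum gives exp(N rho a). *)
have -> : ((if kf true then q else 1) + (if kf false then q else 1)) / 2 - 1 = rho * a.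
  rewrite rhoE /q /mgf_bound -/n -/a; case: (kf true); case: (kf false) => /=; by field.
rewrite le_eqVlt; apply/orP; left; apply/eqP.
rewrite /t /a; field; repeat (apply/andP; split); by rewrite gt_eqF ?addr_gt0 ?ltr0n.
Qed.

(** Here [p] is the expected number of observations of one entry. The parameter of [full_exponent]
    is divided by [1 + zeta], whence the prefactor of the deviation. *)
Lemma full_tail (nu b H : R) (V : 'M[R]_(n1, n2)) : 0 < nu -> 0 < b -> 0 <= H ->
  frob2 V <= nu -> (forall i j, `|V i j| <= b) ->
  let p := N / (n1 * n2)%:R in
  let B := [set w | (1 + zeta) * (3 * Num.sqrt (nu * H / p) + b * H / p)
     <= matip (Ymat Ms Nn X z (fun _ _ => true) N w - Ms) V] in
  measurable B /\ (P B <= (expR (- H))%:E)%E.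
Proof.
move=> nu0 b0 H0 Vnu Vb p.
have p0 : 0 < p by rewrite divr_gt0// ltr0n muln_gt0 n1_gt0.
have [th [th0 thb hth]] := full_exponent p0 nu0 b0 H0.
have thV i j : th * `|V i j| <= 1 by apply: le_trans thb; rewrite ler_wpM2l.
set u := (1 + zeta) * _.
have rho1 : 1 = (1 + 1)%:R / 2 :> R by field.
have [] := @chernoff (fun=> true) 1 th u V rho1 ltr01 th0 thV.
rewrite mulr1 -/p => mB pB; split => //.
apply: (le_trans pB); rewrite lee_fin ler_expR; apply: le_trans hth.
apply: lerD; last by rewrite ler_wpM2l// !mulr_ge0 ?sqr_ge0// ltW.
rewrite lerN2 /u le_eqVlt; apply/orP; left; apply/eqP; field.
by apply/andP; split; rewrite gt_eqF// addr_gt0.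
Qed.

(** The threshold in the units of [edge_exponent]: 16 becomes 8 because half a sample has mean size
    N / 2. *)
Lemma tau_exponent : 0 < lg R n1 n2 ->
  N / 2 / (n1 * n2)%:R * tau_bl n1 n2 N zeta
  = 8 * (1 + zeta) * (Num.sqrt (N / n2%:R * lg R n1 n2) + lg R n1 n2).
Proof.
move=> L0; rewrite /tau_bl; set L := lg R n1 n2 in L0 *.
have m1 : 0 < n1%:R :> R by rewrite ltr0n.
have m2 : 0 < n2%:R :> R by rewrite ltr0n.
have -> : Num.sqrt ((n1 ^ 2 * n2)%:R / N * L)
    = (n1%:R * n2%:R / N) * Num.sqrt (N / n2%:R * L).
  have h : 0 <= n1%:R * n2%:R / N :> R by rewrite divr_ge0 ?mulr_ge0 ?ler0n// ltW.
  rewrite -{1}(ger0_norm h) -sqrtr_sqr -sqrtrM ?sqr_ge0//; congr Num.sqrt.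
  by rewrite natrM natrX; field; rewrite !gt_eqF.
by rewrite natrM; field; rewrite !gt_eqF.
Qed.

Lemma colsum_tail (j : 'I_n2) (eps : bool) : 0 < lg R n1 n2 ->
  let B := [set w | tau_bl n1 n2 N zeta
     <= (-1) ^+ eps * (colsum (Ymat Ms Nn X z S (N / 2) w) j - colsum Ms j)] in
  measurable B /\ (P B <= (expR (- (6 * lg R n1 n2)))%:E)%E.
Proof.
move=> L0 B; set L := lg R n1 n2 in L0 *.
pose V : 'M[R]_(n1, n2) := \matrix_(i, j') ((-1) ^+ eps * (j' == j)%:R).
have ipV (A : 'M[R]_(n1, n2)) : matip A V = (-1) ^+ eps * colsum A j.
  rewrite /matip /colsum mulr_sumr; apply: eq_bigr => i _.
  rewrite (bigD1 j)//= !mxE eqxx mulr1 mulrC big1 ?addr0// => j' jj'.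
  by rewrite mxE (negPf jj') !mulr0.
have q0 : 0 <= N / n2%:R by rewrite divr_ge0 ?ler0n// ltW.
have [th [th0 th1 hth]] := edge_exponent q0 L0.
have V1 i j' : `|V i j'| <= 1.
  by rewrite mxE normrM normrX normrN normr1 expr1n mul1r; case: eqP; rewrite ?normr1 ?normr0.
have thV i j' : th * `|V i j'| <= 1 by apply: le_trans th1; rewrite ler_piMr.
have fV : frob2 V = n1%:R.
  rewrite /frob2 (eq_bigr (fun=> 1)) ?sumr_const ?card_ord// => i _.
  rewrite (bigD1 j)//= mxE eqxx mulr1 -exprM mulnC exprM sqrrN !expr1n.
  by rewrite big1 ?addr0// => j' jj'; rewrite mxE (negPf jj') mulr0 expr0n.
have rho2 : 2^-1 = (1 + 0)%:R / 2 :> R by rewrite addn0 mul1r.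
have [] := @chernoff id (2^-1) th (tau_bl n1 n2 N zeta) V rho2 _ th0 thV; first by rewrite invr_gt0.
rewrite (_ : [set w | _] = B); last first.
  by apply/seteqP; split => w; rewrite /B /= matipB !ipV -mulrBr.
move=> mB pB; split => //; apply: (le_trans pB); rewrite lee_fin ler_expR.
apply: le_trans hth; rewrite tau_exponent// -/L fV.
apply: lerD.
  rewrite lerN2 le_eqVlt; apply/orP; left; apply/eqP; field.
  by rewrite gt_eqF// addr_gt0.
have -> : 2 * (N / 2 / (n1 * n2)%:R) * th ^+ 2 * n1%:R = th ^+ 2 * (N / n2%:R).
  by rewrite natrM; field; rewrite !pnatr_eq0 -!lt0n n1_gt0 n2_gt0.
have : 0 <= th ^+ 2 * (N / n2%:R) by rewrite mulr_ge0// sqr_ge0.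
lra.
Qed.

End FullSample.

(** * Correctness of the edges *)

Section RowsEvent.
Context {R : realType} {d : measure_display} {Omega : measurableType d}
  (P : probability Omega R) (n1 n2 : nat) (N zeta : R)
  (Ms : 'M[R]_(n1, n2)) (Nn : Omega -> nat)
  (X : nat -> Omega -> 'I_n1 * 'I_n2) (z : nat -> Omega -> R)
  (S : nat -> Omega -> bool).
Hypothesis n1_gt0 : (0 < n1)%N.
Hypothesis n2_gt0 : (0 < n2)%N.
Hypothesis zeta_gt0 : 0 < zeta.
Hypothesis N_gt0 : 0 < N.
Hypothesis Ms01 : forall i j, 0 <= Ms i j <= 1.
Hypothesis Hobs : obs_model P N zeta Nn X z S.
Hypothesis lg_gt0 : 0 < lg R n1 n2.
Hypothesis N_large : 6 * lg R n1 n2 <= N / (10 * 20).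

Local Notation F := (model_events Nn X z S).
Local Notation L := (lg R n1 n2).
Local Notation Y1 := (Ymat Ms Nn X z S (N / 2)).
Local Notation Y2 := (Ymat Ms Nn X z (fun l w => ~~ S l w) (N / 2)).

Lemma sum_disjoint_le1 (T : finType) (pat : Omega -> T) :
  (forall f, measurable (pat @^-1` [set f])) ->
  (\sum_(f : T) P (pat @^-1` [set f]) <= 1)%E.
Proof.
move=> mp; rewrite -[X in (_ <= X)%E](probability_setT P).
have -> : (\sum_(f : T) P (pat @^-1` [set f]) =
   P (\big[setU/set0]_(f <- index_enum T) (pat @^-1` [set f])))%E.
  elim: (index_enum T) (index_enum_uniq T) => [_|f s IH /= /andP[fs us]].
    by rewrite !big_nil measure0.
  rewrite !big_cons measureU//; first by rewrite IH.
    by apply: bigsetU_measurable => g _.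
  apply/seteqP; split => w //= -[pf]; rewrite -bigcup_seq => -[g /= gs pg].
  by move: fs; rewrite -pf pg gs.
by apply: le_measure; rewrite ?inE//; apply: bigsetU_measurable => g _.
Qed.

(** Conditioning on the independent pattern: its values are disjoint events of total probability at
    most 1, so the number of patterns costs nothing. *)
Lemma decouple (T : finType) (pat : Omega -> T) (J1 J2 : pred (option (nat * 'I_3)))
    (bad : T -> set Omega) (c : R) : 0 <= c ->
  (forall i, J1 i -> ~~ J2 i) ->
  (forall f, <<s cylinder F J1 >> (pat @^-1` [set f])) ->
  (forall f, <<s cylinder F J2 >> (bad f)) ->
  (forall f, (P (bad f) <= c%:E)%E) ->
  (P [set w | bad (pat w) w] <= c%:E)%E.
Proof.
move=> c0 J12 sp sb pb.
have mp f : measurable (pat @^-1` [set f]).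
  exact: (sigma_cylinder_measurable (model_events_measurable Hobs) (sp f)).
have mb f : measurable (bad f).
  exact: (sigma_cylinder_measurable (model_events_measurable Hobs) (sb f)).
have -> : [set w | bad (pat w) w]
    = \big[setU/set0]_(f <- index_enum T) ((pat @^-1` [set f]) `&` bad f).
  apply/seteqP; split => w; rewrite -bigcup_seq /=.
    by move=> h; exists (pat w); rewrite //= mem_index_enum.
  by move=> [f _ [<-]].
apply: (le_trans (measure_bigsetU_le _ _ _)); first by move=> f; exact: measurableI.
apply: (@le_trans _ _ (\sum_(f : T) P (pat @^-1` [set f]) * c%:E)%E).
  apply: lee_sum => f _; rewrite (model_indep Hobs J12 (sp f) (sb f)).
  by apply: lee_pmul.
rewrite -ge0_sume_distrl//.
apply: (@le_trans _ _ (1 * c%:E)%E); last by rewrite mul1e.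
apply: lee_pmul; [by apply: sume_ge0|by rewrite lee_fin|exact: sum_disjoint_le1|by []].
Qed.

Definition diffmx (u v : 'I_n1) (B : {set 'I_n2}) : 'M[R]_(n1, n2) :=
  \matrix_(i, j) (((i == v)%:R - (i == u)%:R) * (j \in B)%:R).

Lemma matip_diffmx (A : 'M[R]_(n1, n2)) u v B :
  matip A (diffmx u v B) = rowsumB A B v - rowsumB A B u.
Proof.
have h (k : 'I_n1) : \sum_i \sum_j A i j * ((i == k)%:R * (j \in B)%:R) = rowsumB A B k.
  rewrite (bigD1 k)//= [X in _ + X]big1 ?addr0 => [|i ik]; last first.
    by apply: big1 => j _; rewrite (negPf ik) mul0r mulr0.
  rewrite /rowsumB [RHS]big_mkcond /=; apply: eq_bigr => j _.
  by rewrite eqxx mul1r; case: ifP => _; rewrite ?mulr1 ?mulr0.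
rewrite -!h -sumrB; apply: eq_bigr => i _; rewrite -sumrB; apply: eq_bigr => j _.
by rewrite mxE; ring.
Qed.

Lemma diffmx_le1 u v B i j : `|diffmx u v B i j| <= 1.
Proof.
rewrite mxE; case: (j \in B); rewrite ?mulr1 ?mulr0 ?normr0//.
by case: (i == v); case: (i == u); rewrite ?subrr ?subr0 ?sub0r ?normrN ?normr1 ?normr0.
Qed.

Lemma frob2_diffmx u v B : frob2 (diffmx u v B) <= 2 * #|B|%:R.
Proof.
have h (k : 'I_n1) : \sum_(i < n1) \sum_(j < n2) ((i == k)%:R * (j \in B)%:R) = #|B|%:R :> R.
  rewrite (bigD1 k)//= [X in _ + X]big1 ?addr0 => [|i ik]; last first.
    by apply: big1 => j _; rewrite (negPf ik) mul0r.
  rewrite -sum1_card natr_sum [RHS]big_mkcond /=; apply: eq_bigr => j _.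
  by rewrite eqxx mul1r; case: ifP.
have -> : 2 * #|B|%:R = \sum_(i < n1) \sum_(j < n2) ((i == v)%:R * (j \in B)%:R)
   + \sum_(i < n1) \sum_(j < n2) ((i == u)%:R * (j \in B)%:R) :> R by rewrite !h; ring.
rewrite -big_split /=; apply: ler_sum => i _; rewrite -big_split /=.
apply: ler_sum => j _; rewrite mxE.
by case: (i == v); case: (i == u); case: (j \in B) => /=; lra.
Qed.

Lemma thr_exponent b : N / 2 / (n1 * n2)%:R * thr_blk n1 n2 N zeta b
  = 8 * (1 + zeta) * (Num.sqrt (N * b%:R / (n1 * n2)%:R * L) + L).
Proof.
have n0 : 0 < (n1 * n2)%:R :> R by rewrite ltr0n muln_gt0 n1_gt0.
rewrite /thr_blk; set n := (n1 * n2)%:R in n0 *.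
have -> : Num.sqrt (n / N * b%:R * L) = (n / N) * Num.sqrt (N * b%:R / n * L).
  have h : 0 <= n / N by rewrite divr_ge0 ?ltW.
  rewrite -{2}(ger0_norm h) -sqrtr_sqr -sqrtrM ?sqr_ge0//; congr Num.sqrt.
  by field; repeat (apply/andP; split); rewrite gt_eqF ?addr_gt0 ?ltr0n.
by field; repeat (apply/andP; split); rewrite gt_eqF ?addr_gt0 ?ltr0n.
Qed.

(** The sample list is frozen, so the conditional mean carries the actual size of the half sample
    instead of N / 2; [t'] has to exceed this mean by one threshold. *)
Lemma edge_tail (V : 'M[R]_(n1, n2)) (b : nat) (ls : seq nat) (t' : R) :
  (forall i j, `|V i j| <= 1) -> frob2 V <= 2 * b%:R -> uniq ls ->
  (size ls)%:R <= 3 / 5 * N ->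
  (size ls)%:R * (matip Ms V / (n1 * n2)%:R)
    + N / 2 / (n1 * n2)%:R * thr_blk n1 n2 N zeta b <= t' ->
  (P [set w | (t' <= obs_sum Ms X z V ls w)%R] <= (expR (- (6 * L)))%:E)%E.
Proof.
move=> V1 fV uls rN ht.
have n0 : 0 < (n1 * n2)%:R :> R by rewrite ltr0n muln_gt0 n1_gt0.
set n := (n1 * n2)%:R in n0 ht *.
have q0 : 0 <= N * b%:R / n by rewrite divr_ge0 ?mulr_ge0 ?ler0n// ltW.
have [th [th0 th1 hth]] := edge_exponent q0 lg_gt0.
have thV i j : th * `|V i j| <= 1 by apply: le_trans th1; rewrite ler_piMr.
apply: (le_trans (obs_sum_tail n1_gt0 n2_gt0 zeta_gt0 Ms01 Hobs t' uls th0 thV)).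
rewrite lee_fin.
apply: (@le_trans _ _ (expR (- (th / (1 + zeta) * t')) *
   expR ((th / (1 + zeta) * matip Ms V + 2 * th ^+ 2 * frob2 V) / n) ^+ size ls)).
  rewrite ler_wpM2l ?expR_ge0//; apply: lerXn2r; rewrite ?nnegrE ?expR_ge0//.
  - exact: (mgf_bound_ge0 n1_gt0 n2_gt0 zeta_gt0 Ms01 Hobs).
  - exact: mgf_bound_le.
rewrite -expRM_natl -expRD ler_expR; apply: le_trans hth.
set r := (size ls)%:R in rN ht *.
have lam0 : 0 <= th / (1 + zeta) by rewrite divr_ge0// addr_ge0// ltW.
have h1 := ler_wpM2l lam0 ht.
rewrite thr_exponent in h1.
have e1 : th / (1 + zeta) * (r * (matip Ms V / n) +
    8 * (1 + zeta) * (Num.sqrt (N * b%:R / n * L) + L)) =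
    th / (1 + zeta) * matip Ms V / n * r + 8 * th * (Num.sqrt (N * b%:R / n * L) + L).
  by field; repeat (apply/andP; split); rewrite gt_eqF ?addr_gt0 ?ltr0n.
have r0 : 0 <= r by rewrite /r ler0n.
have h2 : r * (2 * th ^+ 2 * frob2 V / n) <= 12 / 5 * th ^+ 2 * (N * b%:R / n).
  have -> : 12 / 5 * th ^+ 2 * (N * b%:R / n) = 3 / 5 * N * (2 * th ^+ 2 * (2 * b%:R) / n).
    by field; repeat (apply/andP; split); rewrite gt_eqF ?addr_gt0 ?ltr0n.
  apply: ler_pM => //.
    by rewrite !mulr_ge0 ?invr_ge0 ?sqr_ge0 ?(ltW n0)// sumr_ge0// => i _;
      rewrite sumr_ge0// => j _; exact: sqr_ge0.
  by rewrite ler_pM2r ?invr_gt0// ler_wpM2l// mulr_ge0// sqr_ge0.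
move: h1; rewrite e1 => h1.
have -> : r * ((th / (1 + zeta) * matip Ms V + 2 * th ^+ 2 * frob2 V) / n)
  = th / (1 + zeta) * matip Ms V / n * r + r * (2 * th ^+ 2 * frob2 V / n) by ring.
move: h1 h2; set a1 := th / (1 + zeta) * matip Ms V / n * r; set a2 := _ * t'.
set a3 := r * _; set a4 := 8 * th * _; set a5 := _ * _ * (_ / n).
by lra.
Qed.

(** The first part is a reversed edge, the second a missed one. Neither recentres the sum: in the
    first the sign of the mean suffices, in the second the factor 3 absorbs the fluctuation of the
    sample size. *)
Definition edge_bad (ls : seq nat) (u v : 'I_n1) (B : {set 'I_n2}) : set Omega :=
  let V := diffmx u v B in
  let t := N / 2 / (n1 * n2)%:R * thr_blk n1 n2 N zeta #|B| in
  (if matip Ms V <= 0 then [set w | (t <= obs_sum Ms X z V ls w)%R] else set0) `|`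
  (if 3 * thr_blk n1 n2 N zeta #|B| < matip Ms V
   then [set w | (- t <= obs_sum Ms X z (- V) ls w)%R] else set0).

Lemma edge_bad_sigma ls u v B : <<s cylinder F (sample_idx [in ls]) >> (edge_bad ls u v B).
Proof.
have h0 : <<s cylinder F (sample_idx [in ls]) >> set0 by exact: sigma_algebra0.
rewrite /edge_bad; set A := (if _ then _ else _); set A' := (if _ then _ else _).
have sA : <<s cylinder F (sample_idx [in ls]) >> A.
  by rewrite /A; case: ifP => _ //; exact: obs_sum_ge_sigma.
have sA' : <<s cylinder F (sample_idx [in ls]) >> A'.
  by rewrite /A'; case: ifP => _ //; exact: obs_sum_ge_sigma.
pose T : measurableType _ := g_sigma_algebraType (cylinder F (sample_idx [in ls])).
exact: (@measurableU _ T A A' sA sA').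
Qed.

Lemma edge_bad_prob ls u v B : uniq ls ->
  2 / 5 * N <= (size ls)%:R <= 3 / 5 * N ->
  (P (edge_bad ls u v B) <= (2 * expR (- (6 * L)))%:E)%E.
Proof.
move=> uls /andP[r1 r2].
have n0 : 0 < (n1 * n2)%:R :> R by rewrite ltr0n muln_gt0 n1_gt0.
have mob V t : measurable [set w | (t <= obs_sum Ms X z V ls w)%R].
  apply: (sigma_cylinder_measurable (model_events_measurable Hobs)).
  exact: obs_sum_ge_sigma.
rewrite /edge_bad; set V := diffmx u v B; set th := thr_blk n1 n2 N zeta #|B|.
set n := (n1 * n2)%:R in n0 *; set t := N / 2 / n * th.
have e0 : (0 <= (expR (- (6 * L)))%:E)%E by rewrite lee_fin expR_ge0.
have th0 : 0 <= th by exact: thr_blk_ge0.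
have t0 : 0 <= t by rewrite mulr_ge0// !divr_ge0 ?ltW.
have V1 i j : `|V i j| <= 1 by exact: diffmx_le1.
have fV : frob2 V <= 2 * #|B|%:R by exact: frob2_diffmx.
apply: (le_trans (measureU2 _ _ _)).
- by case: ifP.
- by case: ifP.
have -> : 2 * expR (- (6 * L)) = expR (- (6 * L)) + expR (- (6 * L)) by ring.
rewrite EFinD; apply: leeD.
  case: ifP => [D0|_]; last by rewrite measure0.
  apply: (edge_tail V1 fV uls r2); rewrite -/n -/th -/t gerDr.
  by apply: mulr_ge0_le0; [rewrite ler0n|rewrite pmulr_lle0 ?invr_gt0].
case: ifP => [D0|_]; last by rewrite measure0.
apply: (@edge_tail (- V) #|B|) => //.
- by move=> i j; rewrite mxE normrN.
- by rewrite frob2N.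
rewrite matipN -/n -/th -/t.
(* With at least 2/5 N samples the mean is at least 12/5 t, so falling to t takes a deviation of
   more than one threshold. *)
have : 2 / 5 * N * (3 * th / n) <= (size ls)%:R * (matip Ms V / n).
  apply: ler_pM => //.
  - by rewrite mulr_ge0// ltW.
  - by apply: divr_ge0; [exact: mulr_ge0|exact: ltW].
  - by rewrite ler_pM2r ?invr_gt0// ltW.
have -> : 2 / 5 * N * (3 * th / n) = 12 / 5 * t by rewrite /t; field; repeat (apply/andP; split); rewrite gt_eqF ?addr_gt0 ?ltr0n.
rewrite mulNr mulrN; lra.
Qed.

Lemma blidx_samples w :
  blidx N zeta (Y1 w) = fun j => blidx_of n1 n2 N zeta
    ((n1 * n2)%:R / (N / 2) *
     obs_sum Ms X z (\matrix_(i, j') (j' == j)%:R) (samples id (labels Nn S w)) w).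
Proof.
apply/funext => j; rewrite blidxE -(samples_labels Nn S id) -matip_Ymat; congr blidx_of.
rewrite /colsum /matip; apply: eq_bigr => i _.
rewrite (bigD1 j)//= [X in _ = _ * X + _]mxE eqxx mulr1 big1 ?addr0// => j' jj'.
by rewrite [X in _ * X]mxE (negPf jj') mulr0.
Qed.

(** The block indices of all columns for frozen labels, as an element of a finite type so that
    [decouple] applies. *)
Definition pattern k (s : {ffun 'I_k -> bool}) (w : Omega)
    : {ffun 'I_n2 -> 'I_(K_bl n1 n2 N zeta).+1} :=
  [ffun j => inord (blidx_of n1 n2 N zeta ((n1 * n2)%:R / (N / 2) *
     obs_sum Ms X z (\matrix_(i, j') (j' == j)%:R) (samples id s) w))].

Lemma pattern_sigma k (s : {ffun 'I_k -> bool}) f :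
  <<s cylinder F (sample_idx [in samples id s]) >> (pattern s @^-1` [set f]).
Proof.
pose T : measurableType _ := g_sigma_algebraType (cylinder F (sample_idx [in samples id s])).
have -> : pattern s @^-1` [set f] = \big[setI/setT]_(j : 'I_n2)
   (obs_sum Ms X z (\matrix_(i, j') (j' == j)%:R) (samples id s) @^-1`
     ((fun x => (n1 * n2)%:R / (N / 2) * x) @^-1` [set c | blidx_of n1 n2 N zeta c = f j])).
  apply/seteqP; split => w; rewrite -bigcap_seq /=.
    move=> <- j _ /=; rewrite ffunE inordK// ltnS.
    by case/andP: (blidx_of_bounds n1_gt0 n2_gt0 N_gt0 zeta_gt0 lg_gt0 ((n1 * n2)%:R / (N / 2) *
     obs_sum Ms X z (\matrix_(i, j') (j' == j)%:R) (samples id s) w)).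
  move=> h; apply/ffunP => j; rewrite ffunE; have /= -> := h j (mem_index_enum j).
  by rewrite inord_val.
apply: (@bigsetI_measurable _ T) => j _.
apply: (@obs_sum_sigma _ _ _ _ _ Ms Nn X z S).
rewrite -[X in measurable X]setTI.
have mm : measurable_fun setT (fun x : R => (n1 * n2)%:R / (N / 2) * x).
  by apply: measurable_funM.
apply: mm => //; exact: blidx_of_measurable.
Qed.

(* On the event below, every edge tested by the algorithm is correct up to the
   threshold: no edge is reversed, and every gap larger than three thresholds is found. *)
Lemma rows_event : exists E : set Omega, [/\ measurable E,
  (P (~` E) <= (8 * (n1 * n2)%:R ^- 4)%:E)%E &
  forall w, E w -> forall BL, is_blocking N zeta (Y1 w) BL ->
    forall (B : {set 'I_n2}) (u v : 'I_n1), B = [set: 'I_n2]%SET \/ B \in BL ->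
    (rowsumB Ms B v <= rowsumB Ms B u ->
       rowsumB (Y2 w) B v - rowsumB (Y2 w) B u <= thr_blk n1 n2 N zeta #|B|) /\
    (3 * thr_blk n1 n2 N zeta #|B| < rowsumB Ms B v - rowsumB Ms B u ->
       thr_blk n1 n2 N zeta #|B| < rowsumB (Y2 w) B v - rowsumB (Y2 w) B u)].
Proof.
have n0 : 0 < (n1 * n2)%:R :> R by rewrite ltr0n muln_gt0 n1_gt0.
pose C := option ('I_n2 * 'I_n2 * bool).
pose cand (f : {ffun 'I_n2 -> 'I_(K_bl n1 n2 N zeta).+1}) (o : C) :=
  candidate n1 N (fun j => val (f j)) o.
pose ok k (s : {ffun 'I_k -> bool}) :=
  2 / 5 * N <= (size (samples negb s))%:R <= 3 / 5 * N.
pose badf ls f := \big[setU/set0]_(x : 'I_n1 * 'I_n1 * C) edge_bad ls x.1.1 x.1.2 (cand f x.2).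
(* A second half of abnormal size is declared bad outright. *)
pose Bad k (s : {ffun 'I_k -> bool}) :=
  if ok k s then [set w | badf (samples negb s) (pattern s w) w] else setT.
(* There are n1^2 (2 n2^2 + 1) <= 3 (n1 n2)^2 triples, each of probability at most 2 exp(-6 L). *)
pose c := 6 * (n1 * n2)%:R ^+ 2 * expR (- (6 * L)).
have c0 : 0 <= c by rewrite /c !mulr_ge0 ?exprn_ge0 ?ler0n ?expR_ge0.
have sbadf ls f : <<s cylinder F (sample_idx [in ls]) >> (badf ls f).
  pose T : measurableType _ := g_sigma_algebraType (cylinder F (sample_idx [in ls])).
  by apply: (@bigsetU_measurable _ T) => x _; exact: edge_bad_sigma.
have disj k (s : {ffun 'I_k -> bool}) i :
    sample_idx [in samples id s] i -> ~~ sample_idx [in samples negb s] i.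
  case: i => [[l m]|] //= /andP[/mapP[i]]; rewrite mem_filter => /andP[/= si _] -> ->.
  rewrite andbT; apply/negP => /mapP[j]; rewrite mem_filter => /andP[/= sj _] /val_inj e.
  by move: sj; rewrite -e si.
have sBad k s : <<s cylinder F all_samples >> (Bad k s).
  pose T : measurableType _ := g_sigma_algebraType (cylinder F all_samples).
  rewrite /Bad; case: ifP => _; last exact: (@measurableT _ T).
  rewrite (_ : [set w | _] = \big[setU/set0]_(f <- index_enum _)
      ((pattern s @^-1` [set f]) `&` badf (samples negb s) f)); last first.
    apply/seteqP; split => w; rewrite -bigcup_seq /=.
      by move=> h; exists (pattern s w); rewrite //= mem_index_enum.
    by move=> [f _ [<-]].
  apply: (@bigsetU_measurable _ T) => f _; apply: (@measurableI _ T).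
    by apply: sub_all_samples; exact: pattern_sigma.
  by apply: sub_all_samples; exact: sbadf.
(* The last two triples of [ts] are exponential Markov bounds for the second half having more than
   3/5 N or fewer than 2/5 N samples. With parameter 1/10 both exponents are at most -N / 200, hence
   the constant in [N_large]. *)
pose t10 : R := 1 / 10.
pose ts : seq (R * R * R) := [:: (c, 1, 1); (expR (- (t10 * (3 / 5 * N))), 1, expR t10);
   (expR (t10 * (2 / 5 * N)), 1, expR (- t10))].
have prodE k (s : {ffun 'I_k -> bool}) (q : R) :
    \prod_(i < k) (if s i then 1 else q) = q ^+ size (samples negb s).
  by rewrite expr_samples; apply: eq_bigr => i _; case: (s i).
have pBad k s : (P (Bad k s)
     <= (\sum_(p <- ts) p.1.1 * \prod_(i < k) (if s i then p.1.2 else p.2))%:E)%E.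
  rewrite /ts !big_cons big_nil /= !prodE expr1n mulr1 addr0.
  rewrite -!expRM_natl -!expRD /Bad; case: ifPn => [hok|hno].
    apply: (@le_trans _ _ c%:E); last first.
      by rewrite lee_fin lerDl addr_ge0 ?expR_ge0.
    apply: (@decouple _ _ (sample_idx [in samples id s]) (sample_idx [in samples negb s])
      (badf (samples negb s))) => //.
    - exact: disj.
    - by move=> f; exact: pattern_sigma.
    - move=> f; apply: le_trans.
        apply: (@measure_bigsetU_le_const _ _ _ P _ _ (2 * expR (- (6 * L)))).
      + move=> x; apply: (sigma_cylinder_measurable (model_events_measurable Hobs)).
        exact: edge_bad_sigma.
      + move=> x; exact: (edge_bad_prob x.1.1 x.1.2 _ (samples_uniq negb s) hok).
      rewrite lee_fin /c mulrA ler_wpM2r ?expR_ge0//.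
      rewrite !card_prod card_option !card_prod card_bool !card_ord.
      have h0 : (0 < n2 * n2)%N by rewrite muln_gt0 n2_gt0.
      have h : (n1 * n1 * (n2 * n2 * 2).+1 <= 3 * (n1 * n1 * (n2 * n2)))%N.
        by rewrite mulnCA leq_mul//; lia.
      have e : (n1 * n2)%:R ^+ 2 = (n1 * n1 * (n2 * n2))%:R :> R.
        by rewrite !natrM; ring.
      by move: h; rewrite -(ler_nat R) natrM e; lra.
  apply: (le_trans (probability_le1 _ _)) => //.
  rewrite lee_fin -[X in X <= _]add0r; apply: lerD => //.
  move: hno; rewrite /ok negb_and -!ltNge => /orP[h|h].
    rewrite -[X in X <= _]add0r; apply: lerD; first exact: expR_ge0.
    by rewrite -[X in X <= _]expR0 ler_expR /t10; lra.
  rewrite -[X in X <= _]addr0; apply: lerD; last exact: expR_ge0.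
  by rewrite -[X in X <= _]expR0 ler_expR /t10; lra.
have ts0 p : p \in ts -> [/\ 0 <= p.1.1, 0 <= p.1.2 & 0 <= p.2].
  by rewrite !inE => /orP[/eqP ->|/orP[/eqP ->|/eqP ->]] /=; split=> //; exact: expR_ge0.
have [mB pB] := poisson_label_bound (ltW N_gt0) Hobs sBad ts0 pBad.
set Bt := [set w | _] in mB pB.
exists (~` Bt); split; first exact: measurableC.
  rewrite setCK; apply: (le_trans pB); rewrite lee_fin /ts !big_cons big_nil /= addr0.
  have e1 : expR t10 <= 1 + t10 + t10 ^+ 2.
    by apply: expR_le_quadratic; rewrite ger0_norm /t10; lra.
  have e2 : expR (- t10) <= 1 + - t10 + (- t10) ^+ 2.
    by apply: expR_le_quadratic; rewrite normrN ger0_norm /t10; lra.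
  have x1 : (1 + 1) / 2 - 1 = 0 :> R by lra.
  rewrite x1 mulr0 expR0 mulr1 -!expRD.
  have E1 : expR (- (t10 * (3 / 5 * N)) + N * ((1 + expR t10) / 2 - 1)) <= expR (- (6 * L)).
    by rewrite ler_expR; have := ler_wpM2l (ltW N_gt0) e1; have NL := N_large; rewrite /t10; lra.
  have E2 : expR (t10 * (2 / 5 * N) + N * ((1 + expR (- t10)) / 2 - 1)) <= expR (- (6 * L)).
    by rewrite ler_expR; have := ler_wpM2l (ltW N_gt0) e2; have NL := N_large; rewrite /t10; lra.
  have eL : expR (- (6 * L)) = (n1 * n2)%:R ^- 6.
    by rewrite expRN -/(6%:R) expRM_natl /lg lnK.
  have n1' : 1 <= (n1 * n2)%:R :> R by rewrite ler1n muln_gt0 n1_gt0.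
  apply: (@le_trans _ _ (6 * (n1 * n2)%:R ^+ 2 * (n1 * n2)%:R ^- 6 + 2 * (n1 * n2)%:R ^- 6)).
    rewrite /c -eL; lra.
  set n := (n1 * n2)%:R in n0 n1' *.
  have -> : 6 * n ^+ 2 * n ^- 6 = 6 * n ^- 4 by field; repeat (apply/andP; split); rewrite gt_eqF ?addr_gt0 ?ltr0n.
  have : n ^- 6 <= n ^- 4.
    by rewrite lef_pV2 ?posrE ?exprn_gt0//; apply: ler_weXn2l.
  lra.
move=> w nB BL hBL B u v hB.
have hpat : blidx N zeta (Y1 w) = fun j => val (pattern (labels Nn S w) w j).
  rewrite blidx_samples; apply/funext => j; rewrite ffunE /= inordK// ltnS.
  by case/andP: (blidx_of_bounds n1_gt0 n2_gt0 N_gt0 zeta_gt0 lg_gt0 ((n1 * n2)%:R / (N / 2) *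
     obs_sum Ms X z (\matrix_(i, j') (j' == j)%:R) (samples id (labels Nn S w)) w)).
have : B = finset.set0 \/ exists o, B = cand (pattern (labels Nn S w) w) o.
  case: hB => [->|hB]; first by right; exists None.
  have := blocking_candidate n1_gt0 n2_gt0 N_gt0 zeta_gt0 lg_gt0 hBL hB.
  by rewrite hpat.
case=> [->|[cd Bo]].
  have r0 (A : 'M[R]_(n1, n2)) k : rowsumB A finset.set0 k = 0 by rewrite /rowsumB big_set0.
  have t0 : 0 <= thr_blk n1 n2 N zeta #|@finset.set0 'I_n2| by exact: thr_blk_ge0.
  by rewrite !r0 subrr; split => // h; lra.
have nb : ~ edge_bad (samples negb (labels Nn S w)) u v B w.
  move=> hb; apply: nB; rewrite /Bt /= /Bad; case: ifP => // _ /=.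
  rewrite /badf -bigcup_seq; exists (u, v, cd); first by rewrite /= mem_index_enum.
  by rewrite /= -Bo.
set o := obs_sum Ms X z (diffmx u v B) (samples negb (labels Nn S w)) w.
have key : o = N / 2 / (n1 * n2)%:R * (rowsumB (Y2 w) B v - rowsumB (Y2 w) B u).
  rewrite -matip_diffmx matip_Ymat (samples_labels Nn S negb) -/o.
  by field; repeat (apply/andP; split); rewrite gt_eqF ?ltr0n.
have sc : 0 < N / 2 / (n1 * n2)%:R by rewrite !divr_gt0.
split=> h.
  rewrite leNgt; apply/negP => /ltW h'; apply: nb; left.
  by rewrite matip_diffmx subr_le0 h /= -/o key ler_pM2l.
rewrite ltNge; apply/negP => h'; apply: nb; right.
by rewrite matip_diffmx h /= obs_sumN lerN2 -/o key ler_pM2l.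
Qed.

End RowsEvent.

(** * Topological sorting *)

(** The closing arithmetic of [row_bias]: [a], [b] are the dimensions, [tt] is 16 (zeta + 1), [W] is
    (m1 L / N)^(1/4), [V] is (m2 L / N)^(1/2), [th] and [ta] are the full threshold and the block
    width. Every product is of order tt^2 a b times W^3 or W V. *)
Lemma bias_arith {R : realType} (a b tt W V th ta : R) :
  0 <= a -> 0 <= b -> 1 <= tt -> 0 <= W -> 0 <= V -> V <= 1 ->
  th <= tt * (2 * b * W ^+ 2) -> ta <= 2 * tt * a * V ->
  3 * (4 * tt * W) * (a * (3 * th)) + 6 * (4 * tt * W) * b * (3 * ta)
   + 12 * (4 * tt * W) * (b * W ^+ 2) * (a + ta) + a * (3 * (2 * tt * b * W ^+ 3))
  <= 20 * 20 * tt ^+ 2 * a * b * (W ^+ 3 + W * V).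
Proof.
move=> a0 b0 tt1 W0 V0 V1 T2 T3.
have tt0 : 0 <= tt by exact: le_trans tt1.
have W3 : 0 <= W ^+ 3 by rewrite exprn_ge0.
have A1 : W * a * tt * th <= W * a * tt * (tt * (2 * b * W ^+ 2)).
  by apply: ler_wpM2l => //; rewrite !mulr_ge0.
have A2 : tt * W * b * ta <= tt * W * b * (2 * tt * a * V).
  by apply: ler_wpM2l => //; rewrite !mulr_ge0.
have A3 : tt * W ^+ 3 * b * ta <= tt * W ^+ 3 * b * (2 * tt * a * V).
  by apply: ler_wpM2l => //; rewrite !mulr_ge0.
have M0 : 0 <= a * b * W ^+ 3 * tt by rewrite !mulr_ge0.
have A4 : a * b * W ^+ 3 * tt * 1 <= a * b * W ^+ 3 * tt * tt by apply: ler_wpM2l.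
have A5 : a * b * W ^+ 3 * tt * tt * V <= a * b * W ^+ 3 * tt * tt * 1.
  by apply: ler_wpM2l => //; exact: mulr_ge0.
have A6 : 0 <= a * b * tt ^+ 2 * (W * V) by rewrite !mulr_ge0 ?exprn_ge0.
have A7 : 0 <= a * b * tt ^+ 2 * W ^+ 3 by rewrite !mulr_ge0 ?exprn_ge0.
have -> : 3 * (4 * tt * W) * (a * (3 * th)) + 6 * (4 * tt * W) * b * (3 * ta)
   + 12 * (4 * tt * W) * (b * W ^+ 2) * (a + ta) + a * (3 * (2 * tt * b * W ^+ 3))
   = 36 * (W * a * tt * th) + 72 * (tt * W * b * ta) + 48 * (a * b * W ^+ 3 * tt * 1)
     + 48 * (tt * W ^+ 3 * b * ta) + 6 * (a * b * W ^+ 3 * tt * 1) by ring.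
have e1 : W * a * tt * (tt * (2 * b * W ^+ 2)) = 2 * (a * b * tt ^+ 2 * W ^+ 3) by ring.
have e2 : tt * W * b * (2 * tt * a * V) = 2 * (a * b * tt ^+ 2 * (W * V)) by ring.
have e3 : tt * W ^+ 3 * b * (2 * tt * a * V) = 2 * (a * b * W ^+ 3 * tt * tt * V) by ring.
have e4 : a * b * W ^+ 3 * tt * tt = a * b * tt ^+ 2 * W ^+ 3 by ring.
have -> : 20 * 20 * tt ^+ 2 * a * b * (W ^+ 3 + W * V)
   = 20 * 20 * (a * b * tt ^+ 2 * W ^+ 3) + 20 * 20 * (a * b * tt ^+ 2 * (W * V)) by ring.
rewrite e1 in A1; rewrite e2 in A2; rewrite e3 in A3; rewrite e4 in A4; rewrite mulr1 e4 in A5.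
lra.
Qed.

Section Sorting.
Context {R : realType} (m1 m2 : nat) (N zeta : R) (Ms Y1 Y2 : 'M[R]_(m1, m2))
  (pis : 'S_m1) (sgs : 'S_m2) (BL : seq {set 'I_m2}) (pih : 'S_m1).
Hypothesis m1_gt0 : (0 < m1)%N.
Hypothesis m2_gt0 : (0 < m2)%N.
Hypothesis N_gt0 : 0 < N.
Hypothesis zeta_gt0 : 0 < zeta.
Hypothesis lg_gt0 : 0 < lg R m1 m2.
Hypothesis HMs : in_CBISO pis sgs Ms.
Hypothesis HBL : is_blocking N zeta Y1 BL.
Hypothesis Hedge : forall (B : {set 'I_m2}) (u v : 'I_m1),
    B = [set: 'I_m2]%SET \/ B \in BL ->
    (rowsumB Ms B v <= rowsumB Ms B u ->
       rowsumB Y2 B v - rowsumB Y2 B u <= thr_blk m1 m2 N zeta #|B|) /\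
    (3 * thr_blk m1 m2 N zeta #|B| < rowsumB Ms B v - rowsumB Ms B u ->
       thr_blk m1 m2 N zeta #|B| < rowsumB Y2 B v - rowsumB Y2 B u).
Hypothesis Hpih : is_topsort (edge N zeta Y2 BL) pih \/
     ((forall p, ~ is_topsort (edge N zeta Y2 BL) p) /\ pih = 1%g).

Lemma Ms_range i j : 0 <= Ms i j <= 1.
Proof. by have [B0 [[h _] ->]] := HMs; rewrite mxE. Qed.

Lemma Ms_row_mono u v j : (pis v <= pis u)%N -> Ms v j <= Ms u j.
Proof. by have [B0 [[_ [_ h]] ->]] := HMs => uv; rewrite !mxE; exact: h. Qed.

Lemma Ms_col_mono i j j' : (sgs j <= sgs j')%N -> Ms i j <= Ms i j'.
Proof. by have [B0 [[_ [h _]] ->]] := HMs => uv; rewrite !mxE; exact: h. Qed.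

Lemma rowsum_mono B u v : (pis v <= pis u)%N -> rowsumB Ms B v <= rowsumB Ms B u.
Proof. by move=> uv; apply: ler_sum => j _; exact: Ms_row_mono. Qed.

(** No edge is reversed, so a topological sort exists and the algorithm returns one. *)
Lemma true_order_topsort : is_topsort (edge N zeta Y2 BL) pis.
Proof.
move=> u v; rewrite ltnNge => e; apply/negP => uv; move: e.
case=> [|[B hB]]; last first.
  have [+ _] := Hedge u v (or_intror hB) => /(_ (rowsum_mono _ uv)).
  by rewrite leNgt => /negP.
rewrite thr_fullE//.
have [+ _] := Hedge u v (or_introl erefl) => /(_ (rowsum_mono _ uv)).
by rewrite cardsT card_ord leNgt => /negP.
Qed.

Lemma pih_topsort : is_topsort (edge N zeta Y2 BL) pih.
Proof. by case: Hpih => // -[/(_ pis) h _]; case: h; exact: true_order_topsort. Qed.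

Lemma found_edge (B : {set 'I_m2}) u v : B = [set: 'I_m2]%SET \/ B \in BL ->
  3 * thr_blk m1 m2 N zeta #|B| < rowsumB Ms B v - rowsumB Ms B u -> (pih u < pih v)%N.
Proof.
move=> hB h; apply: pih_topsort; have [_ /(_ h) h'] := Hedge u v hB.
case: hB => [BT|hB]; last by right; exists B.
by left; rewrite thr_fullE//; move: h'; rewrite BT cardsT card_ord.
Qed.

(* If the scores of [u] and [v] differed too much, all rows on the right side of
   rank [i] would be placed strictly on one side of [u] by the topological sort. *)
Lemma sorted_gap (B : {set 'I_m2}) (i : 'I_m1) : B = [set: 'I_m2]%SET \/ B \in BL ->
  `|rowsumB Ms B (pih^-1%g i) - rowsumB Ms B (pis^-1%g i)| <= 3 * thr_blk m1 m2 N zeta #|B|.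
Proof.
move=> hB; set u := pih^-1%g i; set v := pis^-1%g i.
have pu : pih u = i by rewrite permKV.
have pv : pis v = i by rewrite permKV.
rewrite ler_norml; apply/andP; split; rewrite leNgt; apply/negP => h.
  pose A := [set x | (i <= pis x)%N]%SET.
  have sub : (pih @: A \subset [set y : 'I_m1 | (i < y)%N])%SET.
    apply/fintype.subsetP => y /imsetP[x]; rewrite !inE => xi ->; rewrite -pu.
    apply: (found_edge hB); have := @rowsum_mono B x v; rewrite pv => /(_ xi); lra.
  have := subset_leq_card sub; rewrite card_imset; last exact: perm_inj.
  have -> : #|A| = #|[set y : 'I_m1 | (i <= y)%N]%SET|.
    rewrite -(card_imset (mem A) (@perm_inj _ pis)); congr (#|pred_of_set _|).
    apply/setP => y; rewrite inE; apply/imsetP/idP => [[x]|h'].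
      by rewrite inE => h' ->.
    by exists (pis^-1%g y); rewrite ?inE permKV.
  rewrite leqNgt => /negP; apply; apply: proper_card; apply/fintype.properP; split.
    by apply/fintype.subsetP => y; rewrite !inE; exact: ltnW.
  by exists i; rewrite !inE ?ltnn.
pose A := [set x | (pis x <= i)%N]%SET.
have sub : (pih @: A \subset [set y : 'I_m1 | (y < i)%N])%SET.
  apply/fintype.subsetP => y /imsetP[x]; rewrite !inE => xi ->; rewrite -pu.
  apply: (found_edge hB); have := @rowsum_mono B v x; rewrite pv => /(_ xi); lra.
have := subset_leq_card sub; rewrite card_imset; last exact: perm_inj.
have -> : #|A| = #|[set y : 'I_m1 | (y <= i)%N]%SET|.
  rewrite -(card_imset (mem A) (@perm_inj _ pis)); congr (#|pred_of_set _|).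
  apply/setP => y; rewrite inE; apply/imsetP/idP => [[x]|h'].
    by rewrite inE => h' ->.
  by exists (pis^-1%g y); rewrite ?inE permKV.
rewrite leqNgt => /negP; apply; apply: proper_card; apply/fintype.properP; split.
  by apply/fintype.subsetP => y; rewrite !inE; exact: ltnW.
by exists i; rewrite !inE ?ltnn.
Qed.

(** The index [i] is a rank: the row placed there by the sort is compared with the row that belongs
    there. *)
Definition rowgap (i : 'I_m1) (j : 'I_m2) : R :=
  `|Ms (pih^-1%g i) j - Ms (pis^-1%g i) j|.

Lemma rowgap_ge0 i j : 0 <= rowgap i j. Proof. exact: normr_ge0. Qed.

Lemma rowgap_le1 i j : rowgap i j <= 1.
Proof.
rewrite /rowgap; have /andP[a b] := Ms_range (pih^-1%g i) j.
by have /andP[a' b'] := Ms_range (pis^-1%g i) j; rewrite ler_norml; apply/andP; split; lra.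
Qed.

(** Any two rows are ordered entrywise, so their differences have a constant sign and the l1
    distance on a block is the difference of the block sums. *)
Lemma rowgap_sum (B : {set 'I_m2}) i : B = [set: 'I_m2]%SET \/ B \in BL ->
  \sum_(j in B) rowgap i j <= 3 * thr_blk m1 m2 N zeta #|B|.
Proof.
move=> hB; apply: le_trans (sorted_gap i hB).
rewrite /rowsumB -sumrB.
have [h|h] := leqP (pis (pih^-1%g i)) (pis (pis^-1%g i)).
  rewrite -normrN -sumrN; apply: le_trans (ler_norm _); apply: ler_sum => j _.
  by rewrite /rowgap ler0_norm// subr_le0; exact: Ms_row_mono.
apply: le_trans (ler_norm _); apply: ler_sum => j _.
by rewrite /rowgap ger0_norm// subr_ge0; apply: Ms_row_mono; exact: ltnW.
Qed.

Local Notation L := (lg R m1 m2).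
Local Notation x := (m1%:R * L / N).
Local Notation y := (m2%:R * L / N).
Local Notation t := (16 * (zeta + 1)).
Hypothesis x_le1 : x <= 1.

Let m1p : 0 < m1%:R :> R. Proof. by rewrite ltr0n. Qed.
Let m2p : 0 < m2%:R :> R. Proof. by rewrite ltr0n. Qed.
Let x0 : 0 < x. Proof. by rewrite divr_gt0 ?mulr_gt0. Qed.
Let y0 : 0 < y. Proof. by rewrite divr_gt0 ?mulr_gt0. Qed.
Let t1 : 1 <= t. Proof. by have := zeta_gt0; lra. Qed.

Lemma thr_blkE b : thr_blk m1 m2 N zeta b = t * (Num.sqrt (m2%:R * x * b%:R) + m2%:R * x).
Proof.
rewrite /thr_blk natrM; congr (_ * (Num.sqrt _ + _));
  by field; repeat (apply/andP; split); rewrite gt_eqF.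
Qed.

Lemma sqrt_le1 (r : R) : 0 <= r <= 1 -> r <= Num.sqrt r <= 1.
Proof.
move=> /andP[r0 r1].
have s1 : Num.sqrt r <= 1 by rewrite -[X in _ <= X]sqrtr1 ler_wsqrtr.
rewrite s1 andbT -[X in X <= _]sqr_sqrtr// expr2.
by rewrite ler_piMr// sqrtr_ge0.
Qed.

Lemma thr_full_le : thr_blk m1 m2 N zeta m2 <= t * (2 * m2%:R * Num.sqrt x).
Proof.
rewrite thr_blkE; apply: ler_wpM2l; first by apply: le_trans t1.
have -> : Num.sqrt (m2%:R * x * m2%:R) = m2%:R * Num.sqrt x.
  have -> : m2%:R * x * m2%:R = m2%:R ^+ 2 * x by ring.
  by rewrite sqrtrM ?sqr_ge0// sqrtr_sqr ger0_norm ?ler0n.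
have /andP[h _] : x <= Num.sqrt x <= 1 by apply: sqrt_le1; rewrite (ltW x0).
have := ler_wpM2l (ltW m2p) h; lra.
Qed.

Lemma lossR_le : lossR Ms pis sgs pih <= Num.min 1 (6 * t * Num.sqrt x).
Proof.
have t0 : 0 <= t by apply: le_trans t1.
rewrite /lossR; apply: bigmax_le => [|i _].
  by rewrite le_min ler01 /= !mulr_ge0 ?sqrtr_ge0 ?addr_ge0 ?(ltW zeta_gt0).
have e : \sum_(j < m2) (Defs.permM Ms pis^-1 sgs^-1 i j - Defs.permM Ms pih^-1 sgs^-1 i j) ^+ 2
    = \sum_(j < m2) rowgap i j ^+ 2.
  rewrite (reindex_inj (@perm_inj _ sgs)) /=; apply: eq_bigr => j _.
  by rewrite !mxE permK /rowgap real_normK ?num_real// -sqrrN opprB.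
have b1 j : rowgap i j ^+ 2 <= rowgap i j.
  by rewrite expr2 ler_piMr ?rowgap_ge0 ?rowgap_le1.
rewrite le_min; apply/andP; split; rewrite e ler_pdivrMr//.
  rewrite mul1r; apply: (@le_trans _ _ (\sum_(j < m2) 1)).
    by apply: ler_sum => j _; apply: (le_trans (b1 j)); exact: rowgap_le1.
  by rewrite sumr_const card_ord.
apply: (@le_trans _ _ (\sum_(j in [set: 'I_m2]%SET) rowgap i j)).
  by rewrite [X in _ <= X](eq_bigl xpredT); [apply: ler_sum => j _|move=> j; rewrite inE].
apply: (le_trans (rowgap_sum i (or_introl erefl))).
by rewrite cardsT card_ord; have := thr_full_le; lra.
Qed.


Local Notation tau := (tau_bl m1 m2 N zeta).
Local Notation beta := (beta_bl m1 m2 N).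
Local Notation K := (K_bl m1 m2 N zeta).
Local Notation idx := (blidx N zeta Y1).
Hypothesis Hcol : forall j, `|colsum Y1 j - colsum Ms j| <= tau.
Hypothesis y_le1 : y <= 1.

Lemma colsum_range j : 0 <= colsum Ms j <= m1%:R.
Proof.
apply/andP; split; first by apply: sumr_ge0 => i _; case/andP: (Ms_range i j).
rewrite -[X in X%:R]card_ord -sumr_const; apply: ler_sum => i _.
by case/andP: (Ms_range i j).
Qed.

(** The noisy sum of a column in block k lies in [(k - 1) tau, k tau) and is off by at most tau. The
    first block has no lower end and the last no upper end; there the bounds 0 and m1 <= K tau take
    over. *)
Lemma colsum_blidx j : (idx j)%:R * tau - 2 * tau <= colsum Ms j <= (idx j)%:R * tau + tau.
Proof.
have t0 := tau_bl_gt0 m1_gt0 m2_gt0 N_gt0 zeta_gt0 lg_gt0.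
have /andP[c0 c1] := colsum_range j.
have := Hcol j; rewrite ler_norml => /andP[d1 d2].
rewrite blidxE /blidx_of; case: ltP => [h|h].
  by rewrite mul1r; apply/andP; split; lra.
set f := Num.floor _.
have f0 : 0 <= f by rewrite /f floor_ge0 divr_ge0// ?(le_trans (ltW t0))// ltW.
have f1 : f%:~R * tau <= colsum Y1 j.
  by rewrite -ler_pdivlMr//; exact: floor_le_tmp.
have f2 : colsum Y1 j < (f%:~R + 1) * tau.
  by rewrite -ltr_pdivrMr//; have := floorD1_gt (colsum Y1 j / tau); rewrite intrD.
have fE : f%:~R = `|f|%N%:R :> R by rewrite -{1}(gez0_abs f0) -pmulrn.
rewrite fE in f1 f2.
have [hK|hK] := leqP K `|f|%N.+1.
  have kt : m1%:R <= K%:R * tau.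
    rewrite -ler_pdivrMr//; apply: (le_trans (Num.Theory.ceil_ge _)).
    have cg0 : 0 <= Num.ceil (m1%:R / tau).
      by rewrite -(@ler_int R); apply: le_trans (Num.Theory.ceil_ge _); rewrite divr_ge0// ltW.
    by rewrite /K_bl -{1}(gez0_abs cg0) -pmulrn.
  have kf : K%:R * tau <= `|f|%N.+1%:R * tau by rewrite ler_pM2r// ler_nat.
  by move: kf; rewrite -natr1 => kf; apply/andP; split; lra.
by rewrite -natr1; apply/andP; split; lra.
Qed.

(** The blocks partition the columns: since [flatten groups] is the list of small indices, every
    index from 1 to [K] occurs exactly once. *)
Lemma sum_blocks (F : 'I_m2 -> R) :
  \sum_(B <- BL) \sum_(j in B) F j = \sum_j F j.
Proof.
have hu (g : seq nat) : uniq g -> \sum_(j in \bigcup_(k <- g) blk N zeta Y1 k) F j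
     = \sum_(k <- g) \sum_(j in blk N zeta Y1 k) F j.
  move=> ug; rewrite (eq_bigl (fun j => idx j \in g)); last by move=> j; rewrite blk_union.
  rewrite [RHS](eq_bigr (fun k => \sum_j (if idx j == k then F j else 0))); last first.
    by move=> k _; rewrite -big_mkcond; apply: eq_bigl => j; rewrite inE.
  rewrite exchange_big /= big_mkcond /=; apply: eq_bigr => j _.
  rewrite -big_mkcond /=; case: ifP => [h|h].
    rewrite (eq_bigl (pred1 (idx j))); last by move=> k; rewrite /= eq_sym.
    by rewrite -big_filter filter_pred1_uniq// big_seq1.
  by rewrite big1_seq// => k /andP[/eqP <-]; rewrite h.
have [groups [fl [-> _]]] := HBL.
rewrite big_cat /= !big_map big_filter.
set smalls := [seq _ <- _ | _] in fl.
have us : uniq smalls by rewrite filter_uniq// iota_uniq.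
have -> : \sum_(g <- groups) \sum_(j in \bigcup_(k <- g) blk N zeta Y1 k) F j
   = \sum_(k <- smalls) \sum_(j in blk N zeta Y1 k) F j.
  rewrite -fl big_flatten /= big_seq [RHS]big_seq; apply: eq_bigr => g gg; apply: hu.
  move: us; rewrite -fl; elim: (groups) gg => // h gs IH; rewrite inE /= cat_uniq.
  by move=> /orP[/eqP ->|/IH h'] /and3P[? _ ?] //; exact: h'.
rewrite /smalls big_filter.
have -> : \sum_j F j = \sum_(k <- iota 1 K) \sum_(j in blk N zeta Y1 k) F j.
  rewrite -hu ?iota_uniq//; apply: eq_bigl => j; rewrite blk_union mem_iota blidxE add1n ltnS.
  by rewrite blidx_of_bounds.
by rewrite [RHS](bigID (fun k => beta <= #|blk N zeta Y1 k|%:R)) /=.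
Qed.

Local Notation w := (Num.sqrt (Num.sqrt x)).
Local Notation v := (Num.sqrt y).
Local Notation rho := (4 * t * w).

Let w0 : 0 < w. Proof. by rewrite !sqrtr_gt0. Qed.
Let w1 : w <= 1.
Proof.
have /andP[_ h] : x <= Num.sqrt x <= 1 by apply: sqrt_le1; rewrite (ltW x0).
by have /andP[_] : Num.sqrt x <= w <= 1 by apply: sqrt_le1; rewrite sqrtr_ge0.
Qed.
Let w2 : Num.sqrt x = w ^+ 2. Proof. by rewrite sqr_sqrtr// sqrtr_ge0. Qed.
Let w4 : x = w ^+ 4. Proof. by rewrite (exprM _ 2 2) -w2 sqr_sqrtr// ltW. Qed.
Let v0 : 0 < v. Proof. by rewrite sqrtr_gt0. Qed.
Let v1 : v <= 1.
Proof. by have /andP[_] : y <= v <= 1 by apply: sqrt_le1; rewrite (ltW y0). Qed.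
Let v2 : y = v ^+ 2. Proof. by rewrite sqr_sqrtr// ltW. Qed.

Lemma beta_blE : beta = m2%:R * w ^+ 2.
Proof. by rewrite /beta_bl -w2; congr (_ * Num.sqrt _); ring. Qed.

Lemma tau_blE : tau <= 2 * t * m1%:R * v.
Proof.
rewrite /tau_bl.
have -> : (m1 ^ 2 * m2)%:R / N * L = m1%:R ^+ 2 * y by rewrite natrM natrX; ring.
have -> : (m1 * m2)%:R / N * L = m1%:R * y by rewrite natrM; ring.
rewrite sqrtrM ?sqr_ge0// sqrtr_sqr ger0_norm ?ler0n//.
have /andP[h _] : y <= v <= 1 by apply: sqrt_le1; rewrite (ltW y0).
have h2 := ler_wpM2l (ltW m1p) h.
have : t * (m1%:R * v + m1%:R * y) <= t * (m1%:R * v + m1%:R * v).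
  by rewrite ler_wpM2l ?lerD2l// (le_trans _ t1).
lra.
Qed.

(** This is what [beta] is made for: from a size of order m2 sqrt(x) on, both terms of the threshold
    are at most a multiple of x^(1/4) times the size, so [rho] is a threshold per column. *)
Lemma thr_blk_large b : beta / 2 <= b%:R -> thr_blk m1 m2 N zeta b <= rho * b%:R.
Proof.
rewrite beta_blE => hb; rewrite thr_blkE.
have W4 := w4; have W0 := w0; have W1 := w1.
move: hb W4 W0 W1; set W := w => hb W4 W0 W1; rewrite W4.
have t0 : 0 <= t by apply: le_trans t1.
have b0 : 0 <= b%:R :> R by exact: ler0n.
have w2p : 0 <= W ^+ 2 by exact: sqr_ge0.
have h1 : m2%:R * W ^+ 4 <= 2 * b%:R * W.
  have h : m2%:R * W ^+ 2 * W ^+ 2 <= 2 * b%:R * W ^+ 2 by rewrite ler_wpM2r//; lra.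
  have h' : b%:R * W ^+ 2 <= b%:R * W by rewrite ler_wpM2l// expr2 ler_piMl// ltW.
  by rewrite (exprD _ 2 2) mulrA; lra.
have h2 : Num.sqrt (m2%:R * W ^+ 4 * b%:R) <= 2 * b%:R * W.
  have p2 : 0 <= 2 * b%:R * W by rewrite !mulr_ge0// ltW.
  rewrite -[X in _ <= X]ger0_norm// -sqrtr_sqr ler_wsqrtr//.
  have -> : (2 * b%:R * W) ^+ 2 = (4 * b%:R * W ^+ 2) * b%:R by ring.
  rewrite ler_wpM2r// (exprD _ 2 2) mulrA ler_wpM2r//.
  have : m2%:R * W ^+ 2 <= 2 * b%:R by lra.
  lra.
have := ler_wpM2l t0 (lerD h2 h1); lra.
Qed.

Lemma thr_blk_small b : b%:R <= beta / 2 -> thr_blk m1 m2 N zeta b <= 2 * t * m2%:R * w ^+ 3.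
Proof.
rewrite beta_blE => hb; rewrite thr_blkE.
have W4 := w4; have W0 := w0; have W1 := w1.
move: hb W4 W0 W1; set W := w => hb W4 W0 W1; rewrite W4.
have t0 : 0 <= t by apply: le_trans t1.
have m20 := ltW m2p.
have w3p : 0 <= W ^+ 3 by rewrite exprn_ge0// ltW.
have h1 : m2%:R * W ^+ 4 <= m2%:R * W ^+ 3.
  by rewrite ler_wpM2l// exprS ler_piMl.
have h2 : Num.sqrt (m2%:R * W ^+ 4 * b%:R) <= m2%:R * W ^+ 3.
  have p2 : 0 <= m2%:R * W ^+ 3 by rewrite mulr_ge0.
  rewrite -[X in _ <= X]ger0_norm// -sqrtr_sqr ler_wsqrtr//.
  have -> : (m2%:R * W ^+ 3) ^+ 2 = m2%:R * W ^+ 4 * (m2%:R * W ^+ 2) by ring.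
  apply: ler_wpM2l; first by apply: mulr_ge0 => //; rewrite exprn_ge0// ltW.
  have : 0 <= m2%:R * W ^+ 2 by rewrite mulr_ge0// sqr_ge0.
  lra.
have := ler_wpM2l t0 (lerD h2 h1); lra.
Qed.

(* [sum a^2 <= (max a) (sum a)], and the maximum exceeds the mean by at most the variation. *)
Lemma block_gap (B : {set 'I_m2}) (D : R) : B \in BL -> beta / 2 <= #|B|%:R ->
  (forall j j', j \in B -> j' \in B -> colsum Ms j' - colsum Ms j <= D) ->
  \sum_i \sum_(j in B) rowgap i j ^+ 2
  <= 3 * rho * (\sum_i \sum_(j in B) rowgap i j) + 6 * rho * #|B|%:R * D.
Proof.
move=> BBL hb hD.
have b0 : 0 < #|B|%:R :> R.
  apply: lt_le_trans hb; rewrite beta_blE divr_gt0// mulr_gt0// exprn_gt0//.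
have /card_gt0P[j0 j0B] : (0 < #|B|)%N by rewrite -(@ltr0n R).
have [jm jmB min1] := arg_minnP (fun j => val (sgs j)) j0B.
have [jM jMB max1] := arg_maxnP (fun j => val (sgs j)) j0B.
have tr := thr_blk_large hb.
have rho0 : 0 <= rho.
  by apply: mulr_ge0; [apply: mulr_ge0 => //; exact: le_trans t1|exact: sqrtr_ge0].
have th0 : 0 <= thr_blk m1 m2 N zeta #|B| by exact: thr_blk_ge0.
(* [V i] adds the oscillations over the block of the two rows compared, and bounds that of
   [rowgap i]. Summed over the ranks, each of the two orders runs through all rows, which gives
   twice a difference of column sums. *)
pose V i := (Ms (pih^-1%g i) jM - Ms (pih^-1%g i) jm)
          + (Ms (pis^-1%g i) jM - Ms (pis^-1%g i) jm).
have V0 i : 0 <= V i.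
  by rewrite addr_ge0// subr_ge0; apply: Ms_col_mono; exact: min1.
have sumV : \sum_i V i <= 2 * D.
  have s1 (p : 'S_m1) : \sum_i (Ms (p i) jM - Ms (p i) jm) = colsum Ms jM - colsum Ms jm.
    by rewrite sumrB /colsum; congr (_ - _); rewrite [RHS](reindex_perm p).
  by rewrite big_split /= !s1; have := hD _ _ jmB jMB; lra.
have var i j j' : j \in B -> j' \in B -> rowgap i j <= rowgap i j' + V i.
  move=> jB j'B; rewrite /rowgap /V.
  have Mb (r : 'I_m1) (l : 'I_m2) : l \in B -> Ms r jm <= Ms r l <= Ms r jM.
    by move=> lB; apply/andP; split; apply: Ms_col_mono; [exact: min1|exact: max1].
  have /andP[a1 a2] := Mb (pih^-1%g i) _ jB; have /andP[a3 a4] := Mb (pih^-1%g i) _ j'B.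
  have /andP[a5 a6] := Mb (pis^-1%g i) _ jB; have /andP[a7 a8] := Mb (pis^-1%g i) _ j'B.
  set p := Ms (pih^-1%g i) j in a1 a2 *; set p' := Ms (pih^-1%g i) j' in a3 a4 *.
  set q := Ms (pis^-1%g i) j in a5 a6 *; set q' := Ms (pis^-1%g i) j' in a7 a8 *.
  have -> : p - q = (p' - q') + ((p - p') - (q - q')) by ring.
  apply: (le_trans (ler_normD _ _)); rewrite lerD2l.
  by rewrite ler_norml; apply/andP; split; lra.
have row i : \sum_(j in B) rowgap i j ^+ 2
    <= 3 * rho * \sum_(j in B) rowgap i j + 3 * rho * #|B|%:R * V i.
  set A := \sum_(j in B) rowgap i j.
  have A0 : 0 <= A by apply: sumr_ge0 => j _; exact: rowgap_ge0.
  have A1 : A <= 3 * (rho * #|B|%:R).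
    by apply: (le_trans (rowgap_sum i (or_intror BBL))); lra.
  have amax j : j \in B -> rowgap i j <= A / #|B|%:R + V i.
    move=> jB; rewrite -lerBlDr ler_pdivlMr//.
    have -> : (rowgap i j - V i) * #|B|%:R = \sum_(j' in B) (rowgap i j - V i).
      by rewrite sumr_const mulr_natr.
    by apply: ler_sum => j' j'B; have := var i _ _ jB j'B; lra.
  apply: (@le_trans _ _ (\sum_(j in B) (A / #|B|%:R + V i) * rowgap i j)).
    apply: ler_sum => j jB; rewrite expr2 ler_wpM2r ?rowgap_ge0//; exact: amax.
  rewrite -mulr_sumr -/A mulrDl; apply: lerD.
    by rewrite ler_wpM2r// ler_pdivrMr//; lra.
  have := ler_wpM2r (V0 i) A1; lra.
apply: (@le_trans _ _ (\sum_i (3 * rho * \sum_(j in B) rowgap i j + 3 * rho * #|B|%:R * V i))).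
  by apply: ler_sum => i _; exact: row.
rewrite big_split /= -!mulr_sumr lerD2l.
have c0 : 0 <= 3 * rho * #|B|%:R.
  by apply: mulr_ge0; [exact: mulr_ge0|exact: ltW].
have := ler_wpM2l c0 sumV; lra.
Qed.


(** The index intervals of successive groups do not overlap, so their lengths add up to at most the
    whole range, although a single group may skip over many large blocks. *)
Lemma groups_span (gs : seq (seq nat)) (a k : nat) : (a <= k)%N ->
  pairwise ltn (flatten gs) -> (forall i, i \in flatten gs -> (a <= i <= k)%N) ->
  (\sum_(g <- gs) (last 0%N g - head 0%N g) <= k - a)%N.
Proof.
elim: gs a => [|g gs IH] a ak; first by rewrite big_nil.
rewrite big_cons [flatten _]/= pairwise_cat => /and3P[al _ pw] rng.
have [g0|gn] := eqVneq g [::].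
  by move: rng; rewrite g0 add0n; exact: IH.
have hl : last 0%N g \in g by case: (g) gn => // h t _; exact: mem_last.
have hh : head 0%N g \in g by case: (g) gn => // h t _; exact: mem_head.
have /andP[l1 l2] : (a <= last 0%N g <= k)%N by apply: rng; rewrite mem_cat hl.
have /andP[h1 h2] : (a <= head 0%N g <= k)%N by apply: rng; rewrite mem_cat hh.
have rng' i : i \in flatten gs -> (last 0%N g <= i <= k)%N.
  move=> hi; have /andP[_ ->] : (a <= i <= k)%N by apply: rng; rewrite mem_cat hi orbT.
  by rewrite andbT; apply: ltnW; exact: (allrelP al).
apply: (@leq_trans ((last 0%N g - a) + (k - last 0%N g))).
  by apply: leq_add; [exact: leq_sub2l|exact: IH].
by rewrite addnC addnBA// subnK.
Qed.

Lemma pairwise_head_last (g : seq nat) k : pairwise ltn g -> k \in g ->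
  (head 0 g <= k <= last 0 g)%N.
Proof.
elim: g k => // h t IH k /= /andP[al pw]; rewrite inE => /orP[/eqP ->|kt].
  rewrite leqnn /=; have := mem_last h t; rewrite inE => /orP[/eqP -> //|ht].
  by apply: ltnW; exact: (allP al).
apply/andP; split; first by apply: ltnW; exact: (allP al).
by have := IH k pw kt; case: (t) kt => //= h' t' _ /andP[].
Qed.

Lemma row_bias : \sum_i \sum_j rowgap i j ^+ 2
  <= 20 * 20 * t ^+ 2 * m1%:R * m2%:R * (w ^+ 3 + w * v).
Proof.
have tau0 := tau_bl_gt0 m1_gt0 m2_gt0 N_gt0 zeta_gt0 lg_gt0.
have t0 : 0 <= t by exact: le_trans t1.
have rho0 : 0 <= rho by apply: mulr_ge0; [exact: mulr_ge0|exact: sqrtr_ge0].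
have beta0 : 0 < beta by rewrite beta_blE mulr_gt0// exprn_gt0.
have [groups [fl [eBL cases]]] := HBL.
set smalls := [seq _ <- _ | _] in fl cases.
have srt : sorted ltn smalls by apply: sorted_filter; [exact: ltn_trans|exact: iota_ltn_sorted].
have Kt : K%:R * tau <= m1%:R + tau.
  have : K%:R <= m1%:R / tau + 1.
    have cg0 : 0 <= Num.ceil (m1%:R / tau).
      by rewrite -(@ler_int R); apply: le_trans (Num.Theory.ceil_ge _); rewrite divr_ge0// ltW.
    have := ceilB1_lt (m1%:R / tau); rewrite intrD /K_bl => h.
    have -> : `|Num.ceil (m1%:R / tau)|%N%:R = (Num.ceil (m1%:R / tau))%:~R :> R.
      by rewrite -{2}(gez0_abs cg0) -pmulrn.
    by move: h; rewrite mulrN1z; lra.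
  by move/(ler_wpM2r (ltW tau0)); rewrite mulrDl mul1r divfK// gt_eqF.
pose Q (B : {set 'I_m2}) := \sum_i \sum_(j in B) rowgap i j ^+ 2.
pose G (B : {set 'I_m2}) := \sum_i \sum_(j in B) rowgap i j.
have G0 B : 0 <= G B by apply: sumr_ge0 => i _; apply: sumr_ge0 => j _; exact: rowgap_ge0.
have sumQ : \sum_i \sum_j rowgap i j ^+ 2 = \sum_(B <- BL) Q B.
  rewrite /Q [RHS]exchange_big /=; apply: eq_bigr => i _.
  by rewrite -(sum_blocks (fun j => rowgap i j ^+ 2)).
have sumG : \sum_(B <- BL) G B <= m1%:R * (3 * thr_blk m1 m2 N zeta m2).
  have cst (c : R) : m1%:R * c = \sum_(i < m1) c by rewrite sumr_const card_ord mulr_natl.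
  rewrite /G exchange_big /= cst; apply: ler_sum => i _; rewrite (sum_blocks (rowgap i)).
  have := @rowgap_sum [set: 'I_m2]%SET i (or_introl erefl).
  by rewrite cardsT card_ord; apply: le_trans; rewrite [X in _ <= X](eq_bigl xpredT)// => j; rewrite inE.
have sumB : \sum_(B <- BL) #|B|%:R = m2%:R :> R.
  have -> : m2%:R = \sum_(j < m2) (1 : R) by rewrite sumr_const card_ord.
  by rewrite -(sum_blocks (fun=> 1)); apply: eq_bigr => B _; rewrite sumr_const.
have colD k1 k2 j j' : (k1 <= idx j)%N -> (idx j' <= k2)%N ->
   colsum Ms j' - colsum Ms j <= (k2 - k1)%N%:R * tau + 3 * tau.
  move=> a b; have /andP[c1 _] := colsum_blidx j; have /andP[_ c2] := colsum_blidx j'.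
  have h1 : k1%:R * tau <= (idx j)%:R * tau by rewrite ler_pM2r// ler_nat.
  have h2 : (idx j')%:R * tau <= k2%:R * tau by rewrite ler_pM2r// ler_nat.
  have h3 : k2%:R * tau <= ((k2 - k1)%N%:R + k1%:R) * tau.
    by rewrite ler_pM2r// -natrD ler_nat addnC -leq_subLR.
  by move: h3; rewrite mulrDl; lra.
have large k : k \in [seq k <- iota 1 K | beta <= #|blk N zeta Y1 k|%:R] ->
   Q (blk N zeta Y1 k) <= 3 * rho * G (blk N zeta Y1 k) + 6 * rho * #|blk N zeta Y1 k|%:R * (3 * tau).
  move=> hk; have hBL : blk N zeta Y1 k \in BL.
    by rewrite eBL mem_cat map_f.
  move: hk; rewrite mem_filter => /andP[hk _].
  apply: block_gap => //; first by apply: le_trans hk; lra.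
  move=> j j'; rewrite !inE => /eqP e1 /eqP e2.
  by have := @colD k k j j'; rewrite e1 e2 subnn mul0r add0r; exact.
rewrite sumQ.
(* The four terms: the mean part of [block_gap], the oscillation 3 tau present in every block, the
   further oscillation of merged groups, and the single aggregate when all small blocks together
   stay below beta / 2. *)
suff main : \sum_(B <- BL) Q B <= 3 * rho * (m1%:R * (3 * thr_blk m1 m2 N zeta m2))
   + 6 * rho * m2%:R * (3 * tau) + 12 * rho * beta * (m1%:R + tau)
   + m1%:R * (3 * (2 * t * m2%:R * w ^+ 3)).
  apply: (le_trans main).
  have T2 := thr_full_le; rewrite w2 in T2.
  by rewrite beta_blE; apply: bias_arith => //; exact: tau_blE.
pose H B := 3 * rho * G B + 6 * rho * #|B|%:R * (3 * tau).
have H0 B : 0 <= H B.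
  have h3 : 0 <= 3 * rho by exact: mulr_ge0.
  have h6 : 0 <= 6 * rho by exact: mulr_ge0.
  apply: addr_ge0; first by apply: mulr_ge0.
  by apply: mulr_ge0; [apply: mulr_ge0 => //; exact: ler0n|apply: mulr_ge0 => //; exact: ltW].
have sumH : \sum_(B <- BL) H B <= 3 * rho * (m1%:R * (3 * thr_blk m1 m2 N zeta m2))
   + 6 * rho * m2%:R * (3 * tau).
  rewrite /H big_split /= -mulr_sumr -!mulr_suml -mulr_sumr sumB.
  by apply: lerD => //; apply: ler_wpM2l => //; exact: mulr_ge0.
have pw : pairwise ltn (flatten groups) by rewrite fl -(sorted_pairwise ltn_trans).
have eQ : \sum_(B <- BL) Q B =
   \sum_(k <- [seq k <- iota 1 K | beta <= #|blk N zeta Y1 k|%:R]) Q (blk N zeta Y1 k)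
   + \sum_(g <- groups) Q (\bigcup_(k <- g) blk N zeta Y1 k).
  by rewrite eBL big_cat /= !big_map.
have eH : \sum_(B <- BL) H B =
   \sum_(k <- [seq k <- iota 1 K | beta <= #|blk N zeta Y1 k|%:R]) H (blk N zeta Y1 k)
   + \sum_(g <- groups) H (\bigcup_(k <- g) blk N zeta Y1 k).
  by rewrite eBL big_cat /= !big_map.
have lQ : \sum_(k <- [seq k <- iota 1 K | beta <= #|blk N zeta Y1 k|%:R]) Q (blk N zeta Y1 k)
   <= \sum_(k <- [seq k <- iota 1 K | beta <= #|blk N zeta Y1 k|%:R]) H (blk N zeta Y1 k).
  by rewrite big_seq [X in _ <= X]big_seq; apply: ler_sum => k; exact: large.
have w30 : 0 <= m1%:R * (3 * (2 * t * m2%:R * w ^+ 3)).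
  have h3 : 0 <= w ^+ 3 by rewrite exprn_ge0// ltW.
  have h2 : 0 <= 2 * t by exact: mulr_ge0.
  apply: mulr_ge0; first exact: ler0n.
  apply: mulr_ge0 => //; apply: mulr_ge0 => //; apply: mulr_ge0 => //; exact: ler0n.
have b120 : 0 <= 12 * rho * beta * (m1%:R + tau).
  apply: mulr_ge0; last by apply: addr_ge0; [exact: ler0n|exact: ltW].
  by apply: mulr_ge0; [exact: mulr_ge0|exact: ltW].
case: cases => [[us gs]|[_ sz]].
  have UBL : \bigcup_(k <- smalls) blk N zeta Y1 k \in BL.
    by rewrite eBL mem_cat gs /= inE eqxx orbT.
  have QU : Q (\bigcup_(k <- smalls) blk N zeta Y1 k) <= m1%:R * (3 * (2 * t * m2%:R * w ^+ 3)).
    have cst (c : R) : m1%:R * c = \sum_(i < m1) c by rewrite sumr_const card_ord mulr_natl.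
    rewrite cst; apply: ler_sum => i _.
    apply: (@le_trans _ _ (\sum_(j in \bigcup_(k <- smalls) blk N zeta Y1 k) rowgap i j)).
      by apply: ler_sum => j _; rewrite expr2 ler_piMr ?rowgap_ge0 ?rowgap_le1.
    apply: (le_trans (rowgap_sum i (or_intror UBL))).
    by rewrite ler_wpM2l//; apply: thr_blk_small; exact: ltW.
  have gH : 0 <= \sum_(g <- groups) H (\bigcup_(k <- g) blk N zeta Y1 k) by exact: sumr_ge0.
  move: eQ; rewrite {1}gs big_seq1 => eQ; lra.
(* A merged group has at most 2 beta columns, so its span costs at most 12 rho beta tau per index;
   by [groups_span] the spans total at most [K]. *)
have gQ : \sum_(g <- groups) Q (\bigcup_(k <- g) blk N zeta Y1 k)
   <= \sum_(g <- groups) H (\bigcup_(k <- g) blk N zeta Y1 k)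
      + 12 * rho * beta * (tau * (\sum_(g <- groups) (last 0%N g - head 0%N g))%:R).
  rewrite natr_sum mulr_sumr mulr_sumr -big_split /= big_seq [X in _ <= X]big_seq.
  apply: ler_sum => g gg; set U := \bigcup_(k <- g) _.
  have /andP[s1 s2] := sz g gg.
  have UBL : U \in BL by rewrite eBL mem_cat map_f ?orbT.
  have pg : pairwise ltn g.
    move: pw; elim: (groups) gg => // h gs IH; rewrite inE /= pairwise_cat.
    by move=> /orP[/eqP ->|/IH h'] /and3P[_ ? ?] //; exact: h'.
  have hU := @block_gap U ((last 0%N g - head 0%N g)%N%:R * tau + 3 * tau) UBL s1.
  apply: (le_trans (hU _)).
    move=> j j'; rewrite !blk_union => /(pairwise_head_last pg)/andP[a _].
    by move=> /(pairwise_head_last pg)/andP[_ b]; exact: colD.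
  rewrite /H -/(G U).
  have z0 : 0 <= 6 * rho * ((last 0%N g - head 0%N g)%N%:R * tau).
    by apply: mulr_ge0; [exact: mulr_ge0|apply: mulr_ge0; [exact: ler0n|exact: ltW]].
  have := ler_wpM2l z0 s2; lra.
have span : tau * (\sum_(g <- groups) (last 0%N g - head 0%N g))%:R <= m1%:R + tau.
  apply: le_trans Kt; rewrite mulrC ler_pM2r// ler_nat.
  have := @groups_span groups 0 K (leq0n _) pw; rewrite subn0; apply => i.
  by rewrite fl mem_filter mem_iota => /andP[_ /andP[_]]; rewrite add1n ltnS.
have c120 : 0 <= 12 * rho * beta by apply: mulr_ge0; [exact: mulr_ge0|exact: ltW].
have := ler_wpM2l c120 span.
lra.
Qed.

End Sorting.

(** * Chaining over rectangle partitions *)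

Section ExtremePoints.
Context {R : realType}.

(* A linear form on [{0 <= a <= eta, sum a <= s eta}] is maximal at a vertex, where [a] is
   [eta] on at most [s] points. *)
Lemma vertex_bound (T : finType) (C : pred T) (a wt : T -> R) (eta : R) (s : nat) :
  0 < eta -> (forall c, C c -> 0 <= a c <= eta) -> \sum_(c | C c) a c <= s%:R * eta ->
  exists S : seq T, [/\ uniq S, {subset S <= C}, (size S <= s)%N &
    \sum_(c | C c) a c * wt c <= eta * \sum_(c <- S) wt c].
Proof.
move=> eta0 aC sumC.
pose r c c' := wt c' <= wt c.
pose l := sort r [seq c <- enum T | C c && (0 < wt c)].
have ml c : (c \in l) = C c && (0 < wt c) by rewrite mem_sort mem_filter mem_enum andbT.
have ul : uniq l by rewrite sort_uniq filter_uniq// enum_uniq.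
have r_tot : total r by move=> c c'; exact: le_total.
have r_tr : transitive r by move=> c1 c2 c3 h1 h2; exact: le_trans h2 h1.
have pl : pairwise r l by rewrite -sorted_pairwise//; exact: sort_sorted.
have eqs (f : T -> R) : \sum_(c | C c && (0 < wt c)) f c = \sum_(c <- l) f c.
  rewrite /l (perm_big _ (permEl (perm_sort _ _))) /= big_filter.
  by rewrite big_enum_cond.
have step1 : \sum_(c | C c) a c * wt c <= \sum_(c <- l) a c * wt c.
  rewrite -eqs (bigID (fun c => 0 < wt c)) /= gerDl sumr_le0// => c /andP[Cc].
  rewrite -leNgt => w0; have /andP[h _] := aC c Cc; exact: mulr_ge0_le0.
pose t := take s l; pose dl := drop s l.
have ltd : l = t ++ dl by rewrite cat_take_drop.
exists t; split.
- exact: take_uniq.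
- by move=> c /mem_take; rewrite ml => /andP[].
- by rewrite size_take; case: ltnP.
apply: (le_trans step1).
have aw c : c \in l -> a c * wt c <= eta * wt c.
  by rewrite ml => /andP[/aC /andP[_ h] w0]; rewrite ler_pM2r.
have [d0|[c0 [d1 ed]]] : dl = [::] \/ exists c0 d1, dl = c0 :: d1.
- by case: (dl) => [|c0 d1]; [left|right; exists c0, d1].
- rewrite mulr_sumr ltd d0 cats0 big_seq [X in _ <= X]big_seq.
  by apply: ler_sum => c ct; apply: aw; rewrite ltd mem_cat ct.
pose th := wt c0.
have c0l : c0 \in l by rewrite ltd ed mem_cat mem_head orbT.
have th0 : 0 <= th by move: c0l; rewrite ml => /andP[_ /ltW].
move: pl; rewrite ltd ed pairwise_cat => /and3P[/allrelP al _ /=/andP[/allP ad _]].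
have szt : size t = s.
  rewrite size_take; case: ltnP => // h; move: ed.
  by rewrite /dl drop_oversize.
rewrite big_cat /= mulr_sumr -lerBrDl -sumrB.
have dth : \sum_(c <- c0 :: d1) a c * wt c <= th * \sum_(c <- c0 :: d1) a c.
  rewrite mulr_sumr big_seq [X in _ <= X]big_seq; apply: ler_sum => c cd.
  have /andP[a0 _] : 0 <= a c <= eta.
    have : c \in l by rewrite ltd ed mem_cat cd orbT.
    by rewrite ml => /andP[/aC].
  rewrite mulrC ler_wpM2r//; move: cd; rewrite inE => /orP[/eqP -> //|/ad]; exact.
apply: (le_trans dth).
have tth : th * \sum_(c <- t) (eta - a c) <= \sum_(c <- t) (eta * wt c - a c * wt c).
  rewrite mulr_sumr big_seq [X in _ <= X]big_seq; apply: ler_sum => c ct.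
  rewrite -mulrBl mulrC ler_wpM2l//; last by apply: al => //; rewrite mem_head.
  rewrite subr_ge0; have : c \in l by rewrite ltd mem_cat ct.
  by rewrite ml => /andP[/aC /andP[]].
apply: le_trans tth; apply: ler_wpM2l => //.
rewrite sumrB big_const_seq count_predT iter_addr_0 szt lerBrDl -big_cat /= -ed -ltd -eqs.
rewrite -mulr_natl; apply: le_trans sumC.
rewrite [X in _ <= X](bigID (fun c => 0 < wt c)) /= lerDl sumr_ge0// => c /andP[/aC /andP[]].
by [].
Qed.

(** The cross terms of [s k] with all earlier terms are at most 2 [s k] times the sum of the earlier
    truncation levels, which geometric growth bounds by a multiple of [eta k]. An l2 norm is thus
    controlled by l1 norms of truncated increments. *)
Lemma sqr_sum_geometric (s eta : nat -> R) K :
  (forall k, (k < K)%N -> 0 <= s k <= eta k) ->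
  (forall k, (k < K)%N -> \sum_(i < k.+1) eta i <= 3 * eta k) ->
  (\sum_(k < K) s k) ^+ 2 <= 6 * \sum_(k < K) eta k * s k.
Proof.
elim: K => [|K IH] hs he; first by rewrite !big_ord0 expr0n mulr0.
rewrite !big_ord_recr /= mulrDr.
have := IH (fun k hk => hs k (ltnW hk)) (fun k hk => he k (ltnW hk)).
set Sm := \sum_(k < K) s k; set Q := \sum_(k < K) _ * _ => h.
have /andP[s0 s1] := hs K (ltnSn _).
have := he K (ltnSn _); rewrite big_ord_recr /= => he'.
have Sle : Sm <= \sum_(i < K) eta i.
  by apply: ler_sum => i _; have /andP[] := hs i (ltnW (ltn_ord i)).
have h2 : s K * (2 * Sm + s K) <= s K * (6 * eta K) by apply: ler_wpM2l => //; lra.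
rewrite sqrrD; lra.
Qed.

(** Rounding in the direction of the sign of [wt] never decreases the linear form, so only the norm
    of the rounded function has to be compared with the original. *)
Lemma round_towards (Q : nat) (x wt : R) : (0 < Q)%N -> `|x| <= 1 ->
  exists v : 'I_(Q.*2.+1), let y := ((v : nat)%:R - Q%:R) / Q%:R in
    `|y - x| <= Q%:R^-1 /\ 0 <= (y - x) * wt.
Proof.
move=> Q0; rewrite ler_norml => /andP[x1 x2].
have q0 : 0 < Q%:R :> R by rewrite ltr0n.
have qn : Q%:R != 0 :> R by rewrite gt_eqF.
set X := Q%:R * (x + 1).
have X0 : 0 <= X by apply: mulr_ge0; [exact: ltW|lra].
have X2 : X <= (Q.*2)%:R.
  rewrite -mul2n natrM mulrC /X; apply: ler_wpM2l; [exact: ltW|lra].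
have yE (v : nat) : (v%:R - Q%:R) / Q%:R - x = (v%:R - X) / Q%:R.
  by rewrite /X; field.
have bnd (v : nat) : `|v%:R - X| <= 1 -> `|(v%:R - Q%:R) / Q%:R - x| <= Q%:R^-1.
  move=> h; rewrite yE normrM normfV (ger0_norm (ltW q0)) -[X in _ <= X]mul1r.
  by rewrite ler_pM2r ?invr_gt0.
have [f1 f2] : ((Num.truncn X)%:R <= X) /\ (X < (Num.truncn X).+1%:R).
  by have /andP[] := truncn_itv X0.
set f := Num.truncn X in f1 f2.
have fQ : (f <= Q.*2)%N by rewrite -(ler_nat R); exact: le_trans X2.
rewrite -natr1 in f2.
have [w0|w0] := leP wt 0.
  exists (Ordinal (fQ : (f < Q.*2.+1)%N)) => /=; split.
    by apply: bnd; rewrite ler_norml; apply/andP; split; lra.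
  rewrite yE; apply: mulr_le0 => //; apply: mulr_le0_ge0; last by rewrite invr_ge0 ltW.
  lra.
have [fX|fX] := eqVneq (f%:R) X.
  exists (Ordinal (fQ : (f < Q.*2.+1)%N)) => /=; split.
    by apply: bnd; rewrite fX subrr normr0.
  by rewrite yE fX subrr mul0r mul0r.
have fQ1 : (f.+1 < Q.*2.+1)%N.
  by rewrite ltnS -(ltr_nat R); apply: lt_le_trans X2; rewrite lt_neqAle fX.
exists (Ordinal fQ1) => /=; split.
  by apply: bnd; rewrite -natr1 ler_norml; apply/andP; split; lra.
rewrite yE -natr1; apply: mulr_ge0; last exact: ltW.
by apply: divr_ge0; [lra|exact: ltW].
Qed.

End ExtremePoints.

(** * Chaining along abstract nested partitions *)

Section Chaining.
Context {R : realType} (n1 n2 Q : nat).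
Hypothesis Q_gt0 : (0 < Q)%N.
Local Notation E := ('I_n1 * 'I_n2)%type.

Definition rect := ('I_n1.+1 * 'I_n1.+1 * 'I_n2.+1 * 'I_n2.+1)%type.

Definition inrect (r : rect) (e : E) : bool :=
  (r.1.1.1 <= e.1 < r.1.1.2)%N && (r.1.2 <= e.2 < r.2)%N.

(* The label [v] stands for the value [(v - Q) / Q] in [[-1, 1]]. *)
Definition evalr (rs : seq (rect * 'I_(Q.*2.+1))) (e : E) : R :=
  \sum_(p <- rs) ((p.2 : nat)%:R - Q%:R) / Q%:R * (inrect p.1 e)%:R.

Definition fip (W A : E -> R) : R := \sum_e W e * A e.
Definition fnorm2 (A : E -> R) : R := \sum_e A e ^+ 2.

(** The outcome of a union bound over step functions: a variance part proportional to the norm and a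
    Bernstein part [a2]. The supremum bound 2 leaves room for rounding a function with values in
    [-1, 1]. *)
Definition net_good (m : nat) (a1 a2 : R) (W : E -> R) : Prop :=
  forall rs, (size rs <= m)%N -> (forall e, `|evalr rs e| <= 2) ->
    fip W (evalr rs) <= a1 * Num.sqrt (fnorm2 (evalr rs)) + a2.

(** [b k e] is the base point of the level-k cell of [e], and the cells of level [K] are single
    entries. Between levels k and k + 1, [eta k] truncates the increments, [Y k] bounds their sum
    over the cells, [alpha k] bounds the size of a finer cell, [s k] counts the cells of a vertex,
    and [g k] the large increments of both functions together. *)
Context (K : nat) (b : nat -> E -> E) (alpha Y eta : nat -> R) (s g : nat -> nat).
Hypothesis bK : forall e, b K e = e.
Hypothesis b_nest : forall k e, (k < K)%N -> b k (b k.+1 e) = b k e.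
Hypothesis b_idem : forall k e, b k (b k e) = b k e.
Hypothesis b_rect : forall k c, exists r, forall e, inrect r e = (b k e == c).
Hypothesis cell_size : forall k c, (k < K)%N -> #|[set e | b k.+1 e == c]%SET|%:R <= alpha k.
Hypothesis alpha_ge0 : forall k, (k < K)%N -> 0 <= alpha k.
Hypothesis eta_gt0 : forall k, (k < K)%N -> 0 < eta k.
Hypothesis eta_geom : forall k, (k < K)%N -> \sum_(i < k.+1) eta i <= 3 * eta k.
Hypothesis Y_le : forall k, (k < K)%N -> Y k <= (s k)%:R * eta k.
Hypothesis g_ge : forall k, (k < K)%N -> eta k < 1 -> 2 * Y k <= (g k)%:R * eta k.

Definition chained (A : E -> R) : Prop :=
  [/\ forall e, 0 <= A e <= 1,
      forall k e, (k < K)%N -> A (b k e) <= A (b k.+1 e) &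
      forall k, (k < K)%N -> \sum_(c | b k.+1 c == c) (A c - A (b k c)) <= Y k].

Variables (A B : E -> R).
Hypothesis HA : chained A.
Hypothesis HB : chained B.

Let incr (F : E -> R) k e : R := F (b k.+1 e) - F (b k e).
(** One set of large cells common to both functions, so that [A - B] is a combination over a single
    list of cells. *)
Let big k e : bool := (eta k < incr A k e) || (eta k < incr B k e).

Lemma incr_base (F : E -> R) k e : (k < K)%N -> incr F k (b k.+1 e) = incr F k e.
Proof. by move=> kK; rewrite /incr b_idem b_nest. Qed.

Lemma big_base k e : (k < K)%N -> big k (b k.+1 e) = big k e.
Proof. by move=> kK; rewrite /big !incr_base. Qed.

Definition smallp (F : E -> R) k e : R := if big k e then 0 else incr F k e.
Definition bigp (F : E -> R) k e : R := if big k e then incr F k e else 0.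

Lemma telescope (F : E -> R) k e : (k <= K)%N ->
  F (b k e) = F (b 0 e) + \sum_(i < k) incr F i e.
Proof.
elim: k => [|k IH] hk; first by rewrite big_ord0 addr0.
by rewrite big_ord_recr /= addrA -IH ?(ltnW hk)// /incr; ring.
Qed.

Lemma chain_decomp (F : E -> R) e :
  F e = F (b 0 e) + \sum_(k < K) bigp F k e + \sum_(k < K) smallp F k e.
Proof.
rewrite -{1}(bK e) telescope// -addrA -big_split /=; congr (_ + _).
by apply: eq_bigr => k _; rewrite /bigp /smallp; case: ifP; rewrite ?addr0 ?add0r.
Qed.

Lemma sum_cells (W : E -> R) (f : E -> R) k (C : pred E) : (k <= K)%N ->
  (forall e, f (b k e) = f e) -> (forall e, C (b k e) = C e) ->
  \sum_(e | C e) W e * f e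
  = \sum_(c | (b k c == c) && C c) f c * \sum_(e | b k e == c) W e.
Proof.
move=> kK hf hC.
rewrite (partition_big (b k) (fun c => (b k c == c) && C c)) /=; last first.
  by move=> e Ce; rewrite b_idem eqxx hC.
apply: eq_bigr => c /andP[/eqP bc Cc]; rewrite mulr_sumr.
rewrite (eq_bigl (fun e => b k e == c)).
  by apply: eq_bigr => e /eqP <-; rewrite hf mulrC.
move=> e; case: eqP => [ec|]; last by rewrite andbF.
by rewrite andbT -hC ec.
Qed.

Lemma small_bounds (F : E -> R) k e : F = A \/ F = B -> (k < K)%N ->
  0 <= smallp F k e <= eta k.
Proof.
move=> hF kK; have e0 := ltW (eta_gt0 kK).
rewrite /smallp; case: ifPn => [_|]; first by rewrite lexx e0.
rewrite /big negb_or -!leNgt => /andP[hA hB].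
have i0 : 0 <= incr F k e.
  by rewrite /incr subr_ge0; case: hF => ->; [case: HA => _ h _|case: HB => _ h _]; exact: h.
by rewrite i0; case: hF => ->.
Qed.

Lemma sum_incr (F : E -> R) k : F = A \/ F = B -> (k < K)%N ->
  \sum_(c | (b k.+1 c == c) && ~~ big k c) incr F k c <= Y k.
Proof.
move=> hF kK; have [_ h2 h3] : chained F by case: hF => ->.
apply: le_trans (h3 k kK).
rewrite [X in _ <= X](bigID (big k)) /=.
rewrite -[X in X <= _]add0r; apply: lerD.
  by apply: sumr_ge0 => c /andP[/eqP e _]; rewrite subr_ge0 -{2}e; exact: h2.
by rewrite le_eqVlt; apply/orP; left; apply/eqP; apply: eq_bigr => c /andP[/eqP e _];
  rewrite /incr e.
Qed.

Lemma small_norm (F : E -> R) : F = A \/ F = B ->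
  \sum_e (\sum_(k < K) smallp F k e) ^+ 2 <= 6 * \sum_(k < K) eta k * (alpha k * Y k).
Proof.
move=> hF; apply: (@le_trans _ _ (\sum_e 6 * \sum_(k < K) eta k * smallp F k e)).
  apply: ler_sum => e _; apply: (sqr_sum_geometric (s := fun k => smallp F k e)) => // k kK.
  exact: small_bounds.
rewrite -mulr_sumr ler_wpM2l// exchange_big /=; apply: ler_sum => k _.
have kK := ltn_ord k.
rewrite -mulr_sumr ler_wpM2l ?(ltW (eta_gt0 kK))//.
have a0 := alpha_ge0 kK.
have -> : \sum_e smallp F k e = \sum_(e | ~~ big k e) 1 * incr F k e.
  by rewrite [RHS]big_mkcond /=; apply: eq_bigr => e _; rewrite /smallp; case: ifP; rewrite ?mul1r.
rewrite (@sum_cells _ _ k.+1)//; last 2 first.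
- by move=> e; exact: incr_base.
- by move=> e; rewrite big_base.
apply: (@le_trans _ _ (\sum_(c | (b k.+1 c == c) && ~~ big k c) incr F k c * alpha k)).
  apply: ler_sum => c /andP[_ nb]; apply: ler_wpM2l.
    by have := small_bounds c hF kK; rewrite /smallp (negPf nb) => /andP[].
  apply: le_trans (cell_size c kK); rewrite sumr_const le_eqVlt; apply/orP; left; apply/eqP.
  by congr (_%:R); apply: eq_card => e; rewrite inE.
by rewrite -mulr_suml mulrC; apply: ler_wpM2l => //; exact: sum_incr.
Qed.

Let rectof k c : rect := projT1 (cid (b_rect k c)).
Lemma rectofP k c e : inrect (rectof k c) e = (b k e == c).
Proof. exact: (projT2 (cid (b_rect k c))). Qed.

Definition vsign (neg : bool) : 'I_(Q.*2.+1) := if neg then ord0 else ord_max.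
Lemma vsignE neg : ((vsign neg : nat)%:R - Q%:R) / Q%:R = (-1) ^+ neg :> R.
Proof.
have q0 : Q%:R != 0 :> R by rewrite pnatr_eq0 -lt0n.
case: neg => /=; first by rewrite sub0r mulNr divff// expr1.
by rewrite -addnn natrD addrK divff.
Qed.

(** At a vertex the small increments equal [eta k] on at most [s k] cells; divided by [eta k] this
    is a step function of the net. Both signs are needed, since the small parts of [A] and [B] enter
    with opposite signs. *)
Lemma small_net (W : E -> R) (neg : bool) (F : E -> R) (k : nat) (c1 c2 : R) : F = A \/ F = B -> (k < K)%N -> 0 <= c1 ->
  net_good (s k) c1 c2 W ->
  (-1) ^+ neg * fip W (smallp F k)
    <= eta k * (c1 * Num.sqrt ((s k)%:R * alpha k) + c2).
Proof.
move=> hF kK c10 hnet.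
pose W' e := (-1) ^+ neg * W e.
have -> : (-1) ^+ neg * fip W (smallp F k) = \sum_(e | ~~ big k e) W' e * incr F k e.
  rewrite /fip mulr_sumr [RHS]big_mkcond /=; apply: eq_bigr => e _.
  by rewrite /smallp /W'; case: ifP; rewrite ?mulr0 ?mulrA.
rewrite (@sum_cells _ _ k.+1)//; last 2 first.
- by move=> e; exact: incr_base.
- by move=> e; rewrite big_base.
have hC c : (b k.+1 c == c) && ~~ big k c -> 0 <= incr F k c <= eta k.
  by have := small_bounds c hF kK => + /andP[_ nb]; rewrite /smallp (negPf nb).
have [S [uS SC sS hS]] := vertex_bound (fun c => \sum_(e | b k.+1 e == c) W' e)
  (eta_gt0 kK) hC (le_trans (sum_incr hF kK) (Y_le kK)).
apply: (le_trans hS); rewrite ler_pM2l ?eta_gt0//.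
pose rs := [seq (rectof k.+1 c, vsign neg) | c <- S].
have ev e : evalr rs e = (-1) ^+ neg * (b k.+1 e \in S)%:R.
  rewrite /evalr big_map /=.
  under eq_bigr => c _ do rewrite vsignE rectofP.
  rewrite -mulr_sumr; congr (_ * _).
  case: (boolP (_ \in S)) => hb.
    rewrite (bigD1_seq (b k.+1 e))//= eqxx big1 ?addr0// => c hc.
    by rewrite eq_sym (negPf hc).
  by rewrite big1_seq// => c /andP[_ cS]; case: eqP => // ec; rewrite ec cS in hb.
have sz : (size rs <= s k)%N by rewrite size_map.
have ev2 e : `|evalr rs e| <= 2.
  rewrite ev normrM normrX normrN normr1 expr1n mul1r.
  by case: (_ \in S); rewrite ?normr1 ?normr0; lra.
have -> : \sum_(c <- S) \sum_(e | b k.+1 e == c) W' e = fip W (evalr rs).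
  rewrite /fip; under [RHS]eq_bigr => e _ do rewrite ev.
  rewrite (eq_bigr (fun c => \sum_e (if b k.+1 e == c then W' e else 0))); last first.
    by move=> c _; rewrite -big_mkcond.
  rewrite exchange_big /=; apply: eq_bigr => e _; rewrite /W'.
  case: (boolP (_ \in S)) => hb.
    rewrite mulr1 [RHS]mulrC (bigD1_seq (b k.+1 e))//= eqxx.
    have -> : \sum_(c <- S | c != b k.+1 e) (if b k.+1 e == c then (-1) ^+ neg * W e else 0) = 0.
      by apply: big1 => c hc; rewrite eq_sym (negPf hc).
    by rewrite addr0 mulrC.
  rewrite big1_seq ?mulr0// => c /andP[_ cS]; case: eqP => // ec.
  by rewrite ec cS in hb.
apply: (le_trans (hnet rs sz ev2)); rewrite lerD2r; apply: ler_wpM2l => //.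
rewrite ler_wsqrtr// /fnorm2.
have -> : \sum_e evalr rs e ^+ 2 = \sum_(c <- S) \sum_(e | b k.+1 e == c) 1.
  under [RHS]eq_bigr => c _ do rewrite big_mkcond /=.
  rewrite [RHS]exchange_big /=; apply: eq_bigr => e _.
  rewrite ev exprMn -exprM mulnC exprM sqrrN !expr1n mul1r.
  case: (boolP (_ \in S)) => hb.
    rewrite (bigD1_seq (b k.+1 e))//= eqxx big1 ?addr0 ?expr1n// => c hc.
    by rewrite eq_sym (negPf hc).
  rewrite big1_seq ?expr0n// => c /andP[_ cS]; case: eqP => // ec.
  by rewrite ec cS in hb.
apply: (@le_trans _ _ (\sum_(c <- S) alpha k)).
  apply: ler_sum => c _; apply: le_trans (cell_size c kK).
  rewrite sumr_const le_eqVlt; apply/orP; left; apply/eqP.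
  by congr (_%:R); apply: eq_card => e; rewrite inE.
rewrite big_const_seq count_predT iter_addr_0 -[alpha k *+ _]mulr_natl.
by apply: ler_wpM2r; [exact: alpha_ge0|rewrite ler_nat].
Qed.

Definition bigcells : seq (nat * E) :=
  [seq (0%N, c) | c <- enum [pred c | b 0 c == c]] ++
  flatten [seq [seq (k.+1, c) | c <- enum [pred c | (b k.+1 c == c) && big k c]] | k <- iota 0 K].

Definition bigcoef (F : E -> R) (p : nat * E) : R :=
  if p.1 is k.+1 then incr F k p.2 else F p.2.

Lemma sum_bigcells (f : nat * E -> R) : \sum_(p <- bigcells) f p
  = \sum_(c | b 0 c == c) f (0%N, c)
    + \sum_(k < K) \sum_(c | (b k.+1 c == c) && big k c) f (k.+1, c).
Proof.
rewrite /bigcells big_cat /= big_map big_enum_cond /=; congr (_ + _).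
  by apply: eq_bigl => c; rewrite andbT.
rewrite big_flatten /= big_map.
rewrite -(big_mkord xpredT (fun k => \sum_(c | (b k.+1 c == c) && big k c) f (k.+1, c))).
rewrite /index_iota subn0; apply: eq_bigr => k _.
by rewrite big_map big_enum_cond /=; apply: eq_bigl => c; rewrite andbT.
Qed.

Lemma sum_delta (f : E -> R) k (C : pred E) e : C (b k e) ->
  \sum_(c | (b k c == c) && C c) f c * (b k e == c)%:R = f (b k e).
Proof.
move=> Ce; rewrite (bigD1 (b k e))/= ?b_idem ?eqxx ?Ce// mulr1 big1 ?addr0// => c /andP[_ hc].
by rewrite eq_sym (negPf hc) mulr0.
Qed.

Lemma sum_delta0 (f : E -> R) k (C : pred E) e : ~~ C (b k e) ->
  \sum_(c | (b k c == c) && C c) f c * (b k e == c)%:R = 0.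
Proof.
move=> Ce; apply: big1 => c /andP[_ Cc]; case: eqP => [ec|]; last by rewrite mulr0.
by rewrite ec Cc in Ce.
Qed.

Lemma bigpart_eval (F : E -> R) e :
  F (b 0 e) + \sum_(k < K) bigp F k e = \sum_(p <- bigcells) bigcoef F p * (b p.1 e == p.2)%:R.
Proof.
rewrite sum_bigcells /=; congr (_ + _).
  rewrite -(@sum_delta F 0 predT e)//; apply: eq_bigl => c; by rewrite andbT.
apply: eq_bigr => k _; rewrite /bigp; case: ifPn => hb.
  by rewrite (@sum_delta (incr F k) k.+1 (big k) e) ?incr_base ?big_base.
by rewrite (@sum_delta0 (incr F k) k.+1 (big k) e)// big_base.
Qed.

(** A level with [eta k >= 1] has no large increment, since increments are at most 1. On the others
    each large cell takes more than [eta k] out of a total of at most [2 * Y k]. *)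
Lemma size_bigcells :
  (size bigcells <= #|[pred c | b 0 c == c]| + \sum_(k < K) g k)%N.
Proof.
have -> : size bigcells = (#|[pred c | b 0 c == c]|
    + \sum_(k < K) #|[pred c | (b k.+1 c == c) && big k c]|)%N.
  rewrite /bigcells size_cat size_map -cardE; congr (_ + _)%N.
  rewrite size_flatten /shape -map_comp sumnE big_map.
  rewrite -(big_mkord xpredT (fun k => #|[pred c | (b k.+1 c == c) && big k c]|)).
  by rewrite /index_iota subn0; apply: eq_bigr => k _ /=; rewrite size_map -cardE.
rewrite leq_add2l; apply: leq_sum => k _; have kK := ltn_ord k.
have inc0 (F : E -> R) c : chained F -> 0 <= incr F k c <= 1.
  move=> [h1 h2 _]; rewrite subr_ge0 h2//=.
  by have /andP[a1 a2] := h1 (b k.+1 c); have /andP[a3 a4] := h1 (b k c); rewrite /incr; lra.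
have [e1|e1] := ltP (eta k) 1; last first.
  rewrite eq_card0// => c; rewrite !inE; apply/negbTE/negP => /andP[_].
  have /andP[_ hA] := inc0 A c HA; have /andP[_ hB] := inc0 B c HB.
  by rewrite /big => /orP[]; lra.
rewrite -(ler_nat R) -(ler_pM2r (eta_gt0 kK)).
apply: le_trans (g_ge kK e1).
have hs F : chained F -> \sum_(c | (b k.+1 c == c) && big k c) incr F k c <= Y k.
  move=> hF; have [_ h2 h3] := hF; apply: le_trans (h3 k kK).
  rewrite [X in _ <= X](bigID (big k)) /= -[X in X <= _]addr0; apply: lerD.
    rewrite le_eqVlt; apply/orP; left; apply/eqP; apply: eq_bigr => c /andP[/eqP e _].
    by rewrite /incr e.
  by apply: sumr_ge0 => c /andP[/eqP e _]; rewrite subr_ge0 -{2}e; exact: h2.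
have -> : #|[pred c | (b k.+1 c == c) && big k c]|%:R * eta k
    = \sum_(c | (b k.+1 c == c) && big k c) eta k.
  by rewrite sumr_const mulr_natl.
apply: (@le_trans _ _ (\sum_(c | (b k.+1 c == c) && big k c) (incr A k c + incr B k c))).
  apply: ler_sum => c /andP[_]; have /andP[hA _] := inc0 A c HA; have /andP[hB _] := inc0 B c HB.
  by rewrite /big => /orP[]; lra.
by rewrite big_split /=; have := hs A HA; have := hs B HB; lra.
Qed.

(** [D] is [A - B] without its small parts: few cells with coefficients in [-1, 1], rounded into the
    net. The small parts count twice, in the linear form through [small_net] and in the norm of the
    rounded [D] through [small_norm]. *)
Lemma chaining_bound (W : E -> R) (m : nat) (a1 a2 : R) (c1 c2 : nat -> R) :
  0 <= a1 -> (forall k, (k < K)%N -> 0 <= c1 k) ->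
  net_good m a1 a2 W -> (forall k, (k < K)%N -> net_good (s k) (c1 k) (c2 k) W) ->
  (#|[pred c | b 0 c == c]| + \sum_(k < K) g k <= m)%N -> (K < Q)%N ->
  fip W (fun e => A e - B e) <=
    a1 * Num.sqrt (4 * (fnorm2 (fun e => A e - B e)
       + 12 * \sum_(k < K) eta k * (alpha k * Y k)
       + (n1 * n2)%:R * (K.+1%:R / Q%:R) ^+ 2)) + a2
    + \sum_(k < K) 2 * eta k * (c1 k * Num.sqrt ((s k)%:R * alpha k) + c2 k).
Proof.
move=> a10 c10 netm nets hm KQ.
have q0 : 0 < Q%:R :> R by rewrite ltr0n.
pose SA e := \sum_(k < K) smallp A k e; pose SB e := \sum_(k < K) smallp B k e.
pose D e := (A (b 0 e) + \sum_(k < K) bigp A k e) - (B (b 0 e) + \sum_(k < K) bigp B k e).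
have dec e : A e - B e = D e + SA e - SB e.
  by rewrite (chain_decomp A e) (chain_decomp B e) /D /SA /SB; ring.
have ipS (F : E -> R) (neg : bool) : F = A \/ F = B -> (-1) ^+ neg * fip W (fun e => \sum_(k < K) smallp F k e)
    <= \sum_(k < K) eta k * (c1 k * Num.sqrt ((s k)%:R * alpha k) + c2 k).
  move=> hF; have -> : fip W (fun e => \sum_(k < K) smallp F k e) = \sum_(k < K) fip W (smallp F k).
    by rewrite /fip [RHS]exchange_big /=; apply: eq_bigr => e _; rewrite mulr_sumr.
  rewrite mulr_sumr; apply: ler_sum => k _; have kK := ltn_ord k.
  exact: (small_net neg hF kK (c10 k kK) (nets k kK)).
have -> : fip W (fun e => A e - B e) = fip W D + fip W SA - fip W SB.
  rewrite /fip -big_split /= -sumrB; apply: eq_bigr => e _; rewrite dec; ring.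
have hSA := ipS A false (or_introl erefl); rewrite expr0 mul1r in hSA.
have hSB := ipS B true (or_intror erefl); rewrite expr1 mulN1r in hSB.
suff hD : fip W D <= a1 * Num.sqrt (4 * (fnorm2 (fun e => A e - B e)
       + 12 * \sum_(k < K) eta k * (alpha k * Y k)
       + (n1 * n2)%:R * (K.+1%:R / Q%:R) ^+ 2)) + a2.
  have -> : \sum_(k < K) 2 * eta k * (c1 k * Num.sqrt ((s k)%:R * alpha k) + c2 k)
    = 2 * \sum_(k < K) eta k * (c1 k * Num.sqrt ((s k)%:R * alpha k) + c2 k).
    by rewrite mulr_sumr; apply: eq_bigr => k _; rewrite mulrA.
  rewrite -/SA -/SB in hSA hSB; lra.
pose x p := bigcoef A p - bigcoef B p.
pose wc (p : nat * E) := \sum_(e | b p.1 e == p.2) W e.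
have xle p : p \in bigcells -> `|x p| <= 1.
  rewrite /x mem_cat => /orP[/mapP[c _ ->]|/flattenP[l /mapP[k hk ->] /mapP[c _ ->]]] /=.
    case: HA => h _ _; case: HB => h' _ _.
    have /andP[? ?] := h c; have /andP[? ?] := h' c.
    by rewrite /bigcoef /= ler_norml; apply/andP; split; lra.
  have kK : (k < K)%N by move: hk; rewrite mem_iota add0n.
  case: HA => h h2 _; case: HB => h' h2' _.
  have /andP[? ?] := h (b k.+1 c); have /andP[? ?] := h' (b k.+1 c).
  have /andP[? ?] := h (b k c); have /andP[? ?] := h' (b k c).
  have ? := h2 k c kK; have ? := h2' k c kK.
  by rewrite /bigcoef /= /incr ler_norml; apply/andP; split; lra.
(* Rounding is defined for coefficients of modulus at most 1; outside [bigcells] this bound may fail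
   and 0 is a default value. *)
pose x' p := if `|x p| <= 1 then x p else 0.
have x'1 p : `|x' p| <= 1 by rewrite /x'; case: ifP => //; rewrite normr0.
pose v p := projT1 (cid (round_towards (wc p) Q_gt0 (x'1 p))).
have vP p : `|((v p : nat)%:R - Q%:R) / Q%:R - x' p| <= Q%:R^-1 /\
     0 <= (((v p : nat)%:R - Q%:R) / Q%:R - x' p) * wc p.
  exact: (projT2 (cid (round_towards (wc p) Q_gt0 (x'1 p)))).
have xx p : p \in bigcells -> x' p = x p by move=> /xle h; rewrite /x' h.
pose rs := [seq (rectof p.1 p.2, v p) | p <- bigcells].
have ev e : evalr rs e = \sum_(p <- bigcells) ((v p : nat)%:R - Q%:R) / Q%:R * (b p.1 e == p.2)%:R.
  by rewrite /evalr big_map; apply: eq_bigr => p _; rewrite rectofP.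
have De e : D e = \sum_(p <- bigcells) x p * (b p.1 e == p.2)%:R.
  by rewrite /D !bigpart_eval -sumrB; apply: eq_bigr => p _; rewrite -mulrBl.
have ipD : fip W D <= fip W (evalr rs).
  have ipf (f : nat * E -> R) : fip W (fun e => \sum_(p <- bigcells) f p * (b p.1 e == p.2)%:R)
     = \sum_(p <- bigcells) f p * wc p.
    rewrite /fip (eq_bigr (fun e => \sum_(p <- bigcells) f p * (W e * (b p.1 e == p.2)%:R))).
      rewrite exchange_big /=; apply: eq_bigr => p _; rewrite -mulr_sumr; congr (_ * _).
      rewrite /wc [RHS]big_mkcond /=; apply: eq_bigr => e _.
      by case: eqP; rewrite ?mulr1 ?mulr0.
    by move=> e _; rewrite mulr_sumr; apply: eq_bigr => p _; ring.
  have -> : D = fun e => \sum_(p <- bigcells) x p * (b p.1 e == p.2)%:R by exact/funext.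
  have -> : evalr rs = fun e => \sum_(p <- bigcells)
     ((v p : nat)%:R - Q%:R) / Q%:R * (b p.1 e == p.2)%:R by exact/funext.
  rewrite !ipf big_seq [X in _ <= X]big_seq; apply: ler_sum => p hp.
  have [_] := vP p; rewrite (xx p hp) mulrBl; lra.
(* An entry lies in at most one cell of each of the K + 1 levels, and each contributes a rounding
   error of at most 1 / Q. *)
have errle e : `|evalr rs e - D e| <= K.+1%:R / Q%:R.
  rewrite ev De -sumrB; apply: (le_trans (ler_norm_sum _ _ _)).
  apply: (@le_trans _ _ (\sum_(p <- bigcells) Q%:R^-1 * (b p.1 e == p.2)%:R)).
    rewrite big_seq [X in _ <= X]big_seq; apply: ler_sum => p hp.
    rewrite -mulrBl normrM [X in _ * X]ger0_norm// ler_wpM2r//.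
    by have [h _] := vP p; rewrite -(xx p hp).
  rewrite sum_bigcells /=.
  have h0 : \sum_(c | b 0 c == c) Q%:R^-1 * (b 0 e == c)%:R = Q%:R^-1 :> R.
    by rewrite -[RHS](@sum_delta (fun=> Q%:R^-1) 0 predT e)//; apply: eq_bigl => c; rewrite andbT.
  rewrite h0 -natr1 mulrDl mul1r addrC; apply: lerD => //.
  have -> : K%:R / Q%:R = \sum_(k < K) Q%:R^-1 :> R by rewrite sumr_const card_ord mulr_natl.
  apply: ler_sum => k _; case: (boolP (big k (b k.+1 e))) => hb.
    by rewrite (@sum_delta (fun=> Q%:R^-1) k.+1 (big k) e).
  by rewrite (@sum_delta0 (fun=> Q%:R^-1) k.+1 (big k) e)// invr_ge0 ltW.
have KQ1 : K.+1%:R / Q%:R <= 1 :> R by rewrite ler_pdivrMr// mul1r ler_nat.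
have part01 F e : F = A \/ F = B -> 0 <= F (b 0 e) + \sum_(k < K) bigp F k e <= 1.
  move=> hF; have hc : chained F by case: hF => ->.
  have [h1 h2 _] := hc.
  apply/andP; split.
    apply: addr_ge0; first by case/andP: (h1 (b 0 e)).
    apply: sumr_ge0 => k _; rewrite /bigp; case: ifP => // _.
    by rewrite /incr subr_ge0; apply: h2.
  have /andP[_ h] := h1 e; apply: le_trans h; rewrite (chain_decomp F e) lerDl.
  by apply: sumr_ge0 => k _; case/andP: (small_bounds e hF (ltn_ord k)).
have ev2 e : `|evalr rs e| <= 2.
  have /andP[? ?] := part01 A e (or_introl erefl); have /andP[? ?] := part01 B e (or_intror erefl).
  have := errle e; rewrite ler_norml => /andP[? ?].
  have ? : D e <= 1 by rewrite /D; lra.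
  have ? : - 1 <= D e by rewrite /D; lra.
  by rewrite ler_norml; apply/andP; split; lra.
have szr : (size rs <= m)%N.
  by rewrite size_map; apply: leq_trans hm; exact: size_bigcells.
apply: (le_trans ipD); apply: (le_trans (netm rs szr ev2)).
rewrite lerD2r; apply: ler_wpM2l => //; rewrite ler_wsqrtr//.
have hn F : F = A \/ F = B -> \sum_e (\sum_(k < K) smallp F k e) ^+ 2
   <= 6 * \sum_(k < K) eta k * (alpha k * Y k) by exact: small_norm.
have hA := hn A (or_introl erefl); have hB := hn B (or_intror erefl).
(* The rounded function is (A - B) - SA + SB plus the rounding error, hence the factor 4 for four
   squares; [small_norm] for [A] and for [B] makes 6 + 6 = 12. *)
apply: (@le_trans _ _ (\sum_e 4 * ((A e - B e) ^+ 2 + SA e ^+ 2 + SB e ^+ 2 + (K.+1%:R / Q%:R) ^+ 2))).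
  apply: ler_sum => e _.
  have hq : (evalr rs e - D e) ^+ 2 <= (K.+1%:R / Q%:R) ^+ 2.
    rewrite -[X in X <= _]real_normK ?num_real// ler_sqr ?nnegrE ?divr_ge0 ?ler0n//.
  set r1 := evalr rs e - D e in hq.
  have -> : evalr rs e = (A e - B e) - SA e + SB e + r1 by rewrite /r1 dec; ring.
  set a := A e - B e; set u := SA e; set t := SB e.
  have := sqr_ge0 (a + u); have := sqr_ge0 (a - t); have := sqr_ge0 (a - r1).
  have := sqr_ge0 (u + t); have := sqr_ge0 (u + r1); have := sqr_ge0 (t - r1).
  move: hq; set qq := (_ / _) ^+ 2; clear; rewrite !expr2; lra.
rewrite -mulr_sumr ler_pM2l// !big_split /= sumr_const card_prod !card_ord.
rewrite -/SA -/SB in hA hB; rewrite /fnorm2 mulr_natl; lra.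
Qed.

End Chaining.

(** * Union bounds for the full sample *)

Section FullEvents.
Context {R : realType} {d : measure_display} {Omega : measurableType d}
  (P : probability Omega R) (n1 n2 : nat) (N zeta : R)
  (Ms : 'M[R]_(n1, n2)) (Nn : Omega -> nat)
  (X : nat -> Omega -> 'I_n1 * 'I_n2) (z : nat -> Omega -> R)
  (S : nat -> Omega -> bool).
Hypothesis n1_gt0 : (0 < n1)%N.
Hypothesis n2_gt0 : (0 < n2)%N.
Hypothesis zeta_gt0 : 0 < zeta.
Hypothesis N_gt0 : 0 < N.
Hypothesis Ms01 : forall i j, 0 <= Ms i j <= 1.
Hypothesis Hobs : obs_model P N zeta Nn X z S.

Local Notation Y := (Ymat Ms Nn X z (fun _ _ => true) N).
Local Notation n := ((n1 * n2)%:R : R).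
Local Notation p := (N / n).

Lemma finite_event (T : finType) (bad : T -> set Omega) (c : R) :
  (forall x, measurable (bad x)) -> (forall x, (P (bad x) <= c%:E)%E) ->
  exists E : set Omega, [/\ measurable E, (P (~` E) <= (#|T|%:R * c)%:E)%E &
    forall w, E w -> forall x, ~ bad x w].
Proof.
move=> mb pb; exists (~` \big[setU/set0]_(x : T) bad x); split.
- by apply: measurableC; apply: bigsetU_measurable.
- by rewrite setCK; exact: measure_bigsetU_le_const.
- by move=> w nE x bx; apply: nE; rewrite -bigcup_seq; exists x; rewrite //= mem_index_enum.
Qed.

Lemma expR_6lg : expR (- (6 * lg R n1 n2)) = n ^- 6.
Proof.
have n0 : 0 < n by rewrite ltr0n muln_gt0 n1_gt0.
by rewrite expRN expRM_natl /lg lnK.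
Qed.

Lemma colsum_event : 0 < lg R n1 n2 -> exists E : set Omega, [/\ measurable E,
  (P (~` E) <= (2 * n2%:R * n ^- 6)%:E)%E &
  forall w, E w -> forall j,
    `|colsum (Ymat Ms Nn X z S (N / 2) w) j - colsum Ms j| <= tau_bl n1 n2 N zeta].
Proof.
move=> L0.
pose bad (x : 'I_n2 * bool) := [set w | tau_bl n1 n2 N zeta
     <= (-1) ^+ x.2 * (colsum (Ymat Ms Nn X z S (N / 2) w) x.1 - colsum Ms x.1)].
have hb x : measurable (bad x) /\ (P (bad x) <= (expR (- (6 * lg R n1 n2)))%:E)%E.
  exact: (colsum_tail n1_gt0 n2_gt0 zeta_gt0 N_gt0 Ms01 Hobs x.1 x.2 L0).
have [E [mE pE hE]] := finite_event (fun x => (hb x).1) (fun x => (hb x).2).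
exists E; split => //.
  apply: (le_trans pE); rewrite lee_fin expR_6lg card_prod card_ord card_bool natrM.
  by rewrite [n2%:R * 2]mulrC.
move=> w Ew j; rewrite ler_norml; apply/andP; split; rewrite leNgt; apply/negP => h.
  by apply: (hE w Ew (j, true)); rewrite /bad /= expr1 mulN1r; apply: ltW; lra.
by apply: (hE w Ew (j, false)); rewrite /bad /= expr0 mul1r; apply: ltW.
Qed.

Lemma entry_event : 0 < lg R n1 n2 -> exists E : set Omega, [/\ measurable E,
  (P (~` E) <= (2 * n * n ^- 6)%:E)%E &
  forall w, E w -> forall i j, `|(Y w - Ms) i j| <=
    (1 + zeta) * (3 * Num.sqrt (6 * lg R n1 n2 / p) + 6 * lg R n1 n2 / p)].
Proof.
move=> L0; set L := lg R n1 n2 in L0 *.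
pose V (x : 'I_n1 * 'I_n2 * bool) : 'M[R]_(n1, n2) :=
  \matrix_(i, j) ((-1) ^+ x.2 * ((i == x.1.1) && (j == x.1.2))%:R).
have V1 x i j : `|V x i j| <= 1.
  rewrite mxE normrM normrX normrN normr1 expr1n mul1r.
  by case: (_ && _); rewrite ?normr1 ?normr0.
have ipV x (A : 'M[R]_(n1, n2)) : matip A (V x) = (-1) ^+ x.2 * A x.1.1 x.1.2.
  rewrite /matip (bigD1 x.1.1)//= (bigD1 x.1.2)//= mxE !eqxx mulr1 mulrC.
  rewrite [X in _ + X + _]big1 ?addr0 => [|j jn]; last by rewrite mxE (negPf jn) andbF !mulr0.
  by rewrite big1 ?addr0// => i iN; apply: big1 => j _; rewrite mxE (negPf iN) !mulr0.
have fV x : frob2 (V x) <= 1.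
  rewrite /frob2 (bigD1 x.1.1)//= (bigD1 x.1.2)//= mxE !eqxx mulr1.
  rewrite [X in _ + X + _]big1 ?addr0 => [|j jn]; last by rewrite mxE (negPf jn) andbF mulr0 expr0n.
  rewrite big1 ?addr0 => [|i iN]; last by apply: big1 => j _; rewrite mxE (negPf iN) mulr0 expr0n.
  by rewrite -exprM mulnC exprM sqrrN !expr1n.
pose u := (1 + zeta) * (3 * Num.sqrt (6 * L / p) + 6 * L / p).
have H0 : 0 <= 6 * L by rewrite mulr_ge0// ltW.
pose bad x := [set w | u <= matip (Y w - Ms) (V x)].
have hb x : measurable (bad x) /\ (P (bad x) <= (expR (- (6 * L)))%:E)%E.
  have := full_tail n1_gt0 n2_gt0 zeta_gt0 N_gt0 Ms01 Hobs ltr01 ltr01 H0 (fV x) (V1 x).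
  by rewrite !mul1r.
have [E [mE pE hE]] := finite_event (fun x => (hb x).1) (fun x => (hb x).2).
exists E; split => //.
  apply: (le_trans pE); rewrite lee_fin expR_6lg !card_prod !card_ord card_bool natrM.
  by rewrite [_ * 2]mulrC.
move=> w Ew i j; rewrite -/u ler_norml; apply/andP; split; rewrite leNgt; apply/negP => h.
  apply: (hE w Ew (i, j, true)); rewrite /bad /= ipV /= expr1 mulN1r; apply: ltW.
  by rewrite ltrNr.
by apply: (hE w Ew (i, j, false)); rewrite /bad /= ipV /= expr0 mul1r; apply: ltW.
Qed.

(** In units of ln n1: 2 n1 for the two permutations, 12 for each rectangle with its label, and a
    surplus 12 that becomes the failure probability n1^-12. *)
Definition net_entropy (m : nat) : R := (2 * n1 + 12 * m + 12)%:R * ln n1%:R.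

(** The exponent 12 is 4 * 2 + 4: each corner coordinate takes at most n1 + 1 <= n1^2 values and the
    label 2 n1^2 + 1 <= n1^4. *)
Lemma family_card (m : nat) : (1 < n1)%N -> (n2 <= n1)%N ->
  (#|{: 'S_n1 * 'S_n2 * m.-tuple (rect n1 n2 * 'I_((n1 ^ 2).*2.+1))}| <= n1 ^ (2 * n1 + 12 * m))%N.
Proof.
move=> n11 n21.
have fact_le k q : (k <= q)%N -> (k`! <= q ^ k)%N.
  by elim: k => // k IH kq; rewrite factS expnS leq_mul// IH// ltnW.
rewrite !card_prod !card_Sn card_tuple !card_prod !card_ord expnD (_ : 2 * n1 = n1 + n1)%N; last by rewrite mul2n addnn.
rewrite [(n1 ^ (n1 + n1))%N]expnD; apply: leq_mul; first apply: leq_mul.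
- exact: fact_le.
- by apply: (leq_trans (fact_le _ _ n21)); rewrite leq_pexp2l.
rewrite expnM; case: (m) => // m'; rewrite leq_exp2r//.
have h k : (k <= n1)%N -> (k.+1 <= n1 ^ 2)%N.
  by move=> kn; rewrite -mulnn; apply: (@leq_trans n1.+1) => //; nia.
have h4 : ((n1 ^ 2).*2.+1 <= n1 ^ 4)%N.
  rewrite (_ : 4 = 2 + 2)%N// expnD -mul2n; have : (4 <= n1 ^ 2)%N by rewrite -mulnn; nia.
  by move: (n1 ^ 2)%N => q; nia.
rewrite (_ : 12 = 2 + 2 + 2 + 2 + 4)%N// !expnD.
by apply: leq_mul; [apply: leq_mul; [apply: leq_mul; [apply: leq_mul|]|]|];
  rewrite ?h// -expnD.
Qed.

(** The label [Q] has value 0, so a list can be padded to a tuple of fixed length; such tuples form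
    a finite type. *)
Lemma evalr_pad (Q m : nat) (rs : seq (rect n1 n2 * 'I_(Q.*2.+1))) : (size rs <= m)%N ->
  exists t : m.-tuple (rect n1 n2 * 'I_(Q.*2.+1)), forall e, @evalr R n1 n2 _ t e = @evalr R n1 n2 _ rs e.
Proof.
move=> sm; have hQ : (Q < Q.*2.+1)%N by rewrite ltnS -addnn leq_addr.
pose x0 : rect n1 n2 * 'I_(Q.*2.+1) := (ord0, ord0, ord0, ord0, Ordinal hQ).
have hs : size (rs ++ nseq (m - size rs) x0) == m by rewrite size_cat size_nseq subnKC.
exists (Tuple hs) => e; rewrite /evalr /= big_cat /= [X in _ + X]big1_seq ?addr0// => p.
by rewrite mem_nseq => /andP[_ /andP[_ /eqP ->]] /=; rewrite subrr !mul0r.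
Qed.

(** The sorted permutations are functions of the same data, so one event has to serve all
    permutations. The variance proxy of each step function is its own squared norm. *)
Lemma net_event (m : nat) : (1 < n1)%N -> (n2 <= n1)%N ->
  exists E : set Omega, [/\ measurable E, (P (~` E) <= (n1%:R ^- 12)%:E)%E &
    forall w, E w -> forall (pi : 'S_n1) (sg : 'S_n2),
      @net_good R n1 n2 (n1 ^ 2) m
        (3 * (1 + zeta) * Num.sqrt (net_entropy m / p)) (2 * (1 + zeta) * (net_entropy m / p))
        (fun e => (Y w - Ms) ((pi^-1)%g e.1) ((sg^-1)%g e.2))].
Proof.
move=> n11 n21; set H := net_entropy m.
have n0 : 0 < n by rewrite ltr0n muln_gt0 n1_gt0.
have p0 : 0 < p by rewrite divr_gt0.
have l0 : 0 <= ln (n1%:R : R) by rewrite ln_ge0// ler1n.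
have H0 : 0 <= H by rewrite /H /net_entropy mulr_ge0.
have z1 : 0 <= 1 + zeta by have := zeta_gt0; lra.
have Hp : 0 <= H / p by rewrite divr_ge0// ltW.
pose T := ('S_n1 * 'S_n2 * m.-tuple (rect n1 n2 * 'I_((n1 ^ 2).*2.+1)))%type.
pose V (x : T) : 'M[R]_(n1, n2) := \matrix_(i, j) @evalr R n1 n2 _ x.2 (x.1.1 i, x.1.2 j).
(* [full_tail] asks for a positive variance; the zero function is treated apart below. *)
pose ok (x : T) := (0 < frob2 (V x)) && [forall i, forall j, `|V x i j| <= 2].
pose u (x : T) := (1 + zeta) * (3 * Num.sqrt (frob2 (V x) * H / p) + 2 * H / p).
pose bad (x : T) := if ok x then [set w | u x <= matip (Y w - Ms) (V x)] else set0.
have hb x : measurable (bad x) /\ (P (bad x) <= (expR (- H))%:E)%E.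
  rewrite /bad; case: ifPn => [/andP[f0 /forallP h]|_]; last first.
    by split; [exact: measurable0|rewrite measure0 lee_fin expR_ge0].
  apply: (full_tail n1_gt0 n2_gt0 zeta_gt0 N_gt0 Ms01 Hobs) => //.
  by move=> i j; have /forallP := h i.
have [E [mE pE hE]] := finite_event (fun x => (hb x).1) (fun x => (hb x).2).
exists E; split => //.
  apply: (le_trans pE); rewrite lee_fin.
  have n10 : 0 < n1%:R :> R by rewrite ltr0n.
  have -> : expR (- H) = (n1%:R ^+ (2 * n1 + 12 * m))^-1 * n1%:R ^- 12.
    rewrite -invfM -exprD expRN; congr (_^-1).
    by rewrite /H /net_entropy expRM_natl lnK.
  rewrite mulrA -[X in _ <= X]mul1r; apply: ler_wpM2r; first by rewrite invr_ge0 exprn_ge0// ltW.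
  rewrite ler_pdivrMr ?exprn_gt0// mul1r -natrX ler_nat; exact: family_card.
move=> w Ew pi sg rs srs rs2.
set W := fun e => _.
have [t ht] := evalr_pad srs.
have hfip : fip W (@evalr R n1 n2 _ rs) = matip (Y w - Ms) (V (pi, sg, t)).
  rewrite /fip /matip pair_big /=.
  rewrite (reindex (fun e : 'I_n1 * 'I_n2 => (pi e.1, sg e.2))) /=; last first.
    exists (fun e : 'I_n1 * 'I_n2 => ((pi^-1)%g e.1, (sg^-1)%g e.2)) => e _ /=.
      by rewrite !permK -surjective_pairing.
    by rewrite !permKV -surjective_pairing.
  by apply: eq_bigr => e _; rewrite /W /= !permK [V _ _ _]mxE /= ht.
have hfn : fnorm2 (@evalr R n1 n2 _ rs) = frob2 (V (pi, sg, t)).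
  rewrite /fnorm2 /frob2 pair_big /=.
  rewrite (reindex (fun e : 'I_n1 * 'I_n2 => (pi e.1, sg e.2))) /=; last first.
    exists (fun e : 'I_n1 * 'I_n2 => ((pi^-1)%g e.1, (sg^-1)%g e.2)) => e _ /=.
      by rewrite !permK -surjective_pairing.
    by rewrite !permKV -surjective_pairing.
  by apply: eq_bigr => e _; rewrite [V _ _ _]mxE /= ht.
have a20 : 0 <= 2 * (1 + zeta) * (H / p).
  by apply: mulr_ge0 => //; apply: mulr_ge0.
have [f0|f0] := ltP 0 (fnorm2 (@evalr R n1 n2 _ rs)); last first.
  have fz : fnorm2 (@evalr R n1 n2 _ rs) = 0.
    by apply/eqP; rewrite eq_le f0 sumr_ge0// => e _; exact: sqr_ge0.
  have ez e : @evalr R n1 n2 _ rs e = 0.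
    have /psumr_eq0P h : fnorm2 (@evalr R n1 n2 _ rs) = 0 by [].
    by apply/eqP; rewrite -sqrf_eq0; apply/eqP; apply: h => // i _; exact: sqr_ge0.
  by rewrite fz sqrtr0 mulr0 add0r /fip big1// => e _; rewrite ez mulr0.
have okx : ok (pi, sg, t).
  rewrite /ok -hfn f0 /=; apply/forallP => i; apply/forallP => j.
  by rewrite [V _ _ _]mxE /= ht.
have := hE w Ew (pi, sg, t); rewrite /bad okx /= => /negP; rewrite -ltNge => /ltW.
rewrite hfip hfn => h; apply: (le_trans h).
rewrite /u -mulrA sqrtrM ?sumr_ge0//.
  by rewrite le_eqVlt; apply/orP; left; apply/eqP; ring.
by move=> i _; apply: sumr_ge0 => j _; exact: sqr_ge0.
Qed.

End FullEvents.

(** * Partitions into the cells of a rectangular grid *)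

Section Grid.
Context {R : realType}.

Definition flr (l i : nat) : nat := (i %/ l * l)%N.

Lemma flr_le l i : (flr l i <= i)%N.
Proof. exact: leq_divM. Qed.

Lemma flr_idem l i : flr l (flr l i) = flr l i.
Proof. by rewrite /flr; case: l => [|l]; rewrite ?muln0// mulnK. Qed.

Lemma flr_nest l l' i : (l %| l')%N -> flr l' (flr l i) = flr l' i.
Proof.
move=> /dvdnP[q ->]; rewrite /flr [(q * l)%N]mulnC.
by case: l => [|l]; rewrite ?mul0n ?muln0// !divnMA mulnK.
Qed.

Lemma flr_le_nest l l' i : (l %| l')%N -> (flr l' i <= flr l i)%N.
Proof. by move=> ll; rewrite -(flr_nest _ ll) flr_le. Qed.

(** By truncated subtraction the term at 0 vanishes, so the sum telescopes over the multiples of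
    [l]. *)
Lemma sum_dvdn_telescope (u : nat -> R) l m : (0 < l)%N ->
  \sum_(0 <= i < m.+1 | (l %| i)%N) (u i - u (i - l)%N) = u (flr l m) - u 0%N.
Proof.
move=> l0; elim: m => [|m IH].
  by rewrite big_mkcond big_nat1 dvdn0 sub0n /flr div0n mul0n.
rewrite big_mkcond big_nat_recr//= -big_mkcond IH /flr divnS//.
case: (boolP (l %| m.+1)%N) => h; last by rewrite add0n addr0.
have e : ((1 + m %/ l) * l)%N = m.+1 by rewrite -[RHS](divnK h) divnS// h.
by rewrite e -{2}e mulnDl mul1n addKn; ring.
Qed.

(** A shift by [q] meshes is a succession of [q] shifts by one mesh, each of which telescopes to at
    most 1. *)
Lemma sum_dvdn_shift (u : nat -> R) l q m : (0 < l)%N ->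
  (forall x y, (x <= y)%N -> u x <= u y) -> (forall x, 0 <= u x <= 1) ->
  \sum_(0 <= i < m | (l %| i)%N) (u i - u (i - q * l)%N) <= q%:R.
Proof.
move=> l0 um u01; elim: q => [|q IH].
  by rewrite big1// => i _; rewrite mul0n subn0 subrr.
pose w x := u (x - q * l)%N.
have -> : \sum_(0 <= i < m | (l %| i)%N) (u i - u (i - q.+1 * l)%N)
   = \sum_(0 <= i < m | (l %| i)%N) (u i - u (i - q * l)%N)
     + \sum_(0 <= i < m | (l %| i)%N) (w i - w (i - l)%N).
  rewrite -big_split /=; apply: eq_bigr => i _.
  by rewrite /w -subnDA mulSn; ring.
rewrite -natr1; apply: lerD => //.
case: m {IH} => [|m]; first by rewrite big_geq.
rewrite sum_dvdn_telescope// /w.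
by have := u01 (flr l m - q * l)%N; have := u01 (0 - q * l)%N; lra.
Qed.

(** Rounding a multiple of [l] down to a multiple of [k * l] moves it by at most k - 1 meshes. *)
Lemma sum_dvdn_floor (u : nat -> R) l k m : (0 < l)%N -> (0 < k)%N ->
  (forall x y, (x <= y)%N -> u x <= u y) -> (forall x, 0 <= u x <= 1) ->
  \sum_(0 <= i < m | (l %| i)%N) (u i - u (flr (k * l) i)) <= (k.-1)%:R.
Proof.
move=> l0 k0 um u01; apply: le_trans (sum_dvdn_shift k.-1 m l0 um u01).
apply: ler_sum => i /dvdnP[a ->]; rewrite lerD2l lerN2; apply: um.
rewrite /flr divnMr// -mulnBl mulnA leq_mul2r; apply/orP; right.
rewrite leq_subLR {1}(divn_eq a k) addnC leq_add2r -ltnS prednK// ltn_pmod//.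
Qed.

Lemma flo_subproof n l (i : 'I_n) : (flr l i < n)%N.
Proof. exact: leq_ltn_trans (flr_le _ _) (ltn_ord i). Qed.

Definition flo n l (i : 'I_n) : 'I_n := Ordinal (flo_subproof l i).

(** For positive [n], the number of multiples of [l] below [n]. *)
Definition nbase (n l : nat) : nat := (n.-1 %/ l).+1.

Lemma flo_fixE n l (i : 'I_n) : (flo l i == i) = (l %| i)%N.
Proof. by rewrite -val_eqE /= /flr; apply/eqP/idP => [<-|/divnK //]; exact: dvdn_mull. Qed.

Lemma card_flo_fix n l : (0 < l)%N -> (#|[pred i : 'I_n | flo l i == i]| <= nbase n l)%N.
Proof.
move=> l0; rewrite /nbase -[X in (_ <= X)%N]card_ord.
have hf (i : 'I_n) : (i %/ l < (n.-1 %/ l).+1)%N.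
  rewrite ltnS leq_div2r// -ltnS; apply: (leq_trans (ltn_ord i)).
  by rewrite leqSpred.
apply: (@leq_card_in _ _ (fun i => Ordinal (hf i))) => // i j; rewrite !inE => /eqP hi /eqP hj [h].
by apply/val_inj; rewrite -hi -hj /= /flr h.
Qed.

Lemma card_flo_cell n l (c : 'I_n) : (0 < l)%N -> (#|[pred i : 'I_n | flo l i == c]| <= l)%N.
Proof.
move=> l0; rewrite -[X in (_ <= X)%N]card_ord.
have hf (i : 'I_n) : (i %% l < l)%N by rewrite ltn_pmod.
apply: (@leq_card_in _ _ (fun i => Ordinal (hf i))) => // i j; rewrite !inE => /eqP hi /eqP hj [h].
apply/val_inj; rewrite /= (divn_eq i l) (divn_eq j l) h; congr (_ + _)%N.
by move: hi hj => /(congr1 val) /= + /(congr1 val) /=; rewrite /flr => -> ->.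
Qed.

Lemma flo_itv n l (c : 'I_n) : (0 < l)%N ->
  exists a b : 'I_n.+1, forall i : 'I_n, (a <= i < b)%N = (flo l i == c).
Proof.
move=> l0; case: (boolP (l %| c)%N) => h.
  exists (inord c), (inord (minn (c + l) n)) => i.
  rewrite !inordK ?ltnS ?geq_minr// ?(ltnW (ltn_ord c))// leq_min ltn_ord andbT.
  rewrite -val_eqE /= /flr; case/dvdnP: h => q ->.
  rewrite eqn_pmul2r// eqn_leq leq_divRL// -[X in _ = X && _]ltnS ltn_divLR// mulSn addnC andbC.
  by [].
(* A point off the grid is the base of no cell, hence the empty interval. *)
exists ord0, ord0 => i; rewrite ltn0 andbF; apply/esym/negbTE; apply: contra h => /eqP <-.
by rewrite /= /flr dvdn_mull.
Qed.

Context (n1 n2 K : nat) (l1 l2 : nat -> nat).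
Local Notation E := ('I_n1 * 'I_n2)%type.
Hypothesis l1_gt0 : forall k, (0 < l1 k)%N.
Hypothesis l2_gt0 : forall k, (0 < l2 k)%N.
Hypothesis l1_dvd : forall k, (k < K)%N -> (l1 k.+1 %| l1 k)%N.
Hypothesis l2_dvd : forall k, (k < K)%N -> (l2 k.+1 %| l2 k)%N.
Hypothesis l1K : l1 K = 1%N.
Hypothesis l2K : l2 K = 1%N.

Definition gridb k (e : E) : E := (flo (l1 k) e.1, flo (l2 k) e.2).

(** Each column of the finer mesh carries a monotone sequence in [0, 1], for which rounding to the
    coarser mesh costs the ratio of the meshes minus 1; likewise for each row. *)
Definition gridY k : R :=
  (nbase n2 (l2 k.+1))%:R * ((l1 k %/ l1 k.+1).-1)%:R
  + (nbase n1 (l1 k.+1))%:R * ((l2 k %/ l2 k.+1).-1)%:R.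

Lemma gridbK e : gridb K e = e.
Proof.
by rewrite /gridb l1K l2K [RHS]surjective_pairing; congr pair; apply/val_inj;
  rewrite /= /flr divn1 muln1.
Qed.

Lemma gridb_nest k e : (k < K)%N -> gridb k (gridb k.+1 e) = gridb k e.
Proof.
move=> kK; rewrite /gridb /=; congr pair; apply/val_inj; rewrite /= flr_nest//.
  exact: l1_dvd.
exact: l2_dvd.
Qed.

Lemma gridb_idem k e : gridb k (gridb k e) = gridb k e.
Proof. by rewrite /gridb /=; congr pair; apply/val_inj; rewrite /= flr_idem. Qed.

Lemma gridb_rect k c : exists r, forall e, inrect r e = (gridb k e == c).
Proof.
have [a1 [b1 h1]] := flo_itv c.1 (l1_gt0 k); have [a2 [b2 h2]] := flo_itv c.2 (l2_gt0 k).
exists (a1, b1, a2, b2) => e; rewrite /inrect /= h1 h2.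
by case: c {h1 h2} => c1 c2; rewrite /gridb xpair_eqE.
Qed.

Lemma gridb_cell k c : (#|[set e | gridb k e == c]%SET| <= l1 k * l2 k)%N.
Proof.
case: c => c1 c2.
have -> : [set e | gridb k e == (c1, c2)]%SET
    = finset.setX [set i | flo (l1 k) i == c1]%SET [set j | flo (l2 k) j == c2]%SET.
  by apply/setP => e; rewrite !inE /gridb xpair_eqE.
by rewrite cardsX !cardsE leq_mul// card_flo_cell.
Qed.

Lemma gridb_base k : (#|[pred c | gridb k c == c]| <= nbase n1 (l1 k) * nbase n2 (l2 k))%N.
Proof.
have -> : #|[pred c | gridb k c == c]|
    = #|finset.setX [set i : 'I_n1 | flo (l1 k) i == i]%SET [set j : 'I_n2 | flo (l2 k) j == j]%SET|.
  by apply: eq_card => -[i j]; rewrite !inE /gridb xpair_eqE.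
by rewrite cardsX !cardsE leq_mul// card_flo_fix.
Qed.

Lemma grid_chained (F : nat -> nat -> R) :
  (forall i j, 0 <= F i j <= 1) -> (forall i i' j j', (i <= i')%N -> (j <= j')%N -> F i j <= F i' j') ->
  chained K gridb gridY (fun e => F e.1 e.2).
Proof.
move=> F01 Fm; split => // [k e kK|k kK].
  by apply: Fm; rewrite /=; apply: flr_le_nest; [exact: l1_dvd|exact: l2_dvd].
rewrite (eq_bigl (fun c : E => (l1 k.+1 %| c.1)%N && (l2 k.+1 %| c.2)%N)); last first.
  by case=> i j; rewrite /gridb xpair_eqE !flo_fixE.
rewrite -(pair_big (fun i : 'I_n1 => (l1 k.+1 %| i)%N) (fun j : 'I_n2 => (l2 k.+1 %| j)%N)
  (fun i j => F i j - F (flr (l1 k) i) (flr (l2 k) j))) /=.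
(* The row index is coarsened first and the column index second, so that each difference moves along
   one coordinate. *)
have -> : \sum_(i < n1 | (l1 k.+1 %| i)%N) \sum_(j < n2 | (l2 k.+1 %| j)%N)
     (F i j - F (flr (l1 k) i) (flr (l2 k) j))
  = \sum_(j < n2 | (l2 k.+1 %| j)%N) \sum_(i < n1 | (l1 k.+1 %| i)%N) (F i j - F (flr (l1 k) i) j)
   + \sum_(i < n1 | (l1 k.+1 %| i)%N) \sum_(j < n2 | (l2 k.+1 %| j)%N)
       (F (flr (l1 k) i) j - F (flr (l1 k) i) (flr (l2 k) j)).
  rewrite [X in _ = X + _]exchange_big /= -big_split /=; apply: eq_bigr => i _.
  by rewrite -big_split /=; apply: eq_bigr => j _; ring.
have q1 : (0 < l1 k %/ l1 k.+1)%N by rewrite divn_gt0// dvdn_leq// l1_dvd.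
have q2 : (0 < l2 k %/ l2 k.+1)%N by rewrite divn_gt0// dvdn_leq// l2_dvd.
apply: lerD.
- apply: (@le_trans _ _ (\sum_(j < n2 | (l2 k.+1 %| j)%N) ((l1 k %/ l1 k.+1).-1)%:R)).
    apply: ler_sum => j _; rewrite -(big_mkord (fun i => (l1 k.+1 %| i)%N)
       (fun i => F i j - F (flr (l1 k) i) j)) -{1}(divnK (l1_dvd kK)).
    apply: (@sum_dvdn_floor (fun i => F i j)) => // x y xy; exact: Fm.
  rewrite sumr_const -[X in X <= _]mulr_natl; apply: ler_wpM2r => //; rewrite ler_nat.
  apply: leq_trans (card_flo_fix n2 (l2_gt0 k.+1)).
  by apply: subset_leq_card; apply/fintype.subsetP => j; rewrite !inE flo_fixE.
- apply: (@le_trans _ _ (\sum_(i < n1 | (l1 k.+1 %| i)%N) ((l2 k %/ l2 k.+1).-1)%:R)).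
    apply: ler_sum => i _; rewrite -(big_mkord (fun j => (l2 k.+1 %| j)%N)
       (fun j => F (flr (l1 k) i) j - F (flr (l1 k) i) (flr (l2 k) j))) -{1}(divnK (l2_dvd kK)).
    apply: (@sum_dvdn_floor (fun j => F (flr (l1 k) i) j)) => // x y xy; exact: Fm.
  rewrite sumr_const -[X in X <= _]mulr_natl; apply: ler_wpM2r => //; rewrite ler_nat.
  apply: leq_trans (card_flo_fix n1 (l1_gt0 k.+1)).
  by apply: subset_leq_card; apply/fintype.subsetP => j; rewrite !inE flo_fixE.
Qed.

Definition bimonotone (F : nat -> nat -> R) : Prop :=
  (forall i j, 0 <= F i j <= 1) /\
  (forall i i' j j', (i <= i')%N -> (j <= j')%N -> F i j <= F i' j').

Lemma grid_chaining (Q : nat) (eta : nat -> R) (s g : nat -> nat) (F G : nat -> nat -> R)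
    (W : E -> R) (m : nat) (a1 a2 : R) (c1 c2 : nat -> R) : (0 < Q)%N ->
  (forall k, (k < K)%N -> 0 < eta k) ->
  (forall k, (k < K)%N -> \sum_(i < k.+1) eta i <= 3 * eta k) ->
  (forall k, (k < K)%N -> gridY k <= (s k)%:R * eta k) ->
  (forall k, (k < K)%N -> eta k < 1 -> 2 * gridY k <= (g k)%:R * eta k) ->
  bimonotone F -> bimonotone G ->
  0 <= a1 -> (forall k, (k < K)%N -> 0 <= c1 k) ->
  net_good Q m a1 a2 W -> (forall k, (k < K)%N -> net_good Q (s k) (c1 k) (c2 k) W) ->
  (nbase n1 (l1 0) * nbase n2 (l2 0) + \sum_(k < K) g k <= m)%N -> (K < Q)%N ->
  fip W (fun e => F e.1 e.2 - G e.1 e.2) <=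
    a1 * Num.sqrt (4 * (fnorm2 (fun e : E => F e.1 e.2 - G e.1 e.2)
       + 12 * \sum_(k < K) eta k * ((l1 k.+1 * l2 k.+1)%:R * gridY k)
       + (n1 * n2)%:R * (K.+1%:R / Q%:R) ^+ 2)) + a2
    + \sum_(k < K) 2 * eta k * (c1 k * Num.sqrt ((s k)%:R * (l1 k.+1 * l2 k.+1)%:R) + c2 k).
Proof.
move=> Q0 e0 eg Yle gge [F01 Fm] [G01 Gm] a0 c0 nm ns hm KQ.
pose al (k : nat) : R := (l1 k.+1 * l2 k.+1)%:R.
have cs k c : (k < K)%N -> #|[set e | gridb k.+1 e == c]%SET|%:R <= al k.
  by move=> kK; rewrite ler_nat gridb_cell.
have al0 k : (k < K)%N -> 0 <= al k by [].
have hm' : (#|[pred c | gridb 0 c == c]| + \sum_(k < K) g k <= m)%N.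
  by apply: leq_trans hm; rewrite leq_add2r gridb_base.
exact: (chaining_bound Q0 gridbK gridb_nest gridb_idem gridb_rect cs al0 e0 eg Yle gge
  (grid_chained F01 Fm) (grid_chained G01 Gm) a0 c0 nm ns hm' KQ).
Qed.

End Grid.

(** * Dyadic meshes and the stopping level *)

Section Dyadic.

(** By truncated subtraction the mesh is 1 from level [J] on, and refining changes nothing any
    more. *)
Lemma pow_ratio J k : (2 ^ (J - k) %/ 2 ^ (J - k.+1)).-1 = (k < J)%N :> nat.
Proof.
case: ltnP => kJ.
  by rewrite -(subnSK kJ) expnS mulnK ?expn_gt0.
by rewrite (eqP kJ) (eqP (leqW kJ)) expn0 divnn.
Qed.

Lemma nbase_pow n J j : (0 < n)%N -> (n <= 2 ^ J)%N -> (nbase n (2 ^ (J - j)) <= 2 ^ j)%N.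
Proof.
move=> n0 nJ; rewrite /nbase ltn_divLR ?expn_gt0// -expnD.
have : (n.-1 < n)%N by rewrite prednK.
move=> /leq_trans; apply; apply: (leq_trans nJ); rewrite leq_exp2l//.
by rewrite -leq_subLR.
Qed.

Lemma nbase_mul_le n l : (0 < n)%N -> (nbase n l * l <= n + l)%N.
Proof.
move=> n0; rewrite /nbase mulSn addnC leq_add2r.
by apply: leq_trans (leq_divM _ _) (leq_pred _).
Qed.

Lemma nbase1 n : (0 < n)%N -> nbase n 1 = n.
Proof. by move=> n0; rewrite /nbase divn1 prednK. Qed.

Definition dlog n := (trunc_log 2 n).+1.

Lemma dlog_lt n : (0 < n)%N -> (n < 2 ^ dlog n)%N.
Proof. by move=> n0; have /andP[] := @trunc_log_bounds 2 n isT n0. Qed.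

Lemma dlog_le n : (0 < n)%N -> (2 ^ (dlog n).-1 <= n)%N.
Proof. by move=> n0; have /andP[] := @trunc_log_bounds 2 n isT n0. Qed.

Lemma dlog_le2 n : (0 < n)%N -> (2 ^ dlog n <= 2 * n)%N.
Proof. by move=> n0; rewrite /dlog expnS leq_mul2l/=; exact: dlog_le. Qed.

Lemma dlog_id n : (0 < n)%N -> (dlog n <= n)%N.
Proof. by move=> n0; apply: leq_trans (dlog_le n0); rewrite /dlog /= ltn_expl. Qed.

Lemma dlog_split n k : (0 < n)%N -> (k < dlog n)%N -> (2 ^ k * 2 ^ (dlog n - k.+1) <= n)%N.
Proof.
move=> n0 kJ; apply: leq_trans (dlog_le n0); rewrite -expnD.
by rewrite subnS -!subn1 addnBA ?subn_gt0// subnKC// ltnW.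
Qed.

(* The dyadic chain stops at a mesh of order [log n] and then jumps to single entries: each
   further level would cost again the entropy [n1 log n1] of the permutations. *)
Definition kstop n := (dlog n - 1 - trunc_log 2 (dlog n))%N.

Lemma kstop_facts n : (0 < n)%N ->
  [/\ (kstop n < dlog n)%N, (2 ^ kstop n * dlog n <= 2 * n)%N & (n <= 2 * 2 ^ kstop n * dlog n)%N].
Proof.
move=> n0; have J0 : (0 < dlog n)%N by [].
have /andP[t1 t2] := @trunc_log_bounds 2 (dlog n) isT J0.
set t := trunc_log 2 (dlog n) in t1 t2.
have tJ : (t < dlog n)%N by apply: leq_trans t1; rewrite ltn_expl.
have e : (2 ^ (dlog n).-1 = 2 ^ kstop n * 2 ^ t)%N.
  by rewrite -expnD /kstop subn1 subnK// -ltnS prednK.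
split.
- by rewrite /kstop -subnDA ltn_subrL.
- apply: (@leq_trans (2 ^ kstop n * 2 ^ t.+1)); first by rewrite leq_mul2l (ltnW t2) orbT.
  by rewrite expnS mulnCA -e leq_mul2l/=; exact: dlog_le.
- apply: (leq_trans (ltnW (dlog_lt n0))).
  rewrite -[X in (2 ^ X)%N](prednK J0) expnS e mulnA leq_mul2l t1 orbT.
  by [].
Qed.

End Dyadic.

(** * The dyadic chain *)

Section DyadicChain.
Context {R : realType} (n1 n2 : nat).
Hypothesis n1_gt1 : (1 < n1)%N.
Hypothesis n2_gt0 : (0 < n2)%N.
Hypothesis n21 : (n2 <= n1)%N.
Local Notation E := ('I_n1 * 'I_n2)%type.

Let n1_gt0 : (0 < n1)%N. Proof. exact: ltnW. Qed.
Let J := dlog n1.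
Let J2 := dlog n2.
Let ks := kstop n1.

Definition lev (J k : nat) : nat := if (k <= ks)%N then (2 ^ (J - k))%N else 1%N.

Lemma lev_gt0 j k : (0 < lev j k)%N.
Proof. by rewrite /lev; case: ifP => // _; rewrite expn_gt0. Qed.

Lemma lev_dvd j k : (lev j k.+1 %| lev j k)%N.
Proof.
rewrite /lev; case: (leqP k.+1 ks) => h; last by rewrite dvd1n.
by rewrite (ltnW h) dvdn_exp2l// leq_sub2l.
Qed.

Lemma lev_end j : lev j ks.+1 = 1%N.
Proof. by rewrite /lev ltnn. Qed.

Let Yn k := (nbase n2 (lev J2 k.+1) * (lev J k %/ lev J k.+1).-1
  + nbase n1 (lev J k.+1) * (lev J2 k %/ lev J2 k.+1).-1)%N.

Lemma gridY_lev k : @gridY R n1 n2 (lev J) (lev J2) k = (Yn k)%:R.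
Proof. by rewrite /gridY /Yn natrD !natrM. Qed.

Lemma YnE k : (k < ks)%N -> Yn k = (nbase n2 (2 ^ (J2 - k.+1)) * (k < J)
  + nbase n1 (2 ^ (J - k.+1)) * (k < J2))%N.
Proof. by move=> h; rewrite /Yn /lev h (ltnW h) !pow_ratio. Qed.

Let ksJ : (ks < J)%N. Proof. by have [] := kstop_facts n1_gt0. Qed.
Let ks_up : (2 ^ ks * J <= 2 * n1)%N. Proof. by have [] := kstop_facts n1_gt0. Qed.
Let ks_lo : (n1 <= 2 * 2 ^ ks * J)%N. Proof. by have [] := kstop_facts n1_gt0. Qed.

Lemma Yn_le k : (k < ks)%N -> (Yn k <= 4 * 2 ^ k)%N.
Proof.
move=> h; rewrite YnE// (_ : 4 * 2 ^ k = 2 ^ k.+1 + 2 ^ k.+1)%N; last by rewrite expnS; lia.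
by apply: leq_add; rewrite -[X in (_ <= X)%N]muln1; apply: leq_mul;
  rewrite ?leq_b1//; apply: nbase_pow => //; apply: ltnW; exact: dlog_lt.
Qed.

Lemma lev1_le k : (k < ks)%N -> (2 ^ k * lev J k.+1 <= n1)%N.
Proof. by move=> h; rewrite /lev h; apply: dlog_split => //; exact: ltn_trans h ksJ. Qed.

Lemma lev2_le k : (lev J2 k.+1 <= 2 * n2)%N.
Proof.
apply: leq_trans (dlog_le2 n2_gt0); rewrite /lev; case: ifP => _.
  by rewrite leq_exp2l// leq_subr.
by rewrite expn_gt0.
Qed.

Lemma lev1_le2 k : (lev J k.+1 <= 2 * n1)%N.
Proof.
apply: leq_trans (dlog_le2 n1_gt0); rewrite /lev; case: ifP => _.
  by rewrite leq_exp2l// leq_subr.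
by rewrite expn_gt0.
Qed.

(** A mesh times its number of base points is at most three times the side, and the other mesh times
    2^k is at most its own side as long as that mesh is still being refined. *)
Lemma Yn_area k : (k < ks)%N -> (2 ^ k * (lev J k.+1 * lev J2 k.+1 * Yn k) <= 6 * (n1 * n2))%N.
Proof.
move=> h; have a1 := lev1_le h; have a2 := lev2_le k; have a3 := lev1_le2 k.
have b1 := nbase_mul_le (lev J k.+1) n1_gt0; have b2 := nbase_mul_le (lev J2 k.+1) n2_gt0.
have : (Yn k = nbase n2 (lev J2 k.+1) * (k < J) + nbase n1 (lev J k.+1) * (k < J2))%N.
  by rewrite YnE// /lev h.
move=> ->; move: a1 a2 a3 b1 b2.
have : (k < J2)%N -> (2 ^ k * lev J2 k.+1 <= n2)%N.
  by move=> hk; rewrite /lev h; exact: dlog_split.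
move: (lev J k.+1) (lev J2 k.+1) (nbase n1 _) (nbase n2 _) (2 ^ k)%N => x y u v w.
move=> a0 a1 a2 a3 b1 b2.
have c1 : (w * (x * y * (v * (k < J))) <= 3 * (n1 * n2))%N.
  apply: (@leq_trans ((w * x) * (v * y))); first by case: (k < J)%N; nia.
  apply: (@leq_trans (n1 * (3 * n2))); last by nia.
  by apply: leq_mul => //; lia.
have c2 : (w * (x * y * (u * (k < J2))) <= 3 * (n1 * n2))%N.
  case: ltnP a0 => [_ /(_ isT) a0|_ _]; last by rewrite !muln0.
  apply: (@leq_trans ((w * y) * (u * x))); first by nia.
  apply: (@leq_trans (n2 * (3 * n1))); last by nia.
  by apply: leq_mul => //; lia.
by rewrite !mulnDr; lia.
Qed.

(** The final jump goes from meshes that are at most of order [J], by [kstop_facts], to single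
    entries. *)
Lemma Yn_last : (Yn ks <= 8 * n2 * J)%N.
Proof.
have p0 : (0 < 2 ^ ks)%N by rewrite expn_gt0.
rewrite -(leq_pmul2l p0).
have -> : Yn ks = (n2 * (2 ^ (J - ks)).-1 + n1 * (2 ^ (J2 - ks)).-1)%N.
  by rewrite /Yn !lev_end !divn1 !nbase1// /lev leqnn.
have c1 : (2 ^ ks * (n2 * (2 ^ (J - ks)).-1) <= 2 * (n1 * n2))%N.
  apply: (@leq_trans (n2 * 2 ^ J)).
    rewrite mulnCA leq_mul2l; apply/orP; right.
    apply: (@leq_trans (2 ^ ks * 2 ^ (J - ks))); first by rewrite leq_mul2l leq_pred orbT.
    by rewrite -expnD subnKC// ltnW.
  by rewrite [X in (_ <= 2 * X)%N]mulnC mulnCA leq_mul2l; apply/orP; right; exact: dlog_le2.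
have c2 : (2 ^ ks * (n1 * (2 ^ (J2 - ks)).-1) <= 2 * (n1 * n2))%N.
  have [h|h] := leqP ks J2; last by rewrite (eqP (ltnW h)) /= !muln0.
  apply: (@leq_trans (n1 * 2 ^ J2)).
    rewrite mulnCA leq_mul2l; apply/orP; right.
    apply: (@leq_trans (2 ^ ks * 2 ^ (J2 - ks))); first by rewrite leq_mul2l leq_pred orbT.
    by rewrite -expnD subnKC.
  by rewrite mulnCA leq_mul2l; apply/orP; right; exact: dlog_le2.
rewrite mulnDr; apply: (leq_trans (leq_add c1 c2)).
apply: (@leq_trans (4 * ((2 * 2 ^ ks * J) * n2))); last by rewrite leq_eqVlt; apply/orP; left; apply/eqP; ring.
by rewrite -mulnDl leq_mul2l /= leq_mul2r ks_lo orbT.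
Qed.

Lemma sum_pow2 (k : nat) : \sum_(i < k) (2 : R) ^+ i = 2 ^+ k - 1.
Proof.
elim: k => [|k IH]; first by rewrite big_ord0 expr0 subrr.
by rewrite big_ord_recr /= IH exprS; ring.
Qed.

Lemma dyadic_chain (F G : nat -> nat -> R) (W : E -> R) (a1 a2 d1 d2 : R) :
  0 <= a1 -> 0 <= a2 -> 0 <= d1 -> bimonotone F -> bimonotone G ->
  net_good (n1 ^ 2) (10 * n1) a1 a2 W -> net_good (n1 ^ 2) (8 * n2 * J) d1 d2 W ->
  fip W (fun e => F e.1 e.2 - G e.1 e.2) <=
    a1 * Num.sqrt (4 * (fnorm2 (fun e : E => F e.1 e.2 - G e.1 e.2) + 200 * (J%:R ^+ 2 * n2%:R)))
    + 5 * a2 + 2 * J%:R * (a1 * Num.sqrt (8 * (J%:R * n2%:R)))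
    + 2 * (d1 * Num.sqrt (8 * n2 * J)%:R + d2).
Proof.
move=> a10 a20 d10 bF bG net1 net2.
have N0 : 0 < n1%:R :> R by rewrite ltr0n.
have j0 : 0 < J%:R :> R by rewrite ltr0n.
have j1 : 1 <= J%:R :> R by rewrite ler1n.
have m1 : 1 <= n2%:R :> R by rewrite ler1n.
have nj : J%:R <= n1%:R :> R by rewrite ler_nat; exact: dlog_id.
have p2 k : 0 < (2 : R) ^+ k by rewrite exprn_gt0.
(* With these truncation levels each level before the last has at most of order n1 / J large
   increments, hence of order n1 in all, the entropy already paid for the permutations. At the last
   level [et = 1] excludes large increments. *)
pose et k : R := if (k < ks)%N then 2 ^+ k * J%:R / n1%:R else 1.
pose s k := if (k < ks)%N then (Num.truncn ((Yn k)%:R / et k)).+1 else (8 * n2 * J)%N.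
pose g k := if (k < ks)%N then (8 * n1 %/ J).+1 else 0%N.
pose c1 k := if (k < ks)%N then a1 else d1.
pose c2 k := if (k < ks)%N then a2 else d2.
have et0 k : 0 < et k.
  by rewrite /et; case: ifP => // _; rewrite divr_gt0// mulr_gt0.
have etE k : (k < ks)%N -> et k = 2 ^+ k * J%:R / n1%:R by rewrite /et => ->.
have ksup : (2 : R) ^+ ks * J%:R / n1%:R <= 2.
  by rewrite ler_pdivrMr// -natrX -natrM -natrM ler_nat.
have et1 k : (k < ks)%N -> et k <= 1.
  move=> h; rewrite etE// ler_pdivrMr// mul1r -natrX -natrM ler_nat.
  rewrite -(@leq_pmul2l 2)//; apply: leq_trans ks_up; rewrite mulnA -expnS leq_mul2r.
  by rewrite leq_exp2l// h orbT.
have sum_et k : (k <= ks)%N -> \sum_(i < k) et i <= 2 ^+ k * J%:R / n1%:R.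
  move=> h; rewrite (eq_bigr (fun i : 'I_k => 2 ^+ i * (J%:R / n1%:R))); last first.
    by move=> i _; rewrite etE ?mulrA// (leq_trans (ltn_ord i)).
  rewrite -mulr_suml sum_pow2 -mulrA; apply: ler_wpM2r; first by rewrite ltW// divr_gt0.
  by rewrite gerBl.
(* At the last level the earlier truncation levels sum to at most 2^ks J / n1 <= 2, and the last one
   is 1, which gives exactly 3. *)
have geom k : (k < ks.+1)%N -> \sum_(i < k.+1) et i <= 3 * et k.
  move=> h; rewrite big_ord_recr /=; move: h; rewrite ltnS leq_eqVlt => /orP[/eqP->|h].
    by have := sum_et ks (leqnn _); rewrite /et ltnn; move: ksup; lra.
  by have := sum_et k (ltnW h); rewrite -etE//; have := et0 k; lra.
have Yle k : (k < ks.+1)%N -> @gridY R n1 n2 (lev J) (lev J2) k <= (s k)%:R * et k.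
  rewrite gridY_lev ltnS leq_eqVlt /s => /orP[/eqP->|h].
    by rewrite /et ltnn mulr1 ler_nat Yn_last.
  rewrite h -ler_pdivrMr//.
  have /andP[_ /ltW] : (Num.truncn ((Yn k)%:R / et k))%:R <= (Yn k)%:R / et k
     < (Num.truncn ((Yn k)%:R / et k)).+1%:R.
    by apply: truncn_itv; rewrite divr_ge0// ltW.
  by [].
have gge k : (k < ks.+1)%N -> et k < 1 -> 2 * @gridY R n1 n2 (lev J) (lev J2) k <= (g k)%:R * et k.
  rewrite gridY_lev ltnS leq_eqVlt /g => /orP[/eqP->|h _]; first by rewrite /et ltnn ltxx.
  rewrite h etE//.
  apply: (@le_trans _ _ (8 * 2 ^+ k)).
    by rewrite -natrX -!natrM ler_nat (_ : 8 = 2 * 4)%N// -mulnA leq_mul2l Yn_le.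
  rewrite [X in _ <= X](_ : _ = 2 ^+ k * ((8 * n1 %/ J).+1%:R * J%:R / n1%:R)); last by ring.
  rewrite mulrC; apply: ler_wpM2l; first exact: ltW.
  rewrite ler_pdivlMr// -!natrM ler_nat ltnW//; exact: ltn_ceil.
have sE k : (k < ks)%N -> (s k)%:R * et k <= (Yn k)%:R + et k.
  move=> h; rewrite /s h -natr1 mulrDl mul1r lerD2r -ler_pdivlMr//.
  have /andP[] : (Num.truncn ((Yn k)%:R / et k))%:R <= (Yn k)%:R / et k
     < (Num.truncn ((Yn k)%:R / et k)).+1%:R.
    by apply: truncn_itv; rewrite divr_ge0// ltW.
  by [].
have s_le k : (k < ks)%N -> (s k <= 10 * n1)%N.
  move=> h; rewrite -(ler_nat R) -(ler_pM2r (et0 k)); apply: (le_trans (sE k h)).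
  have : (Yn k)%:R <= 4 * n1%:R * et k.
    rewrite etE// mulrA ler_pdivlMr// mulrAC; apply: ler_wpM2r; first exact: ltW.
    apply: (@le_trans _ _ (4 * 2 ^+ k)); first by rewrite -natrX -natrM ler_nat Yn_le.
    by have := ler_wpM2l (ltW (p2 k)) j1; rewrite mulr1; lra.
  have : et k <= n1%:R * et k by rewrite ler_peMl ?(ltW (et0 k))// ler1n.
  by have := et0 k; rewrite natrM; lra.
have nets k : (k < ks.+1)%N -> net_good (n1 ^ 2) (s k) (c1 k) (c2 k) W.
  move=> _; rewrite /c1 /c2; case: ltnP => h; last by rewrite /s ltnNge h.
  by move=> rs hs; apply: net1; apply: leq_trans hs (s_le k h).
have c10 k : (k < ks.+1)%N -> 0 <= c1 k by move=> _; rewrite /c1; case: ifP.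
(* One coarsest cell, 8 n1 large increments, and n1 more for rounding the quotient up at each
   level. *)
have hm : (nbase n1 (lev J 0) * nbase n2 (lev J2 0) + \sum_(k < ks.+1) g k <= 10 * n1)%N.
  have h1 : (nbase n1 (lev J 0) * nbase n2 (lev J2 0) <= 1)%N.
    by rewrite -[X in (_ <= X)%N]muln1 leq_mul//; rewrite /lev /= (@nbase_pow _ _ 0)// ltnW// dlog_lt.
  rewrite big_ord_recr /= {2}/g ltnn addn0 (eq_bigr (fun=> (8 * n1 %/ J).+1)); last first.
    by move=> k _; rewrite /g ltn_ord.
  rewrite sum_nat_const card_ord.
  have h2 : (ks * (8 * n1 %/ J).+1 <= 8 * n1 + n1)%N.
    apply: (@leq_trans (J * (8 * n1 %/ J).+1)); first by rewrite leq_mul2r (ltnW ksJ) orbT.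
    rewrite mulnS addnC; apply: leq_add; last exact: dlog_id.
    by rewrite mulnC leq_divM.
  apply: leq_trans (leq_add h1 h2) _.
  by rewrite (_ : 10 = 1 + 8 + 1)%N// !mulnDl mul1n -addnA leq_add2r.
have KQ : (ks.+1 < n1 ^ 2)%N.
  apply: (@leq_ltn_trans n1); first by apply: leq_trans ksJ _; exact: dlog_id.
  by rewrite -mulnn ltn_Pmulr.
have Q0 : (0 < n1 ^ 2)%N by rewrite expn_gt0 n1_gt0.
have H := @grid_chaining R n1 n2 ks.+1 (lev J) (lev J2) (lev_gt0 J) (lev_gt0 J2)
  (fun k _ => lev_dvd J k) (fun k _ => lev_dvd J2 k) (lev_end J) (lev_end J2)
  (n1 ^ 2) et s g F G W (10 * n1) a1 a2 c1 c2 Q0 (fun k _ => et0 k) geom Yle gge bF bG a10 c10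
  net1 nets hm KQ.
apply: (le_trans H).
have area k : (k < ks)%N -> et k * ((lev J k.+1 * lev J2 k.+1)%:R * (Yn k)%:R) <= 6 * (J%:R * n2%:R).
  move=> h; have : ((2 ^ k * (lev J k.+1 * lev J2 k.+1 * Yn k))%:R : R) <= (6 * (n1 * n2))%:R.
    by rewrite ler_nat Yn_area.
  rewrite natrM natrX (natrM _ 6) (natrM _ n1) [X in _ * X <= _]natrM etE//.
  set Z := _%:R * _%:R => hZ.
  rewrite mulrAC ler_pdivrMr//.
  have := ler_wpM2r (ltW j0) hZ; lra.
have j2 : J%:R * n2%:R <= J%:R ^+ 2 * n2%:R :> R.
  by apply: ler_wpM2r => //; rewrite expr2 ler_peMl// ltW.
have S_le : \sum_(k < ks.+1) et k * ((lev J k.+1 * lev J2 k.+1)%:R * @gridY R n1 n2 (lev J) (lev J2) k)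
    <= 14 * (J%:R ^+ 2 * n2%:R).
  rewrite big_ord_recr /= gridY_lev !lev_end mul1n mul1r {2}/et ltnn mul1r.
  have h1 : (Yn ks)%:R <= 8 * (J%:R * n2%:R) :> R.
    by rewrite -!natrM ler_nat [X in (_ <= 8 * X)%N]mulnC mulnA Yn_last.
  have h2 : \sum_(k < ks) et k * ((lev J k.+1 * lev J2 k.+1)%:R * @gridY R n1 n2 (lev J) (lev J2) k)
      <= \sum_(k < ks) 6 * (J%:R * n2%:R).
    by apply: ler_sum => k _; rewrite gridY_lev; apply: area.
  have h3 : \sum_(k < ks) 6 * (J%:R * n2%:R) <= 6 * (J%:R ^+ 2 * n2%:R) :> R.
    rewrite sumr_const card_ord -[X in X <= _]mulr_natl mulrCA; apply: ler_wpM2l => //.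
    rewrite expr2 -mulrA; apply: ler_wpM2r; first by rewrite mulr_ge0// ltW.
    by rewrite ler_nat ltnW.
  by move: h1 h2 h3 j2; lra.
have tiny : (n1 * n2)%:R * (ks.+2%:R / (n1 ^ 2)%:R) ^+ 2 <= 4 * (J%:R ^+ 2 * n2%:R) :> R.
  have h1 : ks.+2%:R / (n1 ^ 2)%:R <= 2 / n1%:R :> R.
    rewrite natrX expr2 invfM mulrA; apply: ler_wpM2r; first by rewrite invr_ge0 ltW.
    rewrite ler_pdivrMr// -natrM ler_nat.
    rewrite mul2n -addnn -addn1; apply: leq_add => //.
    by apply: leq_trans ksJ _; exact: dlog_id.
  have h2 : (ks.+2%:R / (n1 ^ 2)%:R) ^+ 2 <= (2 / n1%:R) ^+ 2 :> R.
    by rewrite lerXn2r// nnegrE divr_ge0.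
  apply: (@le_trans _ _ ((n1 * n2)%:R * (2 / n1%:R) ^+ 2)); first exact: ler_wpM2l.
  have -> : (n1 * n2)%:R * (2 / n1%:R) ^+ 2 = 4 * (n2%:R / n1%:R) :> R.
    by rewrite natrM; field; rewrite gt_eqF.
  apply: ler_wpM2l => //; apply: (@le_trans _ _ 1).
    by rewrite ler_pdivrMr// mul1r ler_nat.
  by rewrite -natrX -natrM ler1n muln_gt0 n2_gt0 expn_gt0.
(* The constant 200 covers 12 * 14 from the levels and 4 from the rounding. *)
have T1 : a1 * Num.sqrt (4 * (fnorm2 (fun e : E => F e.1 e.2 - G e.1 e.2)
     + 12 * \sum_(k < ks.+1) et k * ((lev J k.+1 * lev J2 k.+1)%:R * @gridY R n1 n2 (lev J) (lev J2) k)
     + (n1 * n2)%:R * (ks.+2%:R / (n1 ^ 2)%:R) ^+ 2))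
   <= a1 * Num.sqrt (4 * (fnorm2 (fun e : E => F e.1 e.2 - G e.1 e.2) + 200 * (J%:R ^+ 2 * n2%:R))).
  apply: ler_wpM2l => //; apply: ler_wsqrtr; apply: ler_wpM2l => //.
  have q0 : 0 <= J%:R ^+ 2 * n2%:R :> R by rewrite mulr_ge0.
  by move: S_le tiny q0; lra.
have T2 : \sum_(k < ks.+1) 2 * et k * (c1 k * Num.sqrt ((s k)%:R * (lev J k.+1 * lev J2 k.+1)%:R) + c2 k)
   <= 4 * a2 + 2 * J%:R * (a1 * Num.sqrt (8 * (J%:R * n2%:R)))
      + 2 * (d1 * Num.sqrt (8 * n2 * J)%:R + d2).
  rewrite big_ord_recr /= {2}/et {2}/c1 {2}/c2 {2}/s !ltnn !lev_end muln1 !mulr1.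
  apply: lerD => //.
  apply: (@le_trans _ _ (\sum_(k < ks) (2 * (a1 * Num.sqrt (8 * (J%:R * n2%:R))) + 2 * a2 * et k))).
    apply: ler_sum => k _; have h := ltn_ord k; rewrite /c1 /c2 h.
    have -> : 2 * et k * (a1 * Num.sqrt ((s k)%:R * (lev J k.+1 * lev J2 k.+1)%:R) + a2)
       = 2 * (a1 * (et k * Num.sqrt ((s k)%:R * (lev J k.+1 * lev J2 k.+1)%:R))) + 2 * a2 * et k.
      by ring.
    rewrite lerD2r; apply: ler_wpM2l => //; apply: ler_wpM2l => //.
    rewrite -{1}(ger0_norm (ltW (et0 k))) -sqrtr_sqr -sqrtrM ?sqr_ge0//; apply: ler_wsqrtr.
    set al := (lev J k.+1 * lev J2 k.+1)%:R.
    have al0 : 0 <= al :> R by [].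
    apply: (@le_trans _ _ (et k * (al * (Yn k)%:R) + et k ^+ 2 * al)).
      have := ler_wpM2r (mulr_ge0 (ltW (et0 k)) al0) (sE k h); rewrite expr2; lra.
    have h1 := area k h.
    have h2 : et k ^+ 2 * al <= 2 * (J%:R * n2%:R).
      rewrite /al natrM expr2 mulrACA.
      have -> : 2 * (J%:R * n2%:R) = J%:R * (2 * n2%:R) :> R by ring.
      apply: ler_pM; rewrite ?mulr_ge0 ?(ltW (et0 k))//.
        rewrite etE// mulrAC ler_pdivrMr// mulrAC mulrC; apply: ler_wpM2l; first exact: ltW.
        by rewrite -natrX -natrM ler_nat lev1_le.
      rewrite -[2 * _]mul1r; apply: ler_pM; rewrite ?(ltW (et0 k)) ?et1//.
      by rewrite -natrM ler_nat lev2_le.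
    by move: h1 h2; rewrite -/al; lra.
  rewrite big_split /= addrC; apply: lerD.
    rewrite -mulr_sumr; have := ler_wpM2l a20 (le_trans (sum_et ks (leqnn _)) ksup); lra.
  rewrite sumr_const card_ord -[X in X <= _]mulr_natl.
  set Z := a1 * _; have Z0 : 0 <= Z by rewrite mulr_ge0// sqrtr_ge0.
  have : ks%:R * Z <= J%:R * Z by apply: ler_wpM2r => //; rewrite ler_nat ltnW.
  by lra.
by move: T1 T2; lra.
Qed.

End DyadicChain.

(** * The chain of slices of columns *)

Section SliceChain.
Context {R : realType} (n1 n2 M : nat).
Hypothesis n1_gt0 : (0 < n1)%N.
Hypothesis n2_gt0 : (0 < n2)%N.
Hypothesis M_gt0 : (0 < M)%N.
Hypothesis M_le : (M <= n1)%N.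
Hypothesis M_big : (16 * n1 <= M ^ 4)%N.
Local Notation E := ('I_n1 * 'I_n2)%type.

Let J := trunc_log 2 (n1 %/ M).
Let K := (J %/ 3).+1.

Lemma slice_lo : (2 ^ J * M <= n1)%N.
Proof.
rewrite -leq_divRL//; have q0 : (0 < n1 %/ M)%N by rewrite divn_gt0.
by have /andP[] := @trunc_log_bounds 2 _ isT q0.
Qed.

Lemma slice_up : (n1 < 2 ^ J.+1 * M)%N.
Proof.
rewrite -ltn_divLR//; have q0 : (0 < n1 %/ M)%N by rewrite divn_gt0.
by have /andP[] := @trunc_log_bounds 2 _ isT q0.
Qed.

(** Since 8^K <= 8 * 2^J, [slice_lo] and [M_big] give 8^K <= M^3. This keeps the truncation levels
    2^k / M at most 1. *)
Lemma slice_levels : (2 ^ K <= M)%N.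
Proof.
rewrite -(@leq_exp2r _ _ 3)// -expnM /K mulSn expnD.
have h : (2 ^ (J %/ 3 * 3) <= 2 ^ J)%N by rewrite leq_exp2l// leq_divM.
have h2 : (2 ^ 3 * 2 ^ J * M <= M ^ 4)%N.
  by apply: leq_trans M_big; rewrite -mulnA leq_mul// slice_lo.
rewrite -(@leq_pmul2r M)// -expnSr; apply: leq_trans h2.
by rewrite leq_mul2r leq_mul2l h !orbT.
Qed.

Definition slev k := (2 ^ (J - 3 * k))%N.

Lemma slev_dvd k : (slev k.+1 %| slev k)%N.
Proof. by rewrite dvdn_exp2l// leq_sub2l// leq_mul2l leqnSn orbT. Qed.

Lemma slev_ratio k : (slev k %/ slev k.+1 <= 8)%N.
Proof.
rewrite -[X in (_ <= X)%N](@mulnK _ (slev k.+1)) ?expn_gt0//; apply: leq_div2r.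
rewrite /slev (_ : 8 = 2 ^ 3)%N// -expnD leq_exp2l// mulnS.
by rewrite -leq_subLR -subnDA [(3 * k + 3)%N]addnC.
Qed.

Lemma slev_pow k : (k < K)%N -> (8 ^ k * slev k.+1 <= 2 ^ J)%N.
Proof.
rewrite /K ltnS => h; rewrite (_ : 8 = 2 ^ 3)%N// -expnM -expnD leq_exp2l// mulnS.
rewrite [(3 + _)%N]addnC subnDA.
have h3 : (3 * k <= J)%N by rewrite mulnC -leq_divRL.
by rewrite -{2}(subnKC h3) leq_add2l leq_subr.
Qed.

Lemma slev_end : slev K = 1%N.
Proof.
rewrite /slev /K; have -> : (J - 3 * (J %/ 3).+1)%N = 0%N; last by [].
by apply/eqP; rewrite subn_eq0 mulnC ltnW// ltn_ceil.
Qed.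

Lemma sum_halves (k : nat) : (\sum_(i < k) M %/ 2 ^ i <= 2 * M)%N.
Proof.
suff : (\sum_(i < k) M %/ 2 ^ i + 2 * (M %/ 2 ^ k) <= 2 * M)%N.
  by apply: leq_trans; rewrite leq_addr.
elim: k => [|k IH]; first by rewrite big_ord0 expn0 divn1.
rewrite big_ord_recr /=; apply: leq_trans IH; rewrite -addnA leq_add2l.
rewrite [X in (_ <= X)%N]mul2n -addnn leq_add2l expnSr divnMA mulnC.
exact: leq_divM.
Qed.

Lemma sum_half_pow (k : nat) : \sum_(i < k) (2^-1 : R) ^+ i <= 2.
Proof.
suff -> : \sum_(i < k) (2^-1 : R) ^+ i = 2 - 2 * 2^-1 ^+ k.
  by have : 0 <= (2^-1 : R) ^+ k by [rewrite exprn_ge0// invr_ge0]; lra.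
elim: k => [|k IH]; first by rewrite big_ord0 expr0; ring.
by rewrite big_ord_recr /= IH exprS; field.
Qed.

(* Columns are never merged; rows are refined by a factor 8 while the truncation level only
   doubles, so that the contributions of the levels decay geometrically. *)
Lemma slice_chain (F G : nat -> nat -> R) (W : E -> R) (a1 a2 B : R) :
  B = (n1 * n2)%:R / M%:R ^+ 2 -> 0 <= a1 -> 0 <= a2 -> bimonotone F -> bimonotone G ->
  net_good (n1 ^ 2) (45 * (n2 * M)) a1 a2 W ->
  fip W (fun e => F e.1 e.2 - G e.1 e.2) <=
    a1 * Num.sqrt (4 * (fnorm2 (fun e : E => F e.1 e.2 - G e.1 e.2) + 200 * B))
    + 3 * a2 + 4 * (a1 * Num.sqrt (14 * B)).
Proof.
move=> hB a10 a20 bF bG net.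
have M0 : 0 < M%:R :> R by rewrite ltr0n.
have N0 : 0 < n1%:R :> R by rewrite ltr0n.
have B0 : 0 <= B by rewrite hB divr_ge0// exprn_ge0.
have p2 k : 0 < (2 : R) ^+ k by rewrite exprn_gt0.
have k2M k : (k < K)%N -> (2 ^ k <= M)%N.
  by move=> h; apply: leq_trans slice_levels; rewrite leq_exp2l// ltnW.
have KM : (K < M)%N by apply: leq_trans slice_levels; rewrite ltn_expl.
pose et k : R := 2 ^+ k / M%:R.
(* [gridY] is at most 7 n2, as each of the n2 columns is refined at most eightfold; [s k] is this
   divided by [et k], with the quotient of M by 2^k rounded up. *)
pose s k := (7 * n2 * (M %/ 2 ^ k).+1)%N.
pose g k := (2 * s k)%N.
have et0 k : 0 < et k by rewrite divr_gt0.
have sum_et k : \sum_(i < k) et i <= 2 ^+ k / M%:R.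
  by rewrite -mulr_suml sum_pow2; apply: ler_wpM2r; [rewrite invr_ge0 ltW|rewrite gerBl].
have geom k : (k < K)%N -> \sum_(i < k.+1) et i <= 3 * et k.
  by move=> _; rewrite big_ord_recr /=; have := sum_et k; rewrite -/(et k); have := et0 k; lra.
have Y7 k : @gridY R n1 n2 slev (fun=> 1%N) k <= 7 * n2%:R.
  rewrite /gridY divnn /= mulr0 addr0 nbase1// mulrC; apply: ler_wpM2r => //.
  by rewrite ler_nat; move: (slev_ratio k); case: (_ %/ _)%N.
have sE k : 7 * n2%:R <= (s k)%:R * et k.
  rewrite /s natrM natrM -mulrA -[X in X <= _]mulr1; apply: ler_wpM2l; first by rewrite mulr_ge0.
  rewrite /et mulrA ler_pdivlMr// mul1r -natrX -natrM ler_nat ltnW// ltn_ceil//.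
  by rewrite expn_gt0.
have Yle k : (k < K)%N -> @gridY R n1 n2 slev (fun=> 1%N) k <= (s k)%:R * et k.
  by move=> _; exact: le_trans (Y7 k) (sE k).
have gge k : (k < K)%N -> et k < 1 -> 2 * @gridY R n1 n2 slev (fun=> 1%N) k <= (g k)%:R * et k.
  by move=> _ _; rewrite /g natrM -mulrA; apply: ler_wpM2l => //; exact: le_trans (Y7 k) (sE k).
have s_le k : (s k <= 45 * (n2 * M))%N.
  apply: (@leq_trans (7 * n2 * (2 * M))).
    rewrite leq_mul2l; apply/orP; right; rewrite mul2n -addnn -addn1.
    by apply: leq_add => //; exact: leq_div.
  by rewrite mulnACA leq_mul2r orbT.
(* In units of n2 M: at most 2 for the coarsest slices and 14 * (2 + 1) = 42 for the large
   increments, where the halves of M sum to 2 M and rounding costs 1 for each of fewer than M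
   levels. *)
have hm : (nbase n1 (slev 0) * nbase n2 1 + \sum_(k < K) g k <= 45 * (n2 * M))%N.
  have h1 : (nbase n1 (slev 0) * nbase n2 1 <= 2 * (n2 * M))%N.
    rewrite nbase1// mulnCA mulnC leq_mul2l; apply/orP; right.
    rewrite /nbase /slev muln0 subn0 ltn_divLR ?expn_gt0//.
    apply: (leq_ltn_trans (leq_pred _)); apply: leq_trans slice_up _.
    by rewrite expnS mulnAC.
  have h2 : (\sum_(k < K) g k <= 42 * (n2 * M))%N.
    rewrite /g /s (eq_bigr (fun k : 'I_K => 14 * n2 * (M %/ 2 ^ k + 1))%N); last first.
      by move=> k _; rewrite !mulnA addn1.
    rewrite -big_distrr /= big_split /= sum1_card card_ord.
    apply: (@leq_trans (14 * n2 * (3 * M))); last by rewrite mulnACA.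
    rewrite leq_mul2l; apply/orP; right; rewrite (_ : 3 = 2 + 1)%N// mulnDl mul1n.
    by apply: leq_add; [exact: sum_halves|exact: ltnW].
  apply: leq_trans (leq_add h1 h2) _.
  by rewrite -mulnDl leq_mul2r orbT.
have KQ : (K < n1 ^ 2)%N.
  apply: (leq_trans KM); apply: (leq_trans M_le).
  by rewrite -mulnn leq_pmulr.
have Q0 : (0 < n1 ^ 2)%N by rewrite expn_gt0 n1_gt0.
have l0 k : (0 < slev k)%N by rewrite expn_gt0.
have nets k : (k < K)%N -> net_good (n1 ^ 2) (s k) a1 a2 W.
  by move=> _ rs hs; apply: net; apply: leq_trans hs (s_le k).
have H := @grid_chaining R n1 n2 K slev (fun=> 1%N) l0 (fun=> isT)
  (fun k _ => slev_dvd k) (fun k _ => isT) slev_end erefl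
  (n1 ^ 2) et s g F G W (45 * (n2 * M)) a1 a2 (fun=> a1) (fun=> a2) Q0 (fun k _ => et0 k) geom
  Yle gge bF bG a10 (fun _ _ => a10) net nets hm KQ.
apply: (le_trans H) => {H}.
have h2 k : 0 <= (2^-1 : R) ^+ k by rewrite exprn_ge0// invr_ge0.
(* The row mesh is at most n1 / (8^k M); multiplied by 2^k / M and n2 it leaves B / 4^k. *)
have area k : (k < K)%N -> et k * (slev k.+1 * 1)%:R * n2%:R <= B * (2^-1 ^+ k) ^+ 2.
  move=> h; rewrite muln1.
  have h8 : (8 ^ k * slev k.+1 * M <= n1)%N.
    by apply: leq_trans slice_lo; rewrite leq_mul2r slev_pow// orbT.
  have e8 : (8 : R) ^+ k = (2 ^+ k) ^+ 3 by rewrite -exprM mulnC exprM; congr (_ ^+ k); ring.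
  have : (8 : R) ^+ k * (slev k.+1)%:R * M%:R <= n1%:R by rewrite -natrX -!natrM ler_nat.
  rewrite e8 /et hB natrM exprVn.
  move: (2 ^+ k) (p2 k) => u u0; move: (slev k.+1)%:R => v hv.
  rewrite [X in _ <= X](_ : _ = (n1%:R * n2%:R) / (M%:R ^+ 2 * u ^+ 2)); last first.
    by field; rewrite !gt_eqF.
  rewrite ler_pdivlMr ?mulr_gt0 ?exprn_gt0//.
  rewrite [X in X <= _](_ : _ = u ^+ 3 * v * M%:R * n2%:R); last by field; rewrite gt_eqF.
  exact: ler_wpM2r.
have half1 k : (2^-1 : R) ^+ k <= 1 by apply: exprn_ile1; rewrite ?invr_ge0//; lra.
have S_le : \sum_(k < K) et k * ((slev k.+1 * 1)%:R * @gridY R n1 n2 slev (fun=> 1%N) k) <= 14 * B.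
  apply: (@le_trans _ _ (\sum_(k < K) 7 * B * 2^-1 ^+ k)); last first.
    by rewrite -mulr_sumr; have := ler_wpM2l B0 (sum_half_pow K); lra.
  apply: ler_sum => k _.
  have q : et k * (slev k.+1 * 1)%:R * @gridY R n1 n2 slev (fun=> 1%N) k
     <= et k * (slev k.+1 * 1)%:R * (7 * n2%:R).
    by apply: ler_wpM2l => //; rewrite mulr_ge0// ltW.
  have q2 : B * (2^-1 ^+ k) ^+ 2 <= B * 2^-1 ^+ k.
    by apply: ler_wpM2l => //; rewrite expr2 ler_piMl.
  by have := area k (ltn_ord k); move: q q2; lra.
have tiny : (n1 * n2)%:R * (K.+1%:R / (n1 ^ 2)%:R) ^+ 2 <= B.
  rewrite hB; apply: ler_wpM2l => //; rewrite -exprVn lerXn2r ?nnegrE ?divr_ge0 ?invr_ge0//.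
  rewrite ler_pdivrMr ?ltr0n// mulrC ler_pdivlMr// -natrM ler_nat -mulnn.
  by apply: leq_mul => //; exact: leq_trans KM M_le.
have T1 : a1 * Num.sqrt (4 * (fnorm2 (fun e : E => F e.1 e.2 - G e.1 e.2)
     + 12 * \sum_(k < K) et k * ((slev k.+1 * 1)%:R * @gridY R n1 n2 slev (fun=> 1%N) k)
     + (n1 * n2)%:R * (K.+1%:R / (n1 ^ 2)%:R) ^+ 2))
   <= a1 * Num.sqrt (4 * (fnorm2 (fun e : E => F e.1 e.2 - G e.1 e.2) + 200 * B)).
  apply: ler_wpM2l => //; apply: ler_wsqrtr; apply: ler_wpM2l => //.
  by move: S_le tiny B0; lra.
have T2 : \sum_(k < K) 2 * et k * (a1 * Num.sqrt ((s k)%:R * (slev k.+1 * 1)%:R) + a2)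
   <= 2 * a2 + 4 * (a1 * Num.sqrt (14 * B)).
  apply: (@le_trans _ _ (\sum_(k < K) (2 * (a1 * Num.sqrt (14 * B)) * 2^-1 ^+ k + 2 * a2 * et k))).
    apply: ler_sum => k _; have h := ltn_ord k.
    have -> : 2 * et k * (a1 * Num.sqrt ((s k)%:R * (slev k.+1 * 1)%:R) + a2)
       = 2 * (a1 * (et k * Num.sqrt ((s k)%:R * (slev k.+1 * 1)%:R))) + 2 * a2 * et k by ring.
    rewrite lerD2r -[X in _ <= X]mulrA -[X in _ <= 2 * X]mulrA; apply: ler_wpM2l => //; apply: ler_wpM2l => //.
    rewrite -(ger0_norm (ltW (et0 k))) -(ger0_norm (h2 k)) -!sqrtr_sqr.
    rewrite -sqrtrM ?sqr_ge0// -sqrtrM ?mulr_ge0//; apply: ler_wsqrtr.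
    have s14 : (s k)%:R * et k <= 14 * n2%:R.
      rewrite /et mulrA ler_pdivrMr// -natrX -!natrM ler_nat /s.
      have : ((M %/ 2 ^ k).+1 * 2 ^ k <= 2 * M)%N.
        by rewrite mulSn mul2n -addnn; apply: leq_add; [exact: k2M|exact: leq_divM].
      move=> q; apply: (@leq_trans (7 * n2 * (2 * M))); first by rewrite -mulnA leq_mul2l q orbT.
      by rewrite mulnACA -[X in (_ <= X)%N]mulnA.
    have := ler_wpM2r (mulr_ge0 (ltW (et0 k)) (ler0n R (slev k.+1 * 1))) s14.
    by have := area k h; rewrite expr2; lra.
  rewrite big_split /= addrC; apply: lerD; rewrite -mulr_sumr.
    rewrite -[X in _ <= X]mulr1; apply: ler_wpM2l; first by rewrite mulr_ge0.
    apply: (le_trans (sum_et K)); rewrite ler_pdivrMr// mul1r -natrX ler_nat.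
    exact: slice_levels.
  set Z := a1 * _; have Z0 : 0 <= Z by rewrite mulr_ge0// sqrtr_ge0.
  by have := ler_wpM2l Z0 (sum_half_pow K); lra.
by move: T1 T2; lra.
Qed.

End SliceChain.

(** * Least squares *)

Section LeastSquares.
Context {R : realType} (n1 n2 : nat).
Local Notation E := ('I_n1 * 'I_n2)%type.

(** Clamping the indices extends the matrix to all naturals, where indices can be rounded and
    shifted freely; an empty matrix is extended by 0. *)
Lemma BISO_extension (B : 'M[R]_(n1, n2)) : is_BISO B ->
  exists F : nat -> nat -> R, bimonotone F /\
    ((0 < n1)%N -> (0 < n2)%N -> forall i j, B i j = F i j).
Proof.
case: n1 n2 B => [|k1] [|k2] B [B01 [Bc Br]]; try by exists (fun _ _ => 0); split => //;
  split=> *; rewrite ?lexx ?ler01.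
exists (fun i j => B (inord (minn i k1)) (inord (minn j k2))); split; last first.
  move=> _ _ i j; have hi : (i <= k1)%N by rewrite -ltnS. have hj : (j <= k2)%N by rewrite -ltnS.
  by rewrite (minn_idPl hi) (minn_idPl hj) !inord_val.
split=> // i i' j j' ii jj; apply: (@le_trans _ _ (B (inord (minn i k1)) (inord (minn j' k2)))).
  by apply: Bc; rewrite !inordK ?ltnS ?geq_minr// leq_min geq_minr andbT (leq_trans (geq_minl _ _)).
by apply: Br; rewrite !inordK ?ltnS ?geq_minr// leq_min geq_minr andbT (leq_trans (geq_minl _ _)).
Qed.

(** Twice the optimality inequality is used, because half of the squared distance is spent on
    absorbing the cross term with [Ms - Mt]; hence the factors 4. *)
Lemma least_squares_basic (Y Ms Mh Mt : 'M[R]_(n1, n2)) : frob2 (Y - Mh) <= frob2 (Y - Mt) ->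
  frob2 (Mh - Mt) <= 4 * matip (Y - Ms) (Mh - Mt) + 4 * frob2 (Ms - Mt).
Proof.
move=> h; have : frob2 (Mh - Mt) <= 4 * matip (Y - Ms) (Mh - Mt) + 4 * frob2 (Ms - Mt)
    + 2 * (frob2 (Y - Mh) - frob2 (Y - Mt)).
  rewrite /frob2 /matip -sumrB !mulr_sumr -!big_split /=; apply: ler_sum => i _.
  rewrite -sumrB !mulr_sumr -!big_split /=; apply: ler_sum => j _; rewrite !mxE.
  have := sqr_ge0 ((Mh i j - Mt i j) - 2 * (Ms i j - Mt i j)); lra.
by move: h; lra.
Qed.

Lemma frob2_triangle (Ms Mh Mt : 'M[R]_(n1, n2)) :
  frob2 (Mh - Ms) <= 2 * frob2 (Mh - Mt) + 2 * frob2 (Ms - Mt).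
Proof.
rewrite /frob2 !mulr_sumr -!big_split /=; apply: ler_sum => i _.
rewrite !mulr_sumr -!big_split /=; apply: ler_sum => j _; rewrite !mxE.
have := sqr_ge0 ((Mh i j - Mt i j) + (Ms i j - Mt i j)); lra.
Qed.

Lemma matip_le_norms (W D : 'M[R]_(n1, n2)) : 4 * matip W D <= 8 * frob2 W + 2^-1 * frob2 D.
Proof.
rewrite /frob2 /matip !mulr_sumr -!big_split /=; apply: ler_sum => i _.
rewrite !mulr_sumr -!big_split /=; apply: ler_sum => j _.
have := sqr_ge0 (4 * W i j - D i j); lra.
Qed.

Lemma reindex_perms (pi : 'S_n1) (sg : 'S_n2) (f : 'I_n1 -> 'I_n2 -> R) :
  \sum_i \sum_j f (pi i) (sg j) = \sum_i \sum_j f i j.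
Proof.
rewrite [RHS](reindex_inj (@perm_inj _ pi)) /=; apply: eq_bigr => i _.
by rewrite [RHS](reindex_inj (@perm_inj _ sg)).
Qed.

(** The permutations are moved onto the noise, so that chaining compares two bimonotone functions on
    one fixed grid. *)
Lemma matip_perm (W B1 B0 : 'M[R]_(n1, n2)) (F G : nat -> nat -> R) (pi : 'S_n1) (sg : 'S_n2) :
  (forall i j, B1 i j = F i j) -> (forall i j, B0 i j = G i j) ->
  matip W (Defs.permM B1 pi sg - Defs.permM B0 pi sg)
  = fip (fun e : E => W ((pi^-1)%g e.1) ((sg^-1)%g e.2)) (fun e => F e.1 e.2 - G e.1 e.2).
Proof.
move=> hF hG; rewrite /matip /fip.
rewrite -(pair_big predT predT (fun i j => W ((pi^-1)%g i) ((sg^-1)%g j) * (F i j - G i j))) /=.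
rewrite -[RHS](reindex_perms pi sg); apply: eq_bigr => i _; apply: eq_bigr => j _.
by rewrite !permK !mxE hF hG.
Qed.

Lemma frob2_perm (B1 B0 : 'M[R]_(n1, n2)) (F G : nat -> nat -> R) (pi : 'S_n1) (sg : 'S_n2) :
  (forall i j, B1 i j = F i j) -> (forall i j, B0 i j = G i j) ->
  frob2 (Defs.permM B1 pi sg - Defs.permM B0 pi sg) = fnorm2 (fun e : E => F e.1 e.2 - G e.1 e.2).
Proof.
move=> hF hG; rewrite /frob2 /fnorm2.
rewrite -(pair_big predT predT (fun (i : 'I_n1) (j : 'I_n2) => (F i j - G i j) ^+ 2)) /=.
rewrite -[RHS](reindex_perms pi sg); apply: eq_bigr => i _; apply: eq_bigr => j _.
by rewrite !mxE hF hG.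
Qed.

End LeastSquares.

(** * Numerical inequalities for the rates *)

Section Numerics.
Context {R : realType}.
Implicit Types (a b q r t x y z l h : R).

Lemma absorb_sqrt t2 a r q b : 0 <= t2 -> 0 <= a -> 0 <= r ->
  t2 <= 4 * (a * Num.sqrt (4 * (t2 + r)) + q) + 4 * b ->
  t2 <= 64 * a ^+ 2 + 16 * (a * Num.sqrt r) + 8 * q + 8 * b.
Proof.
move=> t0 a0 r0 h.
set s := Num.sqrt t2; set u := Num.sqrt r.
have s0 : 0 <= s by exact: sqrtr_ge0. have u0 : 0 <= u by exact: sqrtr_ge0.
have s2 : s ^+ 2 = t2 by rewrite sqr_sqrtr.
have u2 : u ^+ 2 = r by rewrite sqr_sqrtr.
have le1 : Num.sqrt (4 * (t2 + r)) <= 2 * (s + u).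
  have su : 0 <= 2 * (s + u) by rewrite mulr_ge0// addr_ge0.
  rewrite -[X in _ <= X](ger0_norm su) -sqrtr_sqr; apply: ler_wsqrtr.
  by have := mulr_ge0 s0 u0; rewrite -s2 -u2; lra.
have le2 : a * Num.sqrt (4 * (t2 + r)) <= a * (2 * (s + u)) by exact: ler_wpM2l.
have := sqr_ge0 (s - 8 * a); rewrite -/u.
have : t2 = s ^+ 2 by []. move: h le2; lra.
Qed.

Lemma sqrt_mul_le h r u : 0 <= h -> 0 <= u -> h * r <= u ^+ 2 -> Num.sqrt h * Num.sqrt r <= u.
Proof.
by move=> h0 u0 le; rewrite -sqrtrM// -[X in _ <= X](ger0_norm u0) -sqrtr_sqr; exact: ler_wsqrtr.
Qed.

Lemma sqrt_mul_le_half h r : 0 <= h -> 0 <= r -> 2 * (Num.sqrt h * Num.sqrt r) <= h + r.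
Proof.
move=> h0 r0; have := sqr_ge0 (Num.sqrt h - Num.sqrt r).
have := sqr_sqrtr h0; have := sqr_sqrtr r0; lra.
Qed.

(** [U] carries the rate 1 / sqrt N. Each product of square roots is a multiple of [U] because
    [J <= 4 * l], and [2^-1 <= l] lets lower powers of [l] be replaced by higher ones. *)
Lemma dyadic_numeric (m1 m2 J l N z h0 h1 t2 b2 : R) :
  1 <= m2 -> m2 <= m1 -> 2^-1 <= l -> 0 <= J -> J <= 4 * l -> 0 < N -> 1 <= z -> 0 <= t2 ->
  0 <= h0 -> 0 <= h1 ->
  h0 <= 134 * m1 * l * (m1 * m2 / N) -> h1 <= (14 * m1 + 96 * m2 * J) * l * (m1 * m2 / N) ->
  t2 <= 4 * (3 * z * Num.sqrt h0 * Num.sqrt (4 * (t2 + 200 * (J ^+ 2 * m2))) + (5 * (2 * z * h0)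
     + 2 * J * (3 * z * Num.sqrt h0 * Num.sqrt (8 * (J * m2)))
     + 2 * (3 * z * Num.sqrt h1 * Num.sqrt (8 * m2 * J) + 2 * z * h1))) + 4 * b2 ->
  t2 <= m1 * m2 * (10 * (100 * 100) * (z ^+ 2 * (m1 * l / N)) + 10 * (100 * 100) * (z * (l ^+ 2 / Num.sqrt N))
     + 10 * (100 * 100) * (z * (m2 * l ^+ 2 / N))) + 8 * b2.
Proof.
move=> m21 m12 l1 J0 Jl N0 z1 t0 h00 h10 hh0 hh1 H.
have z0 : 0 <= z by lra. have l0 : 0 <= l by lra.
have m10 : 0 <= m1 by lra. have m20 : 0 <= m2 by lra.
set q := m1 * m2 in hh0 hh1 *.
have q0 : 0 <= q by rewrite mulr_ge0.
set sN := Num.sqrt N; have sN0 : 0 < sN by rewrite sqrtr_gt0.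
have sN2 : sN ^+ 2 = N by rewrite sqr_sqrtr// ltW.
set D := q / N in hh0 hh1; have D0 : 0 <= D by rewrite divr_ge0// ltW.
set U := q * (l ^+ 2 / sN).
have U0 : 0 <= U by rewrite mulr_ge0// divr_ge0 ?exprn_ge0// ltW.
have U2 : U ^+ 2 = q * D * l ^+ 4.
  by rewrite /U /D -sN2; field; rewrite gt_eqF.
have l34 : l ^+ 3 <= 2 * l ^+ 4.
  rewrite [l ^+ 4]exprS mulrA; apply: ler_peMl; [exact: exprn_ge0|lra].
have qD0 : 0 <= q * D by rewrite mulr_ge0.
have J2 : J ^+ 2 <= 16 * l ^+ 2.
  by have := ler_pM J0 J0 Jl Jl; rewrite !expr2; lra.
have J3 : J ^+ 3 <= 64 * l ^+ 3.
  have := ler_pM (sqr_ge0 J) J0 J2 Jl; rewrite -exprSr => h; apply: (le_trans h).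
  by rewrite le_eqVlt; apply/orP; left; apply/eqP; ring.
have r0 : 0 <= 200 * (J ^+ 2 * m2).
  by apply: mulr_ge0; [exact: ler0n|apply: mulr_ge0; [exact: sqr_ge0|exact: m20]].
have P1 : Num.sqrt h0 * Num.sqrt (200 * (J ^+ 2 * m2)) <= 1000 * U.
  apply: sqrt_mul_le; [exact: h00|by move: U0; lra|].
  apply: (@le_trans _ _ (134 * m1 * l * D * (200 * (16 * l ^+ 2 * m2)))).
    apply: ler_pM; [exact: h00|exact: r0|exact: hh0|].
    by apply: ler_wpM2l; [lra|exact: ler_wpM2r].
  have -> : 134 * m1 * l * D * (200 * (16 * l ^+ 2 * m2)) = 134 * 3200 * (q * D * l ^+ 3).
    by rewrite /q; ring.
  have := ler_wpM2l qD0 l34; rewrite exprMn U2 => h.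
  have : 0 <= q * D * l ^+ 4 by rewrite mulr_ge0// exprn_ge0.
  by move: h; lra.
have P2 : J * (Num.sqrt h0 * Num.sqrt (8 * (J * m2))) <= 300 * U.
  have -> : J * (Num.sqrt h0 * Num.sqrt (8 * (J * m2))) = Num.sqrt h0 * Num.sqrt (8 * (J ^+ 3 * m2)).
    rewrite mulrCA; congr (_ * _).
    by rewrite -{1}(ger0_norm J0) -sqrtr_sqr -sqrtrM ?sqr_ge0//; congr Num.sqrt; ring.
  apply: sqrt_mul_le; [exact: h00|by move: U0; lra|].
  apply: (@le_trans _ _ (134 * m1 * l * D * (8 * (64 * l ^+ 3 * m2)))).
    apply: ler_pM; [exact: h00|by rewrite !mulr_ge0 ?exprn_ge0|exact: hh0|].
    by apply: ler_wpM2l; [lra|exact: ler_wpM2r].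
  have -> : 134 * m1 * l * D * (8 * (64 * l ^+ 3 * m2)) = 134 * 512 * (q * D * l ^+ 4).
    by rewrite /q; ring.
  have : 0 <= q * D * l ^+ 4 by rewrite mulr_ge0// exprn_ge0.
  by rewrite exprMn U2; lra.
have h1' : h1 <= 14 * m1 * l * D + 384 * m2 * l ^+ 2 * D.
  apply: (le_trans hh1).
  have := ler_wpM2l (mulr_ge0 (mulr_ge0 m20 l0) D0) Jl; lra.
have P3 : Num.sqrt h1 * Num.sqrt (8 * m2 * J) <= 200 * U.
  apply: sqrt_mul_le; [exact: h10|by move: U0; lra|].
  apply: (@le_trans _ _ (412 * m1 * l ^+ 2 * D * (8 * m2 * (4 * l)))).
    apply: ler_pM; [exact: h10|by rewrite !mulr_ge0| |].
      apply: (le_trans h1').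
      have e1 : m1 * l * D <= 2 * (m1 * l ^+ 2 * D).
        have := ler_wpM2l (mulr_ge0 (mulr_ge0 m10 l0) D0) l1; rewrite expr2; lra.
      have e2 : m2 * l ^+ 2 * D <= m1 * l ^+ 2 * D.
        by apply: ler_wpM2r => //; apply: ler_wpM2r => //; exact: sqr_ge0.
      by move: e1 e2; lra.
    by apply: ler_wpM2l; [rewrite mulr_ge0|].
  have -> : 412 * m1 * l ^+ 2 * D * (8 * m2 * (4 * l)) = 412 * 32 * (q * D * l ^+ 3).
    by rewrite /q; ring.
  have := ler_wpM2l qD0 l34; rewrite exprMn U2 => h.
  have : 0 <= q * D * l ^+ 4 by rewrite mulr_ge0// exprn_ge0.
  by move: h; lra.
have a0 : 0 <= 3 * z * Num.sqrt h0.
  by apply: mulr_ge0; [apply: mulr_ge0; [exact: ler0n|exact: z0]|exact: sqrtr_ge0].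
have := absorb_sqrt t0 a0 r0 H.
have e2 : (3 * z * Num.sqrt h0) ^+ 2 = 9 * z ^+ 2 * h0.
  by rewrite !exprMn sqr_sqrtr//; ring.
rewrite e2 => {}H.
have Q1 := ler_wpM2l z0 P1. have Q2 := ler_wpM2l z0 P2. have Q3 := ler_wpM2l z0 P3.
have Q4 := ler_wpM2l (sqr_ge0 z) hh0.
have Q5 := ler_wpM2l z0 h1'.
have zz : z <= z ^+ 2 by rewrite expr2 ler_peMl.
have Q6 := ler_wpM2r h00 zz.
have mlD : 0 <= m1 * l * D by apply: mulr_ge0; [exact: mulr_ge0|exact: D0].
have Q7 : z * (m1 * l * D) <= z ^+ 2 * (m1 * l * D) by exact: ler_wpM2r.
have p1 : 0 <= z ^+ 2 * (m1 * l * D) by apply: mulr_ge0; [exact: sqr_ge0|exact: mlD].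
have p2 : 0 <= z * U by apply: mulr_ge0; [exact: z0|exact: U0].
have p3 : 0 <= z * (m2 * l ^+ 2 * D).
  apply: mulr_ge0; first exact: z0.
  by apply: mulr_ge0; [apply: mulr_ge0; [exact: m20|exact: sqr_ge0]|exact: D0].
have -> : q * (10 * (100 * 100) * (z ^+ 2 * (m1 * l / N)) + 10 * (100 * 100) * (z * (l ^+ 2 / sN))
     + 10 * (100 * 100) * (z * (m2 * l ^+ 2 / N)))
   = 100 * 1000 * (z ^+ 2 * (m1 * l * D)) + 100 * 1000 * (z * U) + 100 * 1000 * (z * (m2 * l ^+ 2 * D)).
  by rewrite /U /D; ring.
by move: H Q1 Q2 Q3 Q4 Q5 Q6 Q7 p1 p2 p3; lra.
Qed.

Lemma slice_numeric (z h B t2 b2 : R) :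
  0 <= z -> 1 <= z -> 0 <= t2 -> 0 <= h -> 0 <= B ->
  t2 <= 4 * (3 * z * Num.sqrt h * Num.sqrt (4 * (t2 + 200 * B)) + (3 * (2 * z * h)
     + 4 * (3 * z * Num.sqrt h * Num.sqrt (14 * B)))) + 4 * b2 ->
  t2 <= 800 * (z ^+ 2 * h) + 60 * 100 * B + 8 * b2.
Proof.
move=> z0 z1 t0 h0 B0 H.
have a0 : 0 <= 3 * z * Num.sqrt h by apply: mulr_ge0; [lra|exact: sqrtr_ge0].
have r0 : 0 <= 200 * B by apply: mulr_ge0; [exact: ler0n|exact: B0].
have := absorb_sqrt t0 a0 r0 H.
have -> : (3 * z * Num.sqrt h) ^+ 2 = 9 * (z ^+ 2 * h) by rewrite !exprMn sqr_sqrtr//; ring.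
move=> {}H.
have zh : z * Num.sqrt h = Num.sqrt (z ^+ 2 * h) by rewrite sqrtrM ?sqr_ge0// sqrtr_sqr ger0_norm.
have zh0 : 0 <= z ^+ 2 * h by rewrite mulr_ge0// sqr_ge0.
have P1 := sqrt_mul_le_half zh0 r0.
have B14 : 0 <= 14 * B by rewrite mulr_ge0.
have P2 := sqrt_mul_le_half zh0 B14.
have zz : z * h <= z ^+ 2 * h by apply: ler_wpM2r => //; rewrite expr2 ler_peMl.
by move: H P1 P2 zz; rewrite -zh; lra.
Qed.

Lemma ln2_ge_half : 2^-1 <= ln (2 : R).
Proof.
rewrite -[2^-1]expRK ler_ln ?posrE ?expR_gt0//.
have : expR (2^-1 : R) <= 1 + 2^-1 + 2^-1 ^+ 2 by apply: expR_le_quadratic; rewrite ?ger0_norm ?invr_ge0//; lra.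
lra.
Qed.

Lemma ln_nat_ge_half (n : nat) : (1 < n)%N -> 2^-1 <= ln (n%:R : R).
Proof.
move=> n1; apply: (le_trans ln2_ge_half); rewrite ler_ln ?posrE ?ltr0n//; last exact: ltnW.
by rewrite ler_nat.
Qed.

Lemma dlog_le_ln (n : nat) : (1 < n)%N -> (dlog n)%:R <= 4 * ln (n%:R : R).
Proof.
move=> n1; have n0 : (0 < n)%N by exact: ltnW.
have h : ln ((2 ^ (dlog n).-1)%:R : R) <= ln n%:R.
  by rewrite ler_ln ?posrE ?ltr0n ?expn_gt0// ler_nat dlog_le.
have : ((dlog n).-1%:R * ln 2 : R) <= ln n%:R.
  by move: h; rewrite natrX lnXn// mulr_natl.
have g := ln_nat_ge_half n1.
have k := ler_wpM2l (ler0n R (dlog n).-1) ln2_ge_half.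
have : (dlog n)%:R = (dlog n).-1%:R + 1 :> R by rewrite natr1 prednK.
by move: k g; lra.
Qed.

(** Few slices mean that [be] is not small. The two hypotheses on [be] then bound N by a multiple of
    m1^(7/4) l, up to [zb], and in this range l^2 / sqrt N is below (m1 l / N)^(3/4), because powers
    of l = log m1 are negligible against powers of m1. *)
Lemma small_slices_numeric (m1 l N y zb be C D : R) :
  1 <= m1 -> 0 < l -> m1 = expR l -> 0 < N -> 1 <= zb -> 0 < y -> y ^+ 4 = m1 * l / N ->
  0 < be -> be ^+ 3 <= zb ^+ 2 * (m1 * l / N) -> 0 <= C -> 1 <= C * m1 * be ^+ 4 ->
  0 <= D -> C ^+ 3 * 5 ^+ 24 <= D ^+ 16 ->
  l ^+ 2 / Num.sqrt N <= D * (zb * y ^+ 3).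
Proof.
move=> m11 l0 ml N0 zb1 y0 y4 be0 bex C0 b256 D0 CD.
have m10 : 0 < m1 by lra. have zb0 : 0 < zb by lra.
set sN := Num.sqrt N; have sN0 : 0 < sN by rewrite sqrtr_gt0.
have sN2 : sN ^+ 2 = N by rewrite sqr_sqrtr// ltW.
(* After raising to the 16th power, the comparison needs l^24 at most a constant times m1^5; hence
   the exponent 5/24. *)
set e := expR (5 / 24 * l).
have le5 : l <= 5 * e.
  by have := expR_ge1Dx (5 / 24 * l); rewrite -/e; lra.
have e24 : e ^+ 24 = m1 ^+ 5.
  by rewrite ml /e -!expRM_natl; congr expR; field.
have l24 : l ^+ 24 <= 5 ^+ 24 * m1 ^+ 5.
  rewrite -e24 -exprMn; apply: lerXn2r; rewrite ?nnegrE ?(ltW l0)//.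
  by rewrite mulr_ge0// expR_ge0.
have N4 : N ^+ 4 <= C ^+ 3 * zb ^+ 8 * m1 ^+ 7 * l ^+ 4.
  have x0 : 0 <= m1 * l / N by rewrite divr_ge0 ?mulr_ge0// ltW.
  have c1 : 1 <= (C * m1 * be ^+ 4) ^+ 3 by rewrite exprn_ege1.
  have c2 : (be ^+ 3) ^+ 4 <= (zb ^+ 2 * (m1 * l / N)) ^+ 4.
    by apply: lerXn2r; rewrite ?nnegrE ?exprn_ge0 ?(ltW be0)// mulr_ge0// sqr_ge0.
  have c3 : (C * m1 * be ^+ 4) ^+ 3 = C ^+ 3 * m1 ^+ 3 * (be ^+ 3) ^+ 4 by ring.
  have c4 : C ^+ 3 * m1 ^+ 3 * (be ^+ 3) ^+ 4
      <= C ^+ 3 * m1 ^+ 3 * (zb ^+ 2 * (m1 * l / N)) ^+ 4.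
    by apply: ler_wpM2l => //; rewrite mulr_ge0 ?exprn_ge0// ltW.
  have : 1 <= C ^+ 3 * m1 ^+ 3 * (zb ^+ 2 * (m1 * l / N)) ^+ 4.
    by apply: (le_trans c1); rewrite c3.
  have -> : C ^+ 3 * m1 ^+ 3 * (zb ^+ 2 * (m1 * l / N)) ^+ 4
     = (C ^+ 3 * zb ^+ 8 * m1 ^+ 7 * l ^+ 4) / N ^+ 4 by field; rewrite gt_eqF.
  by rewrite ler_pdivlMr ?exprn_gt0// mul1r.
have a0 : 0 <= l ^+ 2 / sN by rewrite divr_ge0 ?sqr_ge0// ltW.
have b0 : 0 <= D * (zb * y ^+ 3) by rewrite !mulr_ge0 ?exprn_ge0// ltW.
rewrite -(@ler_pXn2r _ 16) ?nnegrE//.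
have -> : (l ^+ 2 / sN) ^+ 16 = l ^+ 32 / N ^+ 8.
  by rewrite -sN2; field; rewrite gt_eqF.
have -> : (D * (zb * y ^+ 3)) ^+ 16 = D ^+ 16 * zb ^+ 16 * m1 ^+ 12 * l ^+ 12 / N ^+ 12.
  have -> : (D * (zb * y ^+ 3)) ^+ 16 = D ^+ 16 * zb ^+ 16 * (y ^+ 4) ^+ 12 by ring.
  by rewrite y4; field; rewrite gt_eqF.
rewrite (_ : l ^+ 32 / N ^+ 8 = l ^+ 32 * N ^+ 4 / N ^+ 12); last by field; rewrite gt_eqF.
apply: ler_wpM2r; first by rewrite invr_ge0 exprn_ge0// ltW.
have g0 k : 0 <= l ^+ k by rewrite exprn_ge0// ltW.
have gm k : 0 <= m1 ^+ k by rewrite exprn_ge0// ltW.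
have gz k : 0 <= zb ^+ k by rewrite exprn_ge0// ltW.
have s1 := ler_wpM2l (g0 32) N4.
have cc : 0 <= C ^+ 3 * zb ^+ 8 * m1 ^+ 7 * l ^+ 12.
  by apply: mulr_ge0 => //; apply: mulr_ge0 => //; apply: mulr_ge0 => //; exact: exprn_ge0.
have s2 := ler_wpM2l cc l24.
apply: (le_trans s1).
rewrite (_ : l ^+ 32 * (C ^+ 3 * zb ^+ 8 * m1 ^+ 7 * l ^+ 4)
  = C ^+ 3 * zb ^+ 8 * m1 ^+ 7 * l ^+ 12 * l ^+ 24); last by ring.
apply: (le_trans s2).
rewrite (_ : C ^+ 3 * zb ^+ 8 * m1 ^+ 7 * l ^+ 12 * (5 ^+ 24 * m1 ^+ 5)
  = (C ^+ 3 * 5 ^+ 24) * zb ^+ 8 * m1 ^+ 12 * l ^+ 12); last first.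
  by move: (5 ^+ 24) => c; ring.
apply: ler_wpM2r => //; apply: ler_wpM2r => //.
apply: ler_pM => //.
- by apply: mulr_ge0; [exact: exprn_ge0|apply: exprn_ge0].
- by rewrite ler_weXn2l.
Qed.

(** The two sides are 10^24 and 10^32. *)
Lemma small_slices_constant : (256 : R) ^+ 3 * 5 ^+ 24 <= 100 ^+ 16.
Proof.
have -> : (256 : R) = 2 ^+ 8 by ring.
have -> : (100 : R) = (2 * 5) ^+ 2 by ring.
rewrite -!exprM -exprMn ler_weXn2l//; lra.
Qed.

End Numerics.

(** * Risk bounds on the good events *)

Section Risk.
Context {R : realType} (n1 n2 : nat) (N zeta : R) (Y Ms B0 B1 : 'M[R]_(n1, n2))
  (pih : 'S_n1) (sgh : 'S_n2) (Cb : R).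
Hypothesis n1_gt1 : (1 < n1)%N.
Hypothesis n2_gt0 : (0 < n2)%N.
Hypothesis n21 : (n2 <= n1)%N.
Hypothesis N_gt0 : 0 < N.
Hypothesis zeta_gt0 : 0 < zeta.
Hypothesis Cb_ge0 : 0 <= Cb.
Local Notation l := (ln (n1%:R : R)).
Local Notation q := ((n1 * n2)%:R : R).
Local Notation p := (N / q).
Local Notation x := (n1%:R * l / N).
Local Notation y := (Num.sqrt (Num.sqrt x)).
Local Notation zb := (zbar zeta).
Local Notation S := (zb ^+ 2 * y ^+ 3).
Local Notation Mt := (Defs.permM B0 pih sgh).
Local Notation Mh := (Defs.permM B1 pih sgh).
Local Notation b2 := (frob2 (Ms - Mt)).
Local Notation t2 := (frob2 (Mh - Mt)).
Local Notation W := (fun e : 'I_n1 * 'I_n2 => (Y - Ms) ((pih^-1)%g e.1) ((sgh^-1)%g e.2)).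
Local Notation good m := (@net_good R n1 n2 (n1 ^ 2) m
   (3 * (1 + zeta) * Num.sqrt (net_entropy n1 m / p)) (2 * (1 + zeta) * (net_entropy n1 m / p)) W).
Hypothesis x_le1 : x <= 1.
Hypothesis HB0 : is_BISO B0.
Hypothesis HB1 : is_BISO B1.
Hypothesis Ms01 : forall i j, 0 <= Ms i j <= 1.
Hypothesis HLS : frob2 (Y - Mh) <= frob2 (Y - Mt).
Hypothesis Hbias : b2 <= q * (Cb * S).

Let n1_gt0 : (0 < n1)%N. Proof. exact: ltnW. Qed.
Let q0 : 0 < q. Proof. by rewrite ltr0n muln_gt0 n1_gt0. Qed.
Let l1 : 2^-1 <= l. Proof. exact: ln_nat_ge_half. Qed.
Let n1p : 1 <= n1%:R :> R. Proof. by rewrite ler1n. Qed.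
Let n2p : 1 <= n2%:R :> R. Proof. by rewrite ler1n. Qed.
Let n21p : n2%:R <= n1%:R :> R. Proof. by rewrite ler_nat. Qed.
Let x0 : 0 < x.
Proof. by have := l1; have := n1p => a b; rewrite divr_gt0// mulr_gt0//; lra. Qed.
Let y0 : 0 < y. Proof. by rewrite !sqrtr_gt0. Qed.
Let y4 : y ^+ 4 = x.
Proof. by rewrite (exprM _ 2 2) sqr_sqrtr ?sqrtr_ge0// sqr_sqrtr// ltW. Qed.
Let y1 : y <= 1.
Proof.
apply: (@le_trans _ _ (Num.sqrt 1)); last by rewrite sqrtr1.
apply: ler_wsqrtr; apply: (@le_trans _ _ (Num.sqrt 1)); last by rewrite sqrtr1.
exact: ler_wsqrtr.
Qed.
Let xy : x <= y ^+ 3.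
Proof. by rewrite -[X in X <= _]y4 exprS; apply: ler_piMl => //; exact: exprn_ge0 (ltW y0). Qed.
Let zb1 : 1 <= zb. Proof. by rewrite /zbar le_max lexx orbT. Qed.
Let z2 : 1 + zeta <= 2 * zb.
Proof.
have h1 := zb1; have h2 : zeta <= zb by rewrite /zbar le_max lexx.
by lra.
Qed.
Let t0 : 0 <= t2. Proof. by apply: sumr_ge0 => i _; apply: sumr_ge0 => j _; exact: sqr_ge0. Qed.
Let Mh01 i j : 0 <= Mh i j <= 1. Proof. by rewrite mxE; have [h _] := HB1. Qed.

Lemma lossF_le1 : lossF Ms Mh <= 1.
Proof.
rewrite /lossF ler_pdivrMr// mul1r natrM /frob2.
apply: (@le_trans _ _ (\sum_(i < n1) \sum_(j < n2) 1)).
  apply: ler_sum => i _; apply: ler_sum => j _; rewrite mxE [(- Ms) i j]mxE.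
  have /andP[a1 a2] := Mh01 i j; have /andP[a3 a4] := Ms01 i j.
  by rewrite -[1](expr1n _ 2) -[X in X <= _]real_normK ?num_real// lerXn2r ?nnegrE// ler_norml;
    apply/andP; split; lra.
by rewrite !sumr_const !card_ord -[X in X <= _]mulr_natl.
Qed.

(** The factor 18 is 2 * 8 + 2: the bias enters through the estimate of [t2] and again in the
    triangle inequality. *)
Lemma lossF_split (u : R) : t2 <= q * u + 8 * b2 -> lossF Ms Mh <= 2 * u + 18 * (Cb * S).
Proof.
move=> h; rewrite /lossF ler_pdivrMr//.
by have := frob2_triangle Ms Mh Mt; move: h Hbias; lra.
Qed.

Lemma least_squares_fip : exists F G : nat -> nat -> R, [/\ bimonotone F, bimonotone G,
  t2 = fnorm2 (fun e : 'I_n1 * 'I_n2 => F e.1 e.2 - G e.1 e.2) &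
  t2 <= 4 * fip W (fun e => F e.1 e.2 - G e.1 e.2) + 4 * b2].
Proof.
have [F [bF hF]] := BISO_extension HB1; have [G [bG hG]] := BISO_extension HB0.
exists F, G; split => //; first by apply: frob2_perm; [exact: hF|exact: hG].
have := @least_squares_basic _ _ _ Y Ms Mh Mt HLS.
by rewrite (matip_perm _ _ _ (hF n1_gt0 n2_gt0) (hG n1_gt0 n2_gt0)).
Qed.

Lemma entropyE m : net_entropy n1 m / p = (2 * n1%:R + 12 * m%:R + 12) * l * (n1%:R * n2%:R / N).
Proof.
rewrite /net_entropy invf_div (natrM _ n1) -!mulrA; congr (_ * _).
by rewrite natrD natrD (natrM _ 2) (natrM _ 12).
Qed.

Let D0 : 0 <= n1%:R * n2%:R / N :> R. Proof. by rewrite divr_ge0// ltW. Qed.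
Let l0 : 0 <= l. Proof. by have := l1; lra. Qed.

Lemma entropy_ge0 m : 0 <= net_entropy n1 m / p.
Proof.
rewrite entropyE; by apply: mulr_ge0 => //; apply: mulr_ge0.
Qed.

(** The entropy of the permutations contributes (1 + zeta)^2 x, which the sorting error absorbs
    since x <= y^3. *)
Lemma lossF_dyadic_le : good (10 * n1)%N -> good (8 * n2 * dlog n1)%N ->
  lossF Ms Mh <= (18 * Cb + 80 * (100 * 100))
    * (S + zb * n2%:R / N * l ^+ 2 + zb / Num.sqrt N * l ^+ 2).
Proof.
move=> g1 g2; have [F [G [bF bG eF hF]]] := least_squares_fip.
have zp := zeta_gt0.
have z1 : 0 <= 1 + zeta by lra.
have a10 m : 0 <= 3 * (1 + zeta) * Num.sqrt (net_entropy n1 m / p).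
  by apply: mulr_ge0; [lra|exact: sqrtr_ge0].
have a20 m : 0 <= 2 * (1 + zeta) * (net_entropy n1 m / p).
  by apply: mulr_ge0; [lra|exact: entropy_ge0].
have H := dyadic_chain n1_gt1 n2_gt0 n21 (a10 _) (a20 _) (a10 _) bF bG g1 g2.
have H2 := @dyadic_numeric R n1%:R n2%:R (dlog n1)%:R l N (1 + zeta)
  (net_entropy n1 (10 * n1) / p) (net_entropy n1 (8 * n2 * dlog n1) / p) t2 b2
  n2p n21p l1 (ler0n _ _) (dlog_le_ln n1_gt1) N_gt0.
have {}H2 := H2 _ t0 (entropy_ge0 _) (entropy_ge0 _).
have lD : 0 <= l * (n1%:R * n2%:R / N) by exact: mulr_ge0.
have e1 : net_entropy n1 (10 * n1) / p <= 134 * n1%:R * l * (n1%:R * n2%:R / N).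
  rewrite entropyE -[X in X <= _]mulrA -[X in _ <= X]mulrA natrM.
  apply: ler_wpM2r; first exact: lD.
  by have := n1p; lra.
have e2 : net_entropy n1 (8 * n2 * dlog n1) / p
    <= (14 * n1%:R + 96 * n2%:R * (dlog n1)%:R) * l * (n1%:R * n2%:R / N).
  rewrite entropyE -[X in X <= _]mulrA -[X in _ <= X]mulrA !natrM.
  apply: ler_wpM2r; first exact: lD.
  by have := n1p; lra.
have {}H2 : t2 <= n1%:R * n2%:R * (10 * (100 * 100) * ((1 + zeta) ^+ 2 * x)
   + 10 * (100 * 100) * ((1 + zeta) * (l ^+ 2 / Num.sqrt N))
   + 10 * (100 * 100) * ((1 + zeta) * (n2%:R * l ^+ 2 / N))) + 8 * b2.
  apply: H2; [lra|exact: e1|exact: e2|].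
  apply: (le_trans hF); rewrite lerD2r; apply: ler_wpM2l => //.
  by apply: (le_trans H); rewrite -eF !natrM !addrA.
have := @lossF_split (10 * (100 * 100) * ((1 + zeta) ^+ 2 * x)
   + 10 * (100 * 100) * ((1 + zeta) * (l ^+ 2 / Num.sqrt N))
   + 10 * (100 * 100) * ((1 + zeta) * (n2%:R * l ^+ 2 / N))).
rewrite natrM => /(_ H2) h; apply: (le_trans h).
set A1 := zb / Num.sqrt N * l ^+ 2; set V1 := zb * n2%:R / N * l ^+ 2.
have i1 : (1 + zeta) * (l ^+ 2 / Num.sqrt N) <= 2 * A1.
  have -> : 2 * A1 = 2 * zb * (l ^+ 2 / Num.sqrt N) by rewrite /A1; ring.
  by apply: ler_wpM2r => //; rewrite divr_ge0 ?sqr_ge0 ?sqrtr_ge0.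
have i2 : (1 + zeta) * (n2%:R * l ^+ 2 / N) <= 2 * V1.
  have -> : 2 * V1 = 2 * zb * (n2%:R * l ^+ 2 / N) by rewrite /V1; ring.
  by apply: ler_wpM2r => //; rewrite divr_ge0 ?(ltW N_gt0)// mulr_ge0// sqr_ge0.
have i3 : (1 + zeta) ^+ 2 * x <= 4 * S.
  have -> : 4 * S = (2 * zb) ^+ 2 * y ^+ 3 by ring.
  by apply: ler_pM; rewrite ?sqr_ge0 ?(ltW x0)// lerXn2r ?nnegrE//; have := zb1; lra.
have A0 : 0 <= A1.
  apply: mulr_ge0; last exact: sqr_ge0.
  by rewrite divr_ge0 ?sqrtr_ge0//; have := zb1; lra.
have V0 : 0 <= V1.
  apply: mulr_ge0; last exact: sqr_ge0.
  by rewrite divr_ge0 ?(ltW N_gt0)// mulr_ge0//; have := zb1; lra.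
have S0 : 0 <= S by rewrite mulr_ge0 ?sqr_ge0// exprn_ge0// ltW.
have j1 := mulr_ge0 Cb_ge0 A0; have j2 := mulr_ge0 Cb_ge0 V0.
by move: i1 i2 i3 A0 V0 S0 j1 j2; move: (zb ^+ 2 * y ^+ 3) => SS; lra.
Qed.

(** No chaining here: the noise is bounded in norm. If log / p exceeds 1 the trivial bound on the
    loss suffices; otherwise the square root dominates the Bernstein term. *)
Lemma lossF_entrywise_le : (forall i j, `|(Y - Ms) i j| <=
    (1 + zeta) * (3 * Num.sqrt (6 * lg R n1 n2 / p) + 6 * lg R n1 n2 / p)) -> 0 < lg R n1 n2 ->
  lossF Ms Mh <= (18 * Cb + 100 * 300) * (S + zb ^+ 2 * (lg R n1 n2 / p)).
Proof.
move=> hent L0; set L := lg R n1 n2 in hent L0 *.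
have p0 : 0 < p by rewrite divr_gt0.
have zp := zeta_gt0; have zb1' := zb1; have z2' := z2.
have S0 : 0 <= S by rewrite mulr_ge0 ?sqr_ge0// exprn_ge0// ltW.
set v := L / p; have v0 : 0 < v by rewrite divr_gt0.
have zv0 : 0 <= zb ^+ 2 * v by rewrite mulr_ge0 ?sqr_ge0// ltW.
have cs := mulr_ge0 Cb_ge0 S0; have cz := mulr_ge0 Cb_ge0 zv0.
have zb21 : 1 <= zb ^+ 2 by rewrite exprn_ege1.
have [v1|v1] := leP v 1; last first.
  apply: (le_trans lossF_le1).
  have : v <= zb ^+ 2 * v by rewrite ler_peMl// ltW.
  by move: v1 cs cz S0 zv0; move: (zb ^+ 2 * y ^+ 3) => SS; lra.
have ent i j : (Y - Ms) i j ^+ 2 <= 180 * ((1 + zeta) ^+ 2 * v).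
  rewrite -[X in X <= _]real_normK ?num_real//.
  apply: (@le_trans _ _ (((1 + zeta) * (3 * Num.sqrt (6 * L / p) + 6 * L / p)) ^+ 2)).
    by rewrite lerXn2r ?nnegrE//; exact: le_trans (hent i j).
  rewrite (_ : 6 * L / p = 6 * v); last by rewrite /v mulrA.
  rewrite exprMn [X in _ <= X]mulrCA; apply: ler_wpM2l; first exact: sqr_ge0.
  set s := Num.sqrt _; have s2 : s ^+ 2 = 6 * v by rewrite sqr_sqrtr// mulr_ge0// ltW.
  have : v ^+ 2 <= v by rewrite expr2 ler_piMl// ltW.
  by have := sqr_ge0 (3 * s - 6 * v); move: s2; lra.
have W2 : frob2 (Y - Ms) <= q * (180 * ((1 + zeta) ^+ 2 * v)).
  rewrite /frob2; apply: (@le_trans _ _ (\sum_(i < n1) \sum_(j < n2) 180 * ((1 + zeta) ^+ 2 * v))).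
    by apply: ler_sum => i _; apply: ler_sum => j _; exact: ent.
  by rewrite !sumr_const !card_ord -mulrnA [(n2 * n1)%N]mulnC -[X in X <= _]mulr_natl.
have h := @least_squares_basic _ _ _ Y Ms Mh Mt HLS.
have h2 := matip_le_norms (Y - Ms) (Mh - Mt).
have h3 : t2 <= q * (16 * (180 * ((1 + zeta) ^+ 2 * v))) + 8 * b2 by move: h h2 W2; lra.
apply: (le_trans (lossF_split h3)).
have i1 : (1 + zeta) ^+ 2 * v <= 4 * (zb ^+ 2 * v).
  have -> : 4 * (zb ^+ 2 * v) = (2 * zb) ^+ 2 * v by ring.
  by apply: ler_wpM2r; [exact: ltW|rewrite lerXn2r ?nnegrE//; lra].
by move: i1 cs cz S0 zv0; move: (zb ^+ 2 * y ^+ 3) => SS; lra.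
Qed.

(** [be] balances two errors: the approximation error 1 / M^2 and the entropy term zb^2 M n2 l / N =
    M be^3 are both of order be^2 when M be is of order 1. *)
Lemma lossF_slices_le (M : nat) (be : R) : (0 < M)%N -> (M <= n1)%N -> (16 * n1 <= M ^ 4)%N ->
  0 < be -> be ^+ 3 = zb ^+ 2 * (n2%:R * l / N) -> M%:R * be <= 1 -> 1 <= 2 * (M%:R * be) ->
  good (45 * (n2 * M))%N ->
  lossF Ms Mh <= (18 * Cb + 10 * 100 * (100 * 100)) * (S + be ^+ 2).
Proof.
move=> M0 Mn M16 be0 be3 Mb1 Mb2 g1; have [F [G [bF bG eF hF]]] := least_squares_fip.
have zp := zeta_gt0; have zb1' := zb1; have z2' := z2.
have z1 : 0 <= 1 + zeta by lra.
set h := net_entropy n1 (45 * (n2 * M)) / p in g1.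
have h0 : 0 <= h by exact: entropy_ge0.
have a10 : 0 <= 3 * (1 + zeta) * Num.sqrt h by apply: mulr_ge0; [lra|exact: sqrtr_ge0].
have a20 : 0 <= 2 * (1 + zeta) * h by apply: mulr_ge0; [lra|exact: h0].
have Mp : 0 < M%:R :> R by rewrite ltr0n.
pose B : R := q / M%:R ^+ 2.
have B0' : 0 <= B by rewrite divr_ge0// exprn_ge0.
have H := slice_chain n1_gt0 n2_gt0 M0 Mn M16 (erefl B) a10 a20 bF bG g1.
have z1' : 1 <= 1 + zeta by lra.
have H2 : t2 <= 800 * ((1 + zeta) ^+ 2 * h) + 60 * 100 * B + 8 * b2.
  apply: (slice_numeric z1 z1' t0 h0 B0').
  apply: (le_trans hF); rewrite lerD2r; apply: ler_wpM2l => //.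
  by apply: (le_trans H); rewrite -eF !addrA.
have BE : B <= q * (4 * be ^+ 2).
  rewrite /B; apply: ler_wpM2l => //.
  rewrite -[X in X <= _]mul1r ler_pdivrMr ?exprn_gt0//.
  have : 1 ^+ 2 <= (2 * (M%:R * be)) ^+ 2 by rewrite lerXn2r ?nnegrE//; lra.
  by rewrite expr1n; lra.
have hE : (1 + zeta) ^+ 2 * h <= q * (4 * (14 * S + 540 * be ^+ 2)).
  have hh : h <= q * (14 * x + 540 * (M%:R * (n2%:R * l / N))).
    rewrite /h entropyE !natrM.
    have lD : 0 <= l * (n1%:R * n2%:R / N) by exact: mulr_ge0.
    rewrite [X in _ <= X](_ : _ = (14 * n1%:R + 540 * (n2%:R * M%:R)) * (l * (n1%:R * n2%:R / N)));
      last by ring.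
    rewrite -[X in X <= _]mulrA; apply: ler_wpM2r => //.
    by have := n1p; lra.
  have zz : (1 + zeta) ^+ 2 <= 4 * zb ^+ 2.
    have -> : 4 * zb ^+ 2 = (2 * zb) ^+ 2 by ring.
    by rewrite lerXn2r ?nnegrE//; lra.
  have s1 := ler_pM (sqr_ge0 (1 + zeta)) h0 zz hh.
  apply: (le_trans s1).
  rewrite [X in X <= _](_ : _ = q * (4 * (14 * (zb ^+ 2 * x) + 540 * (M%:R * be ^+ 3)))); last first.
    by rewrite be3; ring.
  apply: ler_wpM2l; first exact: ltW.
  have i1 : zb ^+ 2 * x <= S by apply: ler_wpM2l => //; exact: sqr_ge0.
  have i2 : M%:R * be ^+ 3 <= be ^+ 2.
    rewrite exprS mulrA -[X in _ <= X]mul1r; apply: ler_wpM2r => //; exact: sqr_ge0.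
  by move: i1 i2; move: (zb ^+ 2 * x) (zb ^+ 2 * y ^+ 3) => XX SS; lra.
have h3 : t2 <= q * (32 * 100 * (14 * S + 540 * be ^+ 2) + 240 * 100 * be ^+ 2) + 8 * b2.
  by move: H2 BE hE; move: (zb ^+ 2 * y ^+ 3) ((1 + zeta) ^+ 2 * h) => SS ZH; lra.
apply: (le_trans (lossF_split h3)).
have S0 : 0 <= S by rewrite mulr_ge0 ?sqr_ge0// exprn_ge0// ltW.
have b0 : 0 <= be ^+ 2 by exact: sqr_ge0.
have cb := mulr_ge0 Cb_ge0 b0.
by move: cb S0 b0; move: (zb ^+ 2 * y ^+ 3) => SS; lra.
Qed.

(* [1 / be] is the optimal number of slices. Above [n1] the entrywise bound is good enough, and
   below [n1^(1/4)] the dyadic bound is already dominated by the sorting error. *)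
Lemma lossF_slices_min_le (be : R) : 0 < be -> be ^+ 3 = zb ^+ 2 * (n2%:R * l / N) ->
  good (10 * n1)%N -> good (8 * n2 * dlog n1)%N -> good (45 * (n2 * Num.truncn be^-1))%N ->
  (forall i j, `|(Y - Ms) i j| <=
    (1 + zeta) * (3 * Num.sqrt (6 * lg R n1 n2 / p) + 6 * lg R n1 n2 / p)) ->
  0 < lg R n1 n2 -> lg R n1 n2 <= 2 * l ->
  lossF Ms Mh <= 101 * (18 * Cb + 10 * 100 * (100 * 100)) * (S + zb * n2%:R / N * l ^+ 2 + be ^+ 2).
Proof.
move=> be0 be3 g1 g2 g3 hent L0 L2l.
have zb1' := zb1; have Cb0 := Cb_ge0.
have S0 : 0 <= S by rewrite mulr_ge0 ?sqr_ge0// exprn_ge0// ltW.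
have b0 : 0 <= be ^+ 2 by exact: sqr_ge0.
have V0 : 0 <= zb * n2%:R / N * l ^+ 2.
  apply: mulr_ge0; last exact: sqr_ge0.
  by rewrite divr_ge0 ?(ltW N_gt0)// mulr_ge0//; lra.
set V1 := zb * n2%:R / N * l ^+ 2 in V0 *.
have cS := mulr_ge0 Cb0 S0; have cV := mulr_ge0 Cb0 V0; have cb := mulr_ge0 Cb0 b0.
have [be1|be1] := ltP 1 be.
  apply: (le_trans lossF_le1).
  have : 1 <= be ^+ 2 by rewrite exprn_ege1// ltW.
  by move: cS cV cb S0 V0; move: (zb ^+ 2 * y ^+ 3) => SS; lra.
have ib1 : 1 <= be^-1 by rewrite invf_ge1.
set M := Num.truncn be^-1 in g3.
have /andP[M1 M2] : M%:R <= be^-1 < M.+1%:R by apply: truncn_itv; rewrite invr_ge0 ltW.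
have M0 : (0 < M)%N.
  by rewrite lt0n; apply/eqP => e; move: M2; rewrite e ltNge ib1.
have Mb1 : M%:R * be <= 1 by rewrite -ler_pdivlMr// div1r.
have Mb2 : 1 <= 2 * (M%:R * be).
  have : be^-1 <= 2 * M%:R.
    apply: (le_trans (ltW M2)); rewrite -natr1.
    by have : 1 <= M%:R :> R by [rewrite ler1n]; lra.
  by move=> h; rewrite mulrA -ler_pdivrMr// div1r.
have [Mn|Mn] := leqP M n1; last first.
  apply: (le_trans (lossF_entrywise_le hent L0)).
  have h : zb ^+ 2 * (lg R n1 n2 / p) <= 2 * be ^+ 2.
    rewrite invf_div natrM.
    apply: (@le_trans _ _ (zb ^+ 2 * (2 * l * (n1%:R * n2%:R / N)))).
      by apply: ler_wpM2l; [exact: sqr_ge0|apply: ler_wpM2r].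
    have -> : zb ^+ 2 * (2 * l * (n1%:R * n2%:R / N)) = 2 * (n1%:R * be) * be ^+ 2.
      by rewrite -!mulrA -exprS be3; ring.
    apply: ler_wpM2r => //.
    have : n1%:R * be <= M%:R * be by apply: ler_wpM2r; [exact: ltW|rewrite ler_nat ltnW].
    by move: Mb1; lra.
  have h2 := ler_wpM2l Cb0 h.
  by move: h h2 cS cV cb S0 V0; move: (zb ^+ 2 * y ^+ 3) (zb ^+ 2 * _) => SS ZZ; lra.
have [M16|M16] := leqP (16 * n1) (M ^ 4).
  apply: (le_trans (lossF_slices_le M0 Mn M16 be0 be3 Mb1 Mb2 g3)).
  by move: cS cV cb S0 V0; move: (zb ^+ 2 * y ^+ 3) => SS; lra.
have n10 : 0 < n1%:R :> R by rewrite ltr0n.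
(* 256 = 2^4 * 16, from 1 <= 2 M be and M^4 < 16 n1. *)
have b4 : 1 <= 256 * n1%:R * be ^+ 4.
  have h1 : 1 <= (2 * (M%:R * be)) ^+ 4 by rewrite exprn_ege1.
  have h2 : M%:R ^+ 4 <= 16 * n1%:R :> R by rewrite -natrX -natrM ler_nat ltnW.
  have h3 := ler_wpM2r (exprn_ge0 4 (ltW be0)) h2.
  have e : (2 * (M%:R * be)) ^+ 4 = 16 * (M%:R ^+ 4 * be ^+ 4) by ring.
  by move: h1 h3; rewrite e; lra.
have bx : be ^+ 3 <= zb ^+ 2 * x.
  rewrite be3; apply: ler_wpM2l; first exact: sqr_ge0.
  by apply: ler_wpM2r; [rewrite invr_ge0 ltW|apply: ler_wpM2r].
have lp : 0 < l by have := l1; lra.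
have el : n1%:R = expR l by rewrite lnK.
have c256 : 0 <= 256 :> R by lra. have c100 : 0 <= 100 :> R by lra.
have := small_slices_numeric n1p lp el N_gt0 zb1 y0 y4 be0 bx c256 b4 c100 small_slices_constant.
have zb0 : 0 <= zb by lra.
move=> h; have {}h := ler_wpM2l zb0 h.
apply: (le_trans (lossF_dyadic_le g1 g2)); rewrite -/V1.
have h2 : zb / Num.sqrt N * l ^+ 2 <= 100 * S.
  have -> : zb / Num.sqrt N * l ^+ 2 = zb * (l ^+ 2 / Num.sqrt N) by ring.
  apply: (le_trans h); rewrite le_eqVlt; apply/orP; left; apply/eqP.
  by move: (Num.sqrt (Num.sqrt _)) => yy; ring.
have h3 := ler_wpM2l Cb0 h2.
by move: h2 h3 cS cV cb S0 V0; move: (zb ^+ 2 * y ^+ 3) (zb / Num.sqrt N * l ^+ 2) => SS AA; lra.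
Qed.

(** The bound used is the one of the term attaining the minimum in [vartheta]; [l <= ln N] replaces
    the logarithm of the dimensions by that of N in the last term. *)
Lemma lossF_vartheta_le : good (10 * n1)%N -> good (8 * n2 * dlog n1)%N ->
  good (45 * (n2 * Num.truncn ((zb ^+ 2 * n2%:R / N * l) `^ 3^-1)^-1))%N ->
  (forall i j, `|(Y - Ms) i j| <=
    (1 + zeta) * (3 * Num.sqrt (6 * lg R n1 n2 / p) + 6 * lg R n1 n2 / p)) ->
  0 < lg R n1 n2 -> lg R n1 n2 <= 2 * l -> l <= ln N ->
  lossF Ms Mh <= 101 * (18 * Cb + 10 * 100 * (100 * 100)) * (S + vartheta N n1%:R n2%:R zeta).
Proof.
move=> g1 g2 g3 hent L0 L2l lN.
have zb1' := zb1; have Cb0 := Cb_ge0.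
have lp : 0 < l by have := l1; lra.
have n2r : 0 < n2%:R :> R by rewrite ltr0n.
have th0 : 0 < zb ^+ 2 * n2%:R / N * l.
  by rewrite mulr_gt0// divr_gt0// mulr_gt0// exprn_gt0//; lra.
set th := zb ^+ 2 * n2%:R / N * l in g3 th0.
set be := th `^ 3^-1 in g3.
have be0 : 0 < be by rewrite powR_gt0.
have be3 : be ^+ 3 = zb ^+ 2 * (n2%:R * l / N).
  by rewrite -powR_mulrn ?powR_ge0// -powRrM mulVf// powRr1 ?(ltW th0)// /th; ring.
have be2 : be ^+ 2 = th `^ (2 / 3).
  by rewrite -powR_mulrn ?powR_ge0// -powRrM mulrC.
have min_or (a b : R) : Num.min a b = a \/ Num.min a b = b.
  by case: (leP a b) => _; [left|right].
rewrite /vartheta -/th -be2.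
have S0 : 0 <= S by rewrite mulr_ge0 ?sqr_ge0// exprn_ge0// ltW.
have V0 : 0 <= zb * n2%:R / N * l ^+ 2.
  apply: mulr_ge0; last exact: sqr_ge0.
  by rewrite divr_ge0 ?(ltW N_gt0)// mulr_ge0//; lra.
have HA := lossF_dyadic_le g1 g2.
have HB := lossF_slices_min_le be0 be3 g1 g2 g3 hent L0 L2l.
have HC := lossF_entrywise_le hent L0.
set V1 := zb * n2%:R / N * l ^+ 2 in V0 HA HB *.
set A1 := zb / Num.sqrt N * l ^+ 2 in HA *.
have A0 : 0 <= A1.
  apply: mulr_ge0; last exact: sqr_ge0.
  by rewrite divr_ge0 ?sqrtr_ge0//; lra.
have cS := mulr_ge0 Cb0 S0; have cV := mulr_ge0 Cb0 V0; have cA := mulr_ge0 Cb0 A0.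
have [->|->] := min_or (Num.min A1 (be ^+ 2)) (zb ^+ 2 * n1%:R * n2%:R / N * ln N).
  have [->|->] := min_or A1 (be ^+ 2).
    apply: (le_trans HA).
    by move: cS cV cA S0 V0 A0; move: (zb ^+ 2 * y ^+ 3) => SS; lra.
  by rewrite addrA.
apply: (le_trans HC).
have h : zb ^+ 2 * (lg R n1 n2 / p) <= 2 * (zb ^+ 2 * n1%:R * n2%:R / N * ln N).
  rewrite invf_div natrM.
  have -> : 2 * (zb ^+ 2 * n1%:R * n2%:R / N * ln N) = zb ^+ 2 * (2 * ln N * (n1%:R * n2%:R / N)).
    by ring.
  by apply: ler_wpM2l; [exact: sqr_ge0|apply: ler_wpM2r => //; lra].
have C0 : 0 <= zb ^+ 2 * n1%:R * n2%:R / N * ln N.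
  have : 0 <= ln N by lra.
  move=> h0; apply: mulr_ge0; last exact: h0.
  apply: mulr_ge0; last by rewrite invr_ge0 ltW.
  by apply: mulr_ge0; [apply: mulr_ge0; [exact: sqr_ge0|]|].
have h2 := ler_wpM2l Cb0 h; have cC := mulr_ge0 Cb0 C0.
move: h h2 cC C0 cS cV S0 V0; move: (zb ^+ 2 * y ^+ 3) (zb ^+ 2 * n1%:R * n2%:R / N * ln N) => SS CC.
by move: (zb ^+ 2 * (_ / _)) => LL; lra.
Qed.

End Risk.

(** * Assembly *)

Section Bias.
Context {R : realType} (n1 n2 : nat).

(** The intermediate matrix has the true row order and the estimated column order. Reindexing the
    columns leaves a sum over all columns unchanged, so the row part involves the row order alone;
    likewise for the columns. *)
Lemma bias_split (B0 Ms : 'M[R]_(n1, n2)) (pis pih : 'S_n1) (sgs sgh : 'S_n2) :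
  Ms = Defs.permM B0 pis sgs ->
  frob2 (Ms - Defs.permM B0 pih sgh) <= 2 * (\sum_i \sum_j rowgap Ms pis pih i j ^+ 2)
    + 2 * (\sum_j \sum_i rowgap Ms^T sgs sgh j i ^+ 2).
Proof.
move=> eMs.
have hr : \sum_i \sum_j rowgap Ms pis pih i j ^+ 2
    = \sum_i \sum_j (B0 (pis i) (sgh j) - B0 (pih i) (sgh j)) ^+ 2.
  rewrite -(reindex_perms pih (sgh * sgs^-1)%g (fun i j => rowgap Ms pis pih i j ^+ 2)).
  apply: eq_bigr => i _; apply: eq_bigr => j _.
  by rewrite /rowgap real_normK ?num_real// eMs !mxE perm.permM permK !permKV.
have hc : \sum_j \sum_i rowgap Ms^T sgs sgh j i ^+ 2
    = \sum_i \sum_j (B0 (pis i) (sgs j) - B0 (pis i) (sgh j)) ^+ 2.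
  rewrite exchange_big /=.
  rewrite -(reindex_perms 1%g sgh (fun i j => rowgap Ms^T sgs sgh j i ^+ 2)).
  apply: eq_bigr => i _; apply: eq_bigr => j _.
  by rewrite /rowgap real_normK ?num_real// eMs !mxE perm1 permK !permKV.
rewrite hr hc /frob2 !mulr_sumr -big_split /=; apply: ler_sum => i _.
rewrite !mulr_sumr -big_split /=; apply: ler_sum => j _; rewrite eMs !mxE.
set a := B0 (pis i) (sgs j); set b := B0 (pis i) (sgh j); set c := B0 (pih i) (sgh j).
by have := sqr_ge0 ((a - b) - (b - c)); lra.
Qed.

Lemma in_CBISO01 (Ms : 'M[R]_(n1, n2)) pis sgs : in_CBISO pis sgs Ms -> forall i j, 0 <= Ms i j <= 1.
Proof. by move=> [B [[h _] ->]] i j; rewrite mxE. Qed.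

Lemma sqr_diff_le1 (a b : R) : 0 <= a <= 1 -> 0 <= b <= 1 -> (a - b) ^+ 2 <= 1.
Proof.
move=> /andP[a1 a2] /andP[a3 a4].
rewrite -[1](expr1n _ 2) -[X in X <= _]real_normK ?num_real// lerXn2r ?nnegrE// ler_norml.
by apply/andP; split; lra.
Qed.

Lemma lossR_le1 (Ms : 'M[R]_(n1, n2)) pis sgs pih : (0 < n2)%N -> in_CBISO pis sgs Ms ->
  lossR Ms pis sgs pih <= 1.
Proof.
move=> n20 /in_CBISO01 h; rewrite /lossR; apply: bigmax_le => // i _.
rewrite ler_pdivrMr ?ltr0n// mul1r.
apply: (@le_trans _ _ (\sum_(j < n2) 1)); last by rewrite sumr_const card_ord.
by apply: ler_sum => j _; rewrite !mxE; apply: sqr_diff_le1.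
Qed.

Lemma in_CBISO_lossF_le1 (Ms Mh : 'M[R]_(n1, n2)) pis sgs pih sgh : (0 < n1)%N -> (0 < n2)%N ->
  in_CBISO pis sgs Ms -> in_CBISO pih sgh Mh -> lossF Ms Mh <= 1.
Proof.
move=> n10 n20 /in_CBISO01 h1 /in_CBISO01 h2.
rewrite /lossF ler_pdivrMr ?ltr0n ?muln_gt0 ?n10// mul1r natrM /frob2.
apply: (@le_trans _ _ (\sum_(i < n1) \sum_(j < n2) 1)).
  apply: ler_sum => i _; apply: ler_sum => j _; rewrite mxE [(- Ms) i j]mxE.
  exact: sqr_diff_le1.
by rewrite !sumr_const !card_ord -[X in X <= _]mulr_natl.
Qed.

Lemma in_CBISO_tr (Ms : 'M[R]_(n1, n2)) pis sgs : in_CBISO pis sgs Ms -> in_CBISO sgs pis Ms^T.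
Proof.
move=> [B [[h1 [h2 h3]] ->]]; exists B^T; split.
  split; first by move=> j i; rewrite mxE.
  by split => [j i i' ii|j j' i jj]; rewrite !mxE; [apply: h3|apply: h2].
by apply/matrixP => j i; rewrite !mxE.
Qed.

Lemma lg_le_ln : (0 < n2)%N -> (n2 <= n1)%N -> lg R n1 n2 <= 2 * ln n1%:R.
Proof.
move=> n20 n21; have n10 : (0 < n1)%N by exact: leq_trans n21.
rewrite /lg natrM lnM ?posrE ?ltr0n// mulr_natl mulr2n lerD2l ler_ln ?posrE ?ltr0n//.
by rewrite ler_nat.
Qed.

End Bias.

(** * Transposition of the model and complements of events *)

Section Transpose.
Context {R : realType} {d : measure_display} {Omega : measurableType d}
  (P : probability Omega R) (n1 n2 : nat).

Definition swapX (X : nat -> Omega -> 'I_n1 * 'I_n2) (k : nat) (w : Omega) : 'I_n2 * 'I_n1 :=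
  ((X k w).2, (X k w).1).

Lemma Ymat_tr (Ms : 'M[R]_(n1, n2)) Nn X z keep (Nm : R) w :
  Ymat Ms^T Nn (swapX X) z keep Nm w = (Ymat Ms Nn X z keep Nm w)^T.
Proof.
apply/matrixP => j i; rewrite !mxE mulnC; congr (_ * _).
apply: eq_bigr => k _; rewrite !mxE /=; congr (_ * _%:R).
by rewrite [X k w]surjective_pairing /swapX !xpair_eqE /= andbC.
Qed.

Lemma swap_preimage X k (A : set ('I_n2 * 'I_n1)) :
  swapX X k @^-1` A = X k @^-1` [set e | A (e.2, e.1)].
Proof. by []. Qed.

Lemma obs_model_tr (N zeta : R) Nn X z S : @obs_model R d Omega P n1 n2 N zeta Nn X z S ->
  obs_model P N zeta Nn (swapX X) z S.
Proof.
move=> [h1 [h2 [h3 [h4 [h5 [h6 [h7 [h8 h9]]]]]]]].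
split=> //; split; first by move=> k A; rewrite swap_preimage.
split=> //; split=> //; split=> //; split.
  move=> k [j i]; rewrite swap_preimage mulnC -(h6 k (i, j)); congr (P (_ @^-1` _)).
  by apply/seteqP; split => -[a b] /= [-> ->].
split=> //; split=> // s A us hA; apply: h9 => // v vs.
case: v vs (hA v vs) => [[k m]|] vs //=; rewrite /model_events.
case: ifP => // _ [B ->]; by exists [set e | B (e.2, e.1)].
Qed.

Lemma prob_setCI (A B : set Omega) (a b : R) : measurable A -> measurable B ->
  (P (~` A) <= a%:E)%E -> (P (~` B) <= b%:E)%E ->
  measurable (A `&` B) /\ (P (~` (A `&` B)) <= (a + b)%:E)%E.
Proof.
move=> mA mB hA hB; split; first exact: measurableI.
rewrite setCI EFinD; apply: (le_trans (measureU2 P (measurableC mA) (measurableC mB))).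
exact: leeD.
Qed.

Lemma prob_ge (A : set Omega) (a : R) : measurable A -> (P (~` A) <= a%:E)%E ->
  ((1 - a)%:E <= P A)%E.
Proof.
move=> mA hA; rewrite -(setCK A) probability_setC; last exact: measurableC.
by rewrite EFinB; apply: leeB.
Qed.

End Transpose.

Section RowsSide.
Context {R : realType} {d : measure_display} {Omega : measurableType d}
  (P : probability Omega R) (n1 n2 : nat) (N zeta : R)
  (Ms : 'M[R]_(n1, n2)) (pis : 'S_n1) (sgs : 'S_n2) (Nn : Omega -> nat)
  (X : nat -> Omega -> 'I_n1 * 'I_n2) (z : nat -> Omega -> R)
  (S : nat -> Omega -> bool).
Hypothesis n1_gt0 : (0 < n1)%N.
Hypothesis n2_gt0 : (0 < n2)%N.
Hypothesis zeta_gt0 : 0 < zeta.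
Hypothesis N_gt0 : 0 < N.
Hypothesis HMs : in_CBISO pis sgs Ms.
Hypothesis Hobs : obs_model P N zeta Nn X z S.
Hypothesis lg_gt0 : 0 < lg R n1 n2.
Hypothesis N_big : 6 * lg R n1 n2 <= N / (10 * 20).
Hypothesis x_le1 : n1%:R * lg R n1 n2 / N <= 1.
Local Notation n := ((n1 * n2)%:R : R).
Local Notation Y1 := (Ymat Ms Nn X z S (N / 2)).
Local Notation Y2 := (Ymat Ms Nn X z (fun l w => ~~ S l w) (N / 2)).

Lemma lossR_event : exists E : set Omega, [/\ measurable E, (P (~` E) <= (8 * n ^- 4)%:E)%E &
  forall w, E w -> forall pih, tds_rows N zeta (Y1 w) (Y2 w) pih ->
    lossR Ms pis sgs pih
    <= Num.min 1 (6 * (16 * (zeta + 1)) * Num.sqrt (n1%:R * lg R n1 n2 / N))].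
Proof.
have [E [mE pE hE]] := rows_event n1_gt0 n2_gt0 zeta_gt0 N_gt0 (in_CBISO01 HMs) Hobs lg_gt0 N_big.
exists E; split => // w Ew pih [BL [bBL tBL]].
exact: (lossR_le n1_gt0 n2_gt0 N_gt0 zeta_gt0 lg_gt0 HMs (hE w Ew BL bBL) tBL x_le1).
Qed.

(** The dimensions are not ordered here: the statement serves for the rows and, transposed, for the
    columns. *)
Lemma row_bias_event : n2%:R * lg R n1 n2 / N <= 1 ->
  exists E : set Omega, [/\ measurable E,
    (P (~` E) <= (8 * n ^- 4 + 2 * n2%:R * n ^- 6)%:E)%E &
  forall w, E w -> forall pih, tds_rows N zeta (Y1 w) (Y2 w) pih ->
    \sum_i \sum_j rowgap Ms pis pih i j ^+ 2 <= 20 * 20 * (16 * (zeta + 1)) ^+ 2 * n1%:R * n2%:R *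
      (Num.sqrt (Num.sqrt (n1%:R * lg R n1 n2 / N)) ^+ 3
       + Num.sqrt (Num.sqrt (n1%:R * lg R n1 n2 / N)) * Num.sqrt (n2%:R * lg R n1 n2 / N))].
Proof.
move=> y_le1.
have [E [mE pE hE]] := rows_event n1_gt0 n2_gt0 zeta_gt0 N_gt0 (in_CBISO01 HMs) Hobs lg_gt0 N_big.
have [F [mF pF hF]] := colsum_event n1_gt0 n2_gt0 zeta_gt0 N_gt0 (in_CBISO01 HMs) Hobs lg_gt0.
have [mEF pEF] := prob_setCI mE mF pE pF.
exists (E `&` F); split => // w [Ew Fw] pih [BL [bBL tBL]].
exact: (row_bias n1_gt0 n2_gt0 N_gt0 zeta_gt0 lg_gt0 HMs bBL (hE w Ew BL bBL) tBL x_le1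
  (hF w Fw) y_le1).
Qed.

End RowsSide.

Section Assembly.
Context {R : realType}.

(** The terms come from the sorting of rows and of columns, the entrywise bound and three nets. Each
    surplus power of 1 / n gains a factor 3, since n >= 3. *)
Lemma failure_prob_le (n1 n2 : nat) (n : R) : (0 < n2)%N -> (n2 <= n1)%N -> (2 < n1 * n2)%N ->
  n = (n1 * n2)%:R ->
  8 * n ^- 4 + 2 * n2%:R * n ^- 6 + (8 * n ^- 4 + 2 * n1%:R * n ^- 6) + 2 * n * n ^- 6
    + n1%:R ^- 12 + n1%:R ^- 12 + n1%:R ^- 12 <= 10 * n ^- 3.
Proof.
move=> n20 n21 n3 nE.
have n10 : (0 < n1)%N by exact: leq_trans n21.
have np : 0 < n by rewrite nE ltr0n muln_gt0 n10.
have h12 : n1%:R ^- 12 <= n ^- 6 :> R.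
  rewrite lef_pV2 ?posrE ?exprn_gt0 ?ltr0n// nE -!natrX ler_nat (_ : 12 = 2 * 6)%N// expnM leq_exp2r//.
  by rewrite -mulnn leq_mul2l n21 orbT.
rewrite -!exprVn in h12 *.
set i := n^-1 in h12 *; have i0 : 0 < i by rewrite invr_gt0.
have i3 : i <= 3^-1 by rewrite lef_pV2 ?posrE// nE ler_nat.
have ni : n * i = 1 by rewrite divff// gt_eqF.
have a1 : n1%:R * i <= 1 by rewrite ler_pdivrMr// mul1r nE ler_nat leq_pmulr.
have a2 : n2%:R * i <= 1 by rewrite ler_pdivrMr// mul1r nE ler_nat leq_pmull.
have p k : 0 <= i ^+ k by rewrite exprn_ge0// ltW.
have s k : i ^+ k.+1 <= 3^-1 * i ^+ k by rewrite exprS; exact: ler_wpM2r.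
have b1 := ler_wpM2r (p 5) a1; have b2 := ler_wpM2r (p 5) a2.
have b3 : n * i ^+ 6 = i ^+ 5 by rewrite exprS mulrA ni mul1r.
have b4 : n1%:R * i ^+ 6 = n1%:R * i * i ^+ 5 by rewrite exprS mulrA.
have b5 : n2%:R * i ^+ 6 = n2%:R * i * i ^+ 5 by rewrite exprS mulrA.
move: (s 3%N) (s 4%N) (s 5%N) b1 b2 b3 b4 b5 h12 (p 3%N) (p 4%N).
move: (i ^+ 3) (i ^+ 4) (i ^+ 5) (i ^+ 6) (n1%:R^-1 ^+ 12) => i3' i4' i5' i6' m12.
by lra.
Qed.

(** 32 * 100 is 2 * 2 * 400, the splitting and the constant of [row_bias], times 2 for rows and
    columns together; 4 * 256 comes from (16 (zeta + 1))^2, and 8 from replacing [lg] by ln n1. *)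
Definition bias_const : R := 32 * 100 * (4 * 256) * 8.

Lemma vartheta_ge0 (N a b zeta : R) : 1 <= N -> 0 <= a -> 0 <= b -> 0 <= ln a -> 0 <= vartheta N a b zeta.
Proof.
move=> N1 a0 b0 l0.
have z0 : 0 <= zbar zeta by apply: (@le_trans _ _ 1) => //; rewrite /zbar le_max lexx orbT.
have N0 : 0 <= N by exact: le_trans N1.
have lN : 0 <= ln N by rewrite ln_ge0.
apply: addr_ge0; first by apply: mulr_ge0; [rewrite divr_ge0// mulr_ge0|exact: sqr_ge0].
rewrite !le_min powR_ge0 andbT; apply/andP; split.
  by apply: mulr_ge0; [rewrite divr_ge0// sqrtr_ge0|exact: sqr_ge0].
by apply: mulr_ge0 => //; rewrite divr_ge0// !mulr_ge0// sqr_ge0.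
Qed.

Lemma powR34 (x : R) : 0 <= x -> x `^ (3 / 4) = Num.sqrt (Num.sqrt x) ^+ 3.
Proof.
move=> x0; rewrite -!powR12_sqrt ?powR_ge0// -powR_mulrn ?powR_ge0// -!powRrM.
by congr (_ `^ _); field.
Qed.

Context {d : measure_display} {Omega : measurableType d}
  (P : probability Omega R) (n1 n2 : nat) (N zeta : R)
  (Ms : 'M[R]_(n1, n2)) (pis : 'S_n1) (sgs : 'S_n2) (Nn : Omega -> nat)
  (X : nat -> Omega -> 'I_n1 * 'I_n2) (z : nat -> Omega -> R)
  (S : nat -> Omega -> bool).
Hypothesis n2_gt0 : (0 < n2)%N.
Hypothesis n21 : (n2 <= n1)%N.
Hypothesis n_gt2 : (2 < n1 * n2)%N.
Hypothesis zeta_gt0 : 0 < zeta.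
Hypothesis HMs : in_CBISO pis sgs Ms.
Hypothesis Hobs : obs_model P N zeta Nn X z S.
Local Notation L := (lg R n1 n2).
Hypothesis N_big : 6 * (10 * 20) * (n1%:R * L) <= N.
Local Notation Y := (Ymat Ms Nn X z (fun _ _ => true) N).
Local Notation Y1 := (Ymat Ms Nn X z S (N / 2)).
Local Notation Y2 := (Ymat Ms Nn X z (fun l w => ~~ S l w) (N / 2)).
Local Notation zb := (zbar zeta).

Lemma size_facts : [/\ (1 < n1)%N, 2^-1 <= ln (n1%:R : R), ln n1%:R <= L & L <= 2 * ln n1%:R].
Proof.
have n11 : (1 < n1)%N.
  by rewrite ltnNge; apply/negP => h; have := leq_mul h (leq_trans n21 h); rewrite leqNgt (ltnW n_gt2).
split=> //; [exact: ln_nat_ge_half| |exact: lg_le_ln].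
rewrite /lg ler_ln ?posrE ?ltr0n ?muln_gt0 ?n2_gt0 ?(ltnW n11)//.
by rewrite ler_nat leq_pmulr.
Qed.

Lemma sample_size_facts : [/\ 0 < N, 6 * L <= N / (10 * 20), n1%:R * L / N <= 1, n2%:R * L / N <= 1
  & ln n1%:R <= ln N].
Proof.
have [n11 l1 lL _] := size_facts; have Nb := N_big.
have np : 1 <= n1%:R :> R by rewrite ler1n ltnW.
have n2p : n2%:R <= n1%:R :> R by rewrite ler_nat.
have L1 : 2^-1 <= L by lra.
have nL : L <= n1%:R * L by rewrite ler_peMl//; lra.
have nL2 : n2%:R * L <= n1%:R * L by apply: ler_wpM2r => //; lra.
have nL3 := ler_wpM2l (le_trans ler01 np) L1.
have N0 : 0 < N by lra.
split=> //.
- by rewrite ler_pdivlMr; lra.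
- by rewrite ler_pdivrMr// mul1r; lra.
- by rewrite ler_pdivrMr// mul1r; lra.
- by rewrite ler_ln ?posrE//; lra.
Qed.

Lemma bias_event : exists E : set Omega, [/\ measurable E,
  (P (~` E) <= (8 * (n1 * n2)%:R ^- 4 + 2 * n2%:R * (n1 * n2)%:R ^- 6
     + (8 * (n1 * n2)%:R ^- 4 + 2 * n1%:R * (n1 * n2)%:R ^- 6))%:E)%E &
  forall w, E w -> forall pih sgh, tds_rows N zeta (Y1 w) (Y2 w) pih ->
    tds_rows N zeta (Y1 w)^T (Y2 w)^T sgh ->
    forall B0, is_BISO B0 -> Ms = Defs.permM B0 pis sgs ->
    frob2 (Ms - Defs.permM B0 pih sgh) <= (n1 * n2)%:R *
      (bias_const * (zb ^+ 2 * Num.sqrt (Num.sqrt (n1%:R * ln n1%:R / N)) ^+ 3))].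
Proof.
have [n11 l1 lL L2l] := size_facts; have [N0 Nb xL yL _] := sample_size_facts.
have n10 : (0 < n1)%N by exact: ltnW.
have L0 : 0 < L by lra.
have lC : lg R n2 n1 = L by rewrite /lg mulnC.
have [E [mE pE hE]] := row_bias_event n10 n2_gt0 zeta_gt0 N0 HMs Hobs L0 Nb xL yL.
have [F [mF pF hF]] : exists F : set Omega, [/\ measurable F,
    (P (~` F) <= (8 * (n2 * n1)%:R ^- 4 + 2 * n1%:R * (n2 * n1)%:R ^- 6)%:E)%E &
    forall w, F w -> forall sgh, tds_rows N zeta (Ymat Ms^T Nn (swapX X) z S (N / 2) w)
       (Ymat Ms^T Nn (swapX X) z (fun l w => ~~ S l w) (N / 2) w) sgh ->
    \sum_j \sum_i rowgap Ms^T sgs sgh j i ^+ 2 <= 20 * 20 * (16 * (zeta + 1)) ^+ 2 * n2%:R * n1%:R *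
      (Num.sqrt (Num.sqrt (n2%:R * L / N)) ^+ 3
       + Num.sqrt (Num.sqrt (n2%:R * L / N)) * Num.sqrt (n1%:R * L / N))].
  rewrite -lC; apply: (row_bias_event n2_gt0 n10 zeta_gt0 N0 (in_CBISO_tr HMs) (obs_model_tr Hobs));
    by rewrite lC.
rewrite [(n2 * n1)%N]mulnC in pF.
have [mEF pEF] := prob_setCI mE mF pE pF.
exists (E `&` F); split => // w [Ew Fw] pih sgh hpi hsg B0 HB0 eMs.
apply: (le_trans (bias_split pih sgh eMs)).
have h1 := hE w Ew pih hpi.
have hsg' : tds_rows N zeta (Ymat Ms^T Nn (swapX X) z S (N / 2) w)
       (Ymat Ms^T Nn (swapX X) z (fun l w => ~~ S l w) (N / 2) w) sgh by rewrite !Ymat_tr.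
have h2 := hF w Fw sgh hsg'.
set x := n1%:R * ln n1%:R / N; set y := Num.sqrt (Num.sqrt x).
set w1 := Num.sqrt (Num.sqrt (n1%:R * L / N)) in h1.
set w2 := Num.sqrt (Num.sqrt (n2%:R * L / N)) in h2.
set v1 := Num.sqrt (n1%:R * L / N) in h2; set v2 := Num.sqrt (n2%:R * L / N) in h1.
have n12r : n2%:R * L / N <= n1%:R * L / N.
  by apply: ler_wpM2r; [rewrite invr_ge0 ltW|apply: ler_wpM2r; [exact: ltW|rewrite ler_nat]].
have w10 : 0 <= w1 by exact: sqrtr_ge0. have w20 : 0 <= w2 by exact: sqrtr_ge0.
have v1E : v1 = w1 ^+ 2 by rewrite /w1 sqr_sqrtr// sqrtr_ge0.
have v2l : v2 <= w1 ^+ 2 by rewrite -v1E; exact: ler_wsqrtr.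
have w21 : w2 <= w1 by apply: ler_wsqrtr; exact: ler_wsqrtr.
have y0 : 0 <= y by exact: sqrtr_ge0.
have x0 : 0 <= x by rewrite divr_ge0 ?(ltW N0)// mulr_ge0//; lra.
have xL0 : 0 <= n1%:R * L / N by rewrite divr_ge0 ?(ltW N0)// mulr_ge0//; exact: ltW.
have y4 : y ^+ 4 = x by rewrite (exprM _ 2 2) sqr_sqrtr ?sqrtr_ge0// sqr_sqrtr.
have w4 : w1 ^+ 4 = n1%:R * L / N by rewrite (exprM _ 2 2) sqr_sqrtr ?sqrtr_ge0// sqr_sqrtr.
have wy : w1 <= 2 * y.
  rewrite -(@ler_pXn2r _ 4) ?nnegrE// ?mulr_ge0// exprMn y4 w4.
  have : n1%:R * L / N <= 2 * x.
    rewrite /x mulrA; apply: ler_wpM2r; first by rewrite invr_ge0 ltW.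
    by rewrite mulrCA; apply: ler_wpM2l.
  by move: x0; lra.
have w3 : w1 ^+ 3 <= 8 * y ^+ 3.
  have -> : 8 * y ^+ 3 = (2 * y) ^+ 3 by ring.
  by rewrite lerXn2r ?nnegrE ?mulr_ge0.
have e1 : w1 ^+ 3 + w1 * v2 <= 2 * w1 ^+ 3.
  by have := ler_wpM2l w10 v2l; rewrite -exprS; lra.
have e2 : w2 ^+ 3 + w2 * v1 <= 2 * w1 ^+ 3.
  have a1 : w2 ^+ 3 <= w1 ^+ 3 by rewrite lerXn2r ?nnegrE.
  have a2 : w2 * v1 <= w1 ^+ 3 by rewrite exprS v1E; apply: ler_wpM2r => //; exact: sqr_ge0.
  by move: a1 a2; lra.
have zb1 : 1 <= zb by rewrite /zbar le_max lexx orbT.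
have zz : zeta <= zb by rewrite /zbar le_max lexx.
have zp := zeta_gt0.
set T := (16 * (zeta + 1)) ^+ 2 in h1 h2.
have T0 : 0 <= T by exact: sqr_ge0.
have Tz : T <= 4 * 256 * zb ^+ 2.
  have -> : 4 * 256 * zb ^+ 2 = (16 * (2 * zb)) ^+ 2 by ring.
  by apply: lerXn2r; rewrite ?nnegrE; lra.
set q : R := (n1 * n2)%:R; have q0 : 0 <= q by [].
have qE : q = n1%:R * n2%:R by rewrite /q natrM.
have TQ0 : 0 <= T * q by rewrite mulr_ge0.
have f1 := ler_wpM2l TQ0 e1; have f2 := ler_wpM2l TQ0 e2.
have f3 := ler_wpM2l TQ0 w3.
have f4 : T * q * y ^+ 3 <= 4 * 256 * zb ^+ 2 * q * y ^+ 3.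
  by apply: ler_wpM2r; [exact: exprn_ge0|exact: ler_wpM2r].
have g1 : \sum_i \sum_j rowgap Ms pis pih i j ^+ 2 <= 20 * 20 * (T * q * (w1 ^+ 3 + w1 * v2)).
  by apply: (le_trans h1); rewrite qE le_eqVlt; apply/orP; left; apply/eqP; ring.
have g2 : \sum_j \sum_i rowgap Ms^T sgs sgh j i ^+ 2 <= 20 * 20 * (T * q * (w2 ^+ 3 + w2 * v1)).
  by apply: (le_trans h2); rewrite qE le_eqVlt; apply/orP; left; apply/eqP; ring.
move: g1 g2 f1 f2 f3 f4; rewrite /bias_const.
move: (\sum_i \sum_j rowgap Ms pis pih i j ^+ 2) (\sum_j \sum_i rowgap Ms^T sgs sgh j i ^+ 2) => r1 r2.
move: (w1 ^+ 3 + w1 * v2) (w2 ^+ 3 + w2 * v1) (w1 ^+ 3) (y ^+ 3) (zb ^+ 2) => u1 u2 u3 u4 u5.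
by lra.
Qed.

Lemma lossF_event : exists E : set Omega, [/\ measurable E,
  (P (~` E) <= (10 * (n1 * n2)%:R ^- 3)%:E)%E &
  forall w, E w -> forall pih sgh, tds_rows N zeta (Y1 w) (Y2 w) pih ->
    tds_rows N zeta (Y1 w)^T (Y2 w)^T sgh ->
    forall Mh, in_CBISO pih sgh Mh ->
    (forall M, in_CBISO pih sgh M -> frob2 (Y w - Mh) <= frob2 (Y w - M)) ->
    lossF Ms Mh <= 101 * (18 * bias_const + 10 * 100 * (100 * 100))
      * (zb ^+ 2 * Num.sqrt (Num.sqrt (n1%:R * ln n1%:R / N)) ^+ 3 + vartheta N n1%:R n2%:R zeta)].
Proof.
have [n11 l1 lL L2l] := size_facts; have [N0 Nb xL yL lN] := sample_size_facts.
have n10 : (0 < n1)%N by exact: ltnW.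
have L0 : 0 < L by lra.
have M01 := in_CBISO01 HMs.
have [E1 [mE1 pE1 hE1]] := bias_event.
have [E2 [mE2 pE2 hE2]] := entry_event n10 n2_gt0 zeta_gt0 N0 M01 Hobs L0.
have net m := net_event n10 n2_gt0 zeta_gt0 N0 M01 Hobs m n11 n21.
have [E3 [mE3 pE3 hE3]] := net (10 * n1)%N.
have [E4 [mE4 pE4 hE4]] := net (8 * n2 * dlog n1)%N.
(* The number of slices depends on N, zeta and the dimensions only, so this net is fixed before the
   data. *)
have [E5 [mE5 pE5 hE5]] :=
  net (45 * (n2 * Num.truncn ((zb ^+ 2 * n2%:R / N * ln n1%:R) `^ 3^-1)^-1))%N.
have [mA pA] := prob_setCI mE1 mE2 pE1 pE2.
have [mB pB] := prob_setCI mA mE3 pA pE3.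
have [mC pC] := prob_setCI mB mE4 pB pE4.
have [mD pD] := prob_setCI mC mE5 pC pE5.
exists (E1 `&` E2 `&` E3 `&` E4 `&` E5); split => //.
  by apply: (le_trans pD); rewrite lee_fin; exact: (failure_prob_le n2_gt0 n21 n_gt2 erefl).
move=> w [[[[w1 w2] w3] w4] w5] pih sgh hpi hsg Mh [B1 [HB1 eMh]] hmin.
have [B0 [HB0 eMs]] := HMs.
have Cb0 : 0 <= bias_const by rewrite /bias_const -!natrM ler0n.
have x1 : n1%:R * ln n1%:R / N <= 1.
  apply: le_trans xL; apply: ler_wpM2r; first by rewrite invr_ge0 ltW.
  by apply: ler_wpM2l.
have HLS : frob2 (Y w - Defs.permM B1 pih sgh) <= frob2 (Y w - Defs.permM B0 pih sgh).
  by rewrite -eMh; apply: hmin; exists B0.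
have Hb := hE1 w w1 pih sgh hpi hsg B0 HB0 eMs.
rewrite eMh.
exact: (lossF_vartheta_le n11 n2_gt0 n21 N0 zeta_gt0 Cb0 x1 HB0 HB1 M01 HLS Hb (hE3 w w3 pih sgh)
  (hE4 w w4 pih sgh) (hE5 w w5 pih sgh) (hE2 w w2) L0 L2l lN).
Qed.

End Assembly.

(** * Degenerate regimes and conclusion *)

Lemma prob_set0_ge {R : realType} {d : measure_display} {Omega : measurableType d}
    (P : probability Omega R) (n : nat) (c : R) : (0 < n)%N -> (n <= 2)%N -> 8 <= c ->
  ((1 - c * n%:R ^- 3)%:E <= P set0)%E.
Proof.
move=> n0 n2 c8; rewrite measure0 lee_fin subr_le0 ler_pdivlMr ?exprn_gt0 ?ltr0n// mul1r.
apply: le_trans c8; rewrite -natrX ler_nat (_ : 8 = 2 ^ 3)%N//.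
by rewrite leq_exp2r.
Qed.

Lemma prob_setT_ge {R : realType} {d : measure_display} {Omega : measurableType d}
    (P : probability Omega R) (c : R) : 0 <= c -> ((1 - c)%:E <= P setT)%E.
Proof. by move=> c0; rewrite probability_setT lee_fin gerBl. Qed.

(** Below the sample size needed for sorting, n1 ln n1 / N is at least a constant, and large enough
    constants make the claimed bounds trivial. *)
Lemma small_sample {R : realType} (n1 n2 : nat) (N : R) : (0 < n2)%N -> (n2 <= n1)%N ->
  1 <= N -> N < 6 * (10 * 20) * (n1%:R * lg R n1 n2) ->
  (20 * 20)^-1 ^+ 2 <= n1%:R * ln n1%:R / N.
Proof.
move=> n20 n21 N1 Nb; have h := @lg_le_ln R _ _ n20 n21.
have h2 := ler_wpM2l (ler0n R n1) h.
rewrite ler_pdivlMr; last by lra.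
have -> : (20 * 20)^-1 ^+ 2 * N = N / (20 * 20) ^+ 2 :> R by rewrite mulrC exprVn.
rewrite ler_pdivrMr; last by apply: exprn_gt0; lra.
by move: h2 Nb; lra.
Qed.

Theorem theorem4 (R : realType) :
  (exists c1 : R, 0 < c1 /\
    forall (n1 n2 : nat) (N zeta : R) (d : measure_display)
      (Omega : measurableType d) (P : probability Omega R)
      (Ms : 'M[R]_(n1, n2)) (pis : 'S_n1) (sgs : 'S_n2)
      (Nn : Omega -> nat) (X : nat -> Omega -> 'I_n1 * 'I_n2)
      (z : nat -> Omega -> R) (S : nat -> Omega -> bool),
    (0 < n2)%N -> (n2 <= n1)%N -> 1 <= N -> 0 < zeta ->
    in_CBISO pis sgs Ms ->
    obs_model P N zeta Nn X z S ->
    let Y1 := Ymat Ms Nn X z S (N / 2) in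
    let Y2 := Ymat Ms Nn X z (fun l w => ~~ S l w) (N / 2) in
    exists E : set Omega, measurable E /\
      E `<=` [set w | forall pih : 'S_n1, tds_rows N zeta (Y1 w) (Y2 w) pih ->
                lossR Ms pis sgs pih
                <= Num.min 1 (c1 * zbar zeta ^+ 2 * Num.sqrt (n1%:R * ln n1%:R / N))] /\
      ((1 - 9 * ((n1 * n2)%:R) ^- 3)%:E <= P E)%E)
  /\
  (exists c2 : R, 0 < c2 /\
    forall (n1 n2 : nat) (N zeta : R) (d : measure_display)
      (Omega : measurableType d) (P : probability Omega R)
      (Ms : 'M[R]_(n1, n2)) (pis : 'S_n1) (sgs : 'S_n2)
      (Nn : Omega -> nat) (X : nat -> Omega -> 'I_n1 * 'I_n2)
      (z : nat -> Omega -> R) (S : nat -> Omega -> bool),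
    (0 < n2)%N -> (n2 <= n1)%N -> 1 <= N -> 0 < zeta ->
    in_CBISO pis sgs Ms ->
    obs_model P N zeta Nn X z S ->
    let Y := Ymat Ms Nn X z (fun _ _ => true) N in
    let Y1 := Ymat Ms Nn X z S (N / 2) in
    let Y2 := Ymat Ms Nn X z (fun l w => ~~ S l w) (N / 2) in
    exists E : set Omega, measurable E /\
      E `<=` [set w | forall (pih : 'S_n1) (sgh : 'S_n2),
                tds_rows N zeta (Y1 w) (Y2 w) pih ->
                tds_rows N zeta (Y1 w)^T (Y2 w)^T sgh ->
                forall Mh : 'M[R]_(n1, n2),
                  in_CBISO pih sgh Mh ->
                  (forall M, in_CBISO pih sgh M -> frob2 (Y w - Mh) <= frob2 (Y w - M)) ->
                  lossF Ms Mh
                  <= Num.min 1 (c2 * (zbar zeta ^+ 2 * (n1%:R * ln n1%:R / N) `^ (3 / 4)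
                                      + vartheta N n1%:R n2%:R zeta))] /\
      ((1 - 10 * ((n1 * n2)%:R) ^- 3)%:E <= P E)%E).
Proof.
split.
  (* Large samples need 6 * 16 * 2 * 2 = 384; for small samples 20 * 20 cancels the lower bound of
     [small_sample] under the root. *)
  exists (20 * 20); split; first by lra.
  move=> n1 n2 N zeta d Omega P Ms pis sgs Nn X z S n20 n21 N1 z0 HMs Hobs /=.
  have n10 : (0 < n1)%N by exact: leq_trans n21.
  have [n2s|n_gt2] := leqP (n1 * n2) 2.
    exists set0; split => //; split; first by [].
    by apply: prob_set0_ge => //; [rewrite muln_gt0 n10|lra].
  have zb1 : 1 <= zbar zeta by rewrite /zbar le_max lexx orbT.
  have zb2 : zbar zeta <= zbar zeta ^+ 2 by rewrite expr2 ler_peMl//; lra.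
  have zz : zeta <= zbar zeta by rewrite /zbar le_max lexx.
  have np : 0 < (n1 * n2)%:R :> R by rewrite ltr0n muln_gt0 n10.
  have [Nb|Nb] := leP (6 * (10 * 20) * (n1%:R * lg R n1 n2)) N; last first.
    exists setT; split => //; split; last by apply: prob_setT_ge; rewrite divr_ge0// exprn_ge0.
    move=> w _ /= pih _; apply: (le_trans (lossR_le1 pih n20 HMs)).
    rewrite le_min lexx /=.
    have h : (20 * 20)^-1 <= Num.sqrt (n1%:R * ln n1%:R / N) :> R.
      have g : 0 <= (20 * 20)^-1 :> R by rewrite invr_ge0; lra.
      rewrite -(ger0_norm g) -sqrtr_sqr; apply: ler_wsqrtr.
      exact: small_sample n20 n21 N1 Nb.
    apply: (@le_trans _ _ (20 * 20 * 1 * (20 * 20)^-1)).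
      by rewrite mulr1 divff// gt_eqF//; lra.
    by apply: ler_pM; rewrite ?invr_ge0//; lra.
  have [n11 l1 lL L2l] := @size_facts R _ _ n20 n21 n_gt2.
  have [N0 N6 xL _ _] := sample_size_facts n20 n21 n_gt2 Nb.
  have L0 : 0 < lg R n1 n2 by lra.
  have [E [mE pE hE]] := lossR_event n10 n20 z0 N0 HMs Hobs L0 N6 xL.
  exists E; split => //; split; last first.
    apply: le_trans (prob_ge mE pE); rewrite lee_fin lerD2l lerN2.
    rewrite exprS invfM mulrA; apply: ler_wpM2r; first by rewrite invr_ge0 exprn_ge0// ltW.
    rewrite ler_pdivrMr//.
    by have : 1 <= (n1 * n2)%:R :> R by [rewrite ler1n muln_gt0 n10]; lra.
  move=> w Ew /= pih hpi; apply: (le_trans (hE w Ew pih hpi)).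
  rewrite le_min ge_min lexx /= ge_min; apply/orP; right.
  set s := Num.sqrt (n1%:R * ln n1%:R / N).
  have s0 : 0 <= s by exact: sqrtr_ge0.
  have hs : Num.sqrt (n1%:R * lg R n1 n2 / N) <= 2 * s.
    have e2 : 2 = Num.sqrt (2 ^+ 2) :> R by rewrite sqrtr_sqr ger0_norm.
    rewrite [X in _ <= X * _]e2 /s -sqrtrM ?sqr_ge0//; apply: ler_wsqrtr.
    rewrite mulrA; apply: ler_wpM2r; first by rewrite invr_ge0; lra.
    have := ler_wpM2l (ler0n R n1) L2l.
    have : 0 <= n1%:R * ln n1%:R :> R by apply: mulr_ge0 => //; lra.
    by lra.
  apply: (@le_trans _ _ (6 * (16 * (2 * zbar zeta)) * (2 * s))).
    by apply: ler_pM => //; rewrite ?sqrtr_ge0//; lra.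
  have := ler_wpM2r s0 zb2; have : 0 <= zbar zeta * s by apply: mulr_ge0 => //; lra.
  by lra.
pose c2 : R := 101 * (18 * bias_const + 10 * 100 * (100 * 100)).
(* For small samples y^3 is at least (20 * 20)^-2, so from this size on the constant makes the bound
   trivial. *)
have c2b : 20 * 20 * (20 * 20) <= c2 by rewrite /c2 /bias_const; lra.
exists c2; split; first by lra.
move=> n1 n2 N zeta d Omega P Ms pis sgs Nn X z S n20 n21 N1 z0 HMs Hobs /=.
have n10 : (0 < n1)%N by exact: leq_trans n21.
have [n2s|n_gt2] := leqP (n1 * n2) 2.
  exists set0; split => //; split; first by [].
  by apply: prob_set0_ge => //; [rewrite muln_gt0 n10|lra].
have zb1 : 1 <= zbar zeta by rewrite /zbar le_max lexx orbT.
have np : 0 < (n1 * n2)%:R :> R by rewrite ltr0n muln_gt0 n10.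
have l0 : 0 <= ln n1%:R :> R by rewrite ln_ge0// ler1n.
have x0 : 0 <= n1%:R * ln n1%:R / N by rewrite divr_ge0 ?mulr_ge0//; lra.
have [Nb|Nb] := leP (6 * (10 * 20) * (n1%:R * lg R n1 n2)) N; last first.
  exists setT; split => //; split; last by apply: prob_setT_ge; rewrite divr_ge0// exprn_ge0.
  move=> w _ /= pih sgh _ _ Mh HMh _; apply: (le_trans (in_CBISO_lossF_le1 n10 n20 HMs HMh)).
  rewrite le_min lexx /= powR34//.
  have v0 := vartheta_ge0 zeta N1 (ler0n R n1) (ler0n R n2) l0.
  have hx := small_sample n20 n21 N1 Nb.
  set x := n1%:R * ln n1%:R / N in x0 hx *; set y := Num.sqrt (Num.sqrt x).
  have y0 : 0 <= y by exact: sqrtr_ge0.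
  have y4 : y ^+ 4 = x by rewrite (exprM _ 2 2) sqr_sqrtr ?sqrtr_ge0// sqr_sqrtr.
  have hy : (20 * 20)^-1 ^+ 2 <= y ^+ 3.
    have [y1|y1] := leP y 1.
      by apply: (le_trans hx); rewrite -y4 exprS ler_piMl// exprn_ge0.
    apply: (@le_trans _ _ 1); last by rewrite exprn_ege1// ltW.
    by apply: exprn_ile1; rewrite ?invr_ge0 ?invf_le1//; lra.
  have hz : y ^+ 3 <= zbar zeta ^+ 2 * y ^+ 3 by rewrite ler_peMl ?exprn_ge0// exprn_ege1.
  apply: (@le_trans _ _ (c2 * (20 * 20)^-1 ^+ 2)).
    rewrite exprVn ler_pdivlMr; last by apply: exprn_gt0; lra.
    by rewrite mul1r expr2.
  by apply: ler_wpM2l; lra.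
have [E [mE pE hE]] := lossF_event n20 n21 n_gt2 z0 HMs Hobs Nb.
exists E; split => //; split; last exact: prob_ge.
move=> w Ew /= pih sgh hpi hsg Mh HMh hmin; rewrite le_min (in_CBISO_lossF_le1 n10 n20 HMs HMh) /=.
by rewrite powR34//; exact: (hE w Ew pih sgh hpi hsg Mh HMh hmin).
Qed.
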